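(* In the Gaussian equi-correlated model, there exists a universal positive constant $c$ such that the following holds for any integer $n\ge2$, any $\alpha\in(0,0.4)$, any $\rho\in[0,1)$, any $m\in\mathbb R_+^n$ and any integer $k_0$ with $n_1(m)\le k_0\le0.9n$. (i) The procedure $\mathrm{BH}_\alpha(\widetilde\theta_+,\widetilde\sigma_+)$ satisfies $$\Big(\mathbb E_{m,\rho}\big(\mathrm{FDP}(m,\mathrm{BH}_\alpha(\widetilde\theta_+,\widetilde\sigma_+))\big)-\frac{n_0(m)}{n}\alpha\Big)_+\le c\,\frac{\log n}{n^{1/16}}.$$ Moreover, for any sequence $\epsilon_n\in(0,1)$ tending to zero with $\epsilon_n\gg\log^{-1/2}(n)$ (i.e. $\epsilon_n\log^{1/2}(n)\to\infty$), and any sequences $m_n\in\mathbb R_+^n$ and $k_0=k_{0,n}\le0.9n$ with $n_1(m_n)\le k_{0,n}$ and $n_1(m_n)/n\asymp k_{0,n}/n$, $$\limsup_n\Big\{\mathbb E'\big(\mathrm{TDP}(m_n,\mathrm{BH}_\alpha)\big)-\mathbb E_{m_n,\rho}\big(\mathrm{TDP}(m_n,\mathrm{BH}_{\alpha(1+\epsilon_n)}(\widetilde\theta_+,\widetilde\sigma_+))\big)\Big\}\le0,$$ where $\mathbb E'$ denotes the expectation in the equi-correlated model with correlation $\rho'=0$ (independence) and mean $m'_n=m_n(1-\rho)^{-1/2}$, and $\mathrm{BH}_\alpha=\mathrm{BH}_\alpha(0,1)$ is the procedure based on the classical $p$-values $\overline\Phi(Y_i)$. (ii) The bound $\overline{\mathrm{FDP}}(\cdot;\widetilde\theta_+,\widetilde\sigma_+)$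 satisfies $$\Big(1-\alpha-\mathbb P_{m,\rho}\big(\forall S\subset\{1,\dots,n\},\ \mathrm{FDP}(m,S)\le\overline{\mathrm{FDP}}(S;\widetilde\theta_+,\widetilde\sigma_+)\big)\Big)_+\le c\,\frac{\log n}{n^{1/16}}.$$
   Context: Gaussian equi-correlated model: $Y\sim\mathcal N(m,\Gamma)$ in $\mathbb R^n$ with $\Gamma_{ii}=1$ and $\Gamma_{ij}=\rho$ for $i\ne j$; $\mathbb P_{m,\rho},\mathbb E_{m,\rho}$ denote probability and expectation. One tests simultaneously $H_{0,i}:m_i=0$ against $H_{1,i}:m_i>0$. $\mathcal H_0(m)=\{i:m_i=0\}$, $\mathcal H_1(m)=\{i:m_i>0\}$, $n_0(m)=|\mathcal H_0(m)|$, $n_1(m)=|\mathcal H_1(m)|$. For $R\subset\{1,\dots,n\}$, $\mathrm{FDP}(m,R)=\frac{|R\cap\mathcal H_0(m)|}{|R|\vee1}$ and $\mathrm{TDP}(m,R)=\frac{|R\cap\mathcal H_1(m)|}{n_1(m)\vee1}$. $Y_{(q)}$ is the $q$-th smallest of $Y_1,\dots,Y_n$; $\overline\Phi$ is the upper tail function of $\mathcal N(0,1)$. With $q_n=\lfloor n^{3/4}\rfloor$, $q'_n=\lfloor n^{1/4}\rfloor$ and tuning parameter $k_0$, $$\widetilde\sigma_+=\frac{Y_{(q_n)}-Y_{(q'_n)}}{\overline\Phi^{-1}(q'_n/(n-k_0))-\overline\Phi^{-1}(q_n/n)},\qquad \widetilde\theta_+=Y_{(q_n)}+\widetilde\sigma_+\,\overline\Phi^{-1}(q_n/n)$$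 (for the finitely many small $n$ for which this is ill-defined, any convention may be used). For $u\in\mathbb R$, $s>0$, $p_i(u,s)=\overline\Phi((Y_i-u)/s)$; $0=p_{(0)}(u,s)\le p_{(1)}(u,s)\le\dots\le p_{(n)}(u,s)$ are the ordered values. $\widehat\ell_\alpha(u,s)=\max\{\ell\in\{0,\dots,n\}:\ p_{(\ell)}(u,s)\le\alpha\ell/n\}$ and $\mathrm{BH}_\alpha(u,s)=\{i:\ p_i(u,s)\le\alpha\widehat\ell_\alpha(u,s)/n\}$. For $S\subset\{1,\dots,n\}$, $$\overline{\mathrm{FDP}}(S;u,s)=1\wedge\Big\{\min_{\ell\in\{1,\dots,n\}}\Big(\sum_{i\in S}\mathbf 1\{p_i(u,s)>\alpha\ell/n\}+\ell-1\Big)\Big/(|S|\vee1)\Big\}.$$ $(x)_+=\max(x,0)$; $u_n\asymp v_n$ means each is bounded by a positive constant (not depending on $n$) times the other. *)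

(* Defs.v *)
From HB Require Import structures.
From mathcomp Require Export all_boot all_order all_algebra.
From mathcomp Require Export all_classical all_reals all_analysis.
Set Implicit Arguments.
Unset Strict Implicit.
Unset Printing Implicit Defensive.
Import Order.TTheory GRing.Theory Num.Theory.
Import numFieldNormedType.Exports.
Local Open Scope classical_set_scope.
Local Open Scope ring_scope.

Section GaussianVector.
Context {R : realType}.

(* The Lebesgue integral over R^n as an iterated integral, used below only for
   nonnegative measurable functions (Tonelli). *)
Fixpoint lebesgue_int (n : nat) : (n.-tuple R -> \bar R) -> \bar R :=
  match n with
  | 0 => fun f => f [tuple]
  | n'.+1 => fun f =>
      (\int[lebesgue_measure]_x lebesgue_int (fun t => f [tuple of x :: t]))%E
  end.

(* Density of N(m, G) for a positive definite covariance matrix G. *)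
Definition multinormal_pdf (n : nat) (m : 'rV[R]_n) (G : 'M[R]_n)
    (y : n.-tuple R) : R :=
  let z := \row_i (tnth y i - m 0 i) in
  (Num.sqrt ((2 * pi) ^+ n * \det G))^-1
    * expR (- (z *m invmx G *m z^T) 0 0 / 2).

Definition gaussian_vector d (T : measurableType d) (P : probability T R)
    (n : nat) (Y : {RV P >-> n.-tuple R}) (m : 'rV[R]_n) (G : 'M[R]_n) : Prop :=
  forall B : set (n.-tuple R), measurable B ->
    distribution P Y B =
    lebesgue_int (fun y => (\1_B y * multinormal_pdf m G y)%:E).

Definition equicorr (n : nat) (rho : R) : 'M[R]_n :=
  \matrix_(i, j) (if i == j then 1 else rho).

End GaussianVector.

Definition qn (R : realType) (n : nat) : nat :=
  Num.truncn (n%:R `^ (3 / 4) : R).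
Definition qn' (R : realType) (n : nat) : nat :=
  Num.truncn (n%:R `^ (1 / 4) : R).

Section Procedures.
Context {R : realType}.

Definition Phibar (x : R) : R := fine (normal_prob 0 1 `]x, +oo[).

(* Phibar is a decreasing bijection from R onto ]0, 1[; outside ]0, 1[ the
   value is 0. *)
Definition Phibar_inv (t : R) : R := xget 0 [set x | Phibar x = t].

Definition H0 (n : nat) (m : 'rV[R]_n) : {set 'I_n} := [set i | m 0 i == 0].
Definition H1 (n : nat) (m : 'rV[R]_n) : {set 'I_n} := [set i | 0 < m 0 i].
Definition n0 (n : nat) (m : 'rV[R]_n) : nat := #|H0 m|.
Definition n1 (n : nat) (m : 'rV[R]_n) : nat := #|H1 m|.

Definition FDP (n : nat) (m : 'rV[R]_n) (S : {set 'I_n}) : R :=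
  #|S :&: H0 m|%:R / (maxn #|S| 1)%:R.
Definition TDP (n : nat) (m : 'rV[R]_n) (S : {set 'I_n}) : R :=
  #|S :&: H1 m|%:R / (maxn (n1 m) 1)%:R.

(* Y_(q), for 1 <= q <= n *)
Definition order_stat (n : nat) (y : n.-tuple R) (q : nat) : R :=
  nth 0 (sort <=%R y) q.-1.

(* When k0 <= 0.9 n, both quantiles are taken in ]0, 1[ and the denominator of
   sigma_plus is positive for all but finitely many n; for the other n the
   conventions are those of Phibar_inv and of division by 0. *)
Definition sigma_plus (n k0 : nat) (y : n.-tuple R) : R :=
  (order_stat y (qn R n) - order_stat y (qn' R n))
  / (Phibar_inv ((qn' R n)%:R / (n%:R - k0%:R))
     - Phibar_inv ((qn R n)%:R / n%:R)).
Definition theta_plus (n k0 : nat) (y : n.-tuple R) : R :=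
  order_stat y (qn R n) + sigma_plus k0 y * Phibar_inv ((qn R n)%:R / n%:R).

Definition pval (n : nat) (y : n.-tuple R) (u s : R) (i : 'I_n) : R :=
  Phibar ((tnth y i - u) / s).

(* p_(l), for 0 <= l <= n, with p_(0) = 0 *)
Definition pval_ord (n : nat) (y : n.-tuple R) (u s : R) (l : nat) : R :=
  nth 0 (0 :: sort <=%R [seq pval y u s i | i <- enum 'I_n]) l.

Definition BH_count (n : nat) (alpha u s : R) (y : n.-tuple R) : nat :=
  \max_(l < n.+1 | pval_ord y u s l <= alpha * l%:R / n%:R) l.

Definition BH (n : nat) (alpha u s : R) (y : n.-tuple R) : {set 'I_n} :=
  [set i | pval y u s i <= alpha * (BH_count alpha u s y)%:R / n%:R].

(* The minimum with 1 is the initial value of the iterated minimum. *)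
Definition FDPbar (n : nat) (alpha u s : R) (y : n.-tuple R)
    (S : {set 'I_n}) : R :=
  \big[Num.min/1]_(1 <= l < n.+1)
    ((\sum_(i in S) (alpha * l%:R / n%:R < pval y u s i)%R%:R + l%:R - 1)
     / (maxn #|S| 1)%:R).

(* Sequences are only considered from n = 2 on. *)
Definition asymp (u v : nat -> R) : Prop :=
  exists2 C : R, 0 < C & forall n, (2 <= n)%N ->
    u n <= C * v n /\ v n <= C * u n.

End Procedures.

(* Main.v *)
(* Up to an affine change of coordinates the equi-correlated model is an
   independent Gaussian sample with a common random shift, and the procedures
   are invariant under that shift, so everything reduces to independent standard
   normal coordinates translated by m / sqrt(1 - rho).

   Writing n = exp(s^2), binomial (Chebyshev) deviations of the order statistics
   show that, off an event of probability O(n^(-1/16)), theta_+ and sigma_+ are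
   at least -O(delta / s) and 1 - O(delta / s^2) with delta = n^(-3/32). There
   the step-up thresholds move by a relative O(delta), and a leave-one-out
   argument bounds the false discovery proportion; applied to the null
   coordinates alone it gives Simes' inequality, hence the bound for FDPbar.

   For the power, theta_+ and sigma_+ are also at most O(r / s) and
   1 + O(r / s^2) up to delta, with r = k0 / n. If the oracle rejects a
   non-negligible part of the alternatives its threshold is at least of order r,
   so that its quantile x satisfies r (x + 1) = O(1), and the rescaling inflates
   p-values near the threshold by a factor 1 + O(1 / s), which is absorbed by
   1 + eps_n. *)
From HB Require Import structures.
Require Import Defs.
From mathcomp Require Import measurable_realfun ring lra.
Set Implicit Arguments.
Unset Strict Implicit.
Unset Printing Implicit Defensive.
Import Order.TTheory GRing.Theory Num.Theory.
Import numFieldNormedType.Exports.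
Local Open Scope classical_set_scope.
Local Open Scope ring_scope.

(** The model is given only through its density, so its decomposition into a common factor and
    independent noise has to be recovered: the density is identified as a normal mixture over the
    common factor, and the normalizing constants agree because both sides have total mass one.

    The obstacle in the leave-one-out argument is that [theta_plus] and [sigma_plus] depend on every
    coordinate, the tested one included. On a good fit, however, a rejected coordinate lies strictly
    above [Y_(q_n)], hence above both order statistics from which the estimators are computed, and
    these do not feel where it lies up there.

    Precision is governed by one quantity: moving a statistic near the quantile [x] by [h] changes
    its p-value by a relative amount of order [h * (x + 1)]. The quantiles at play are at most of
    order [s = sqrt (ln n)] and the shifts [h] of order [delta / s], so the product is of order
    [delta]. Levels below 0.4 keep [x] away from 0; a value of [alpha] below [1 / n] is first raised
    to [1 / n], so that [x] stays of order [s]. *)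

(** * Integration against a measure with a density *)

Section density.
Context d (T : measurableType d) (R : realType).
Variables (mu nu : {measure set T -> \bar R}) (w : T -> R).
Hypothesis mw : measurable_fun setT w.
Hypothesis w0 : forall x, 0 <= w x.
Hypothesis nuE : forall A, measurable A -> nu A = (\int[mu]_(x in A) (w x)%:E)%E.
Import HBNNSimple.

Let ge0_integral_density_nnsfun (f : {nnsfun T >-> R}) :
  (\int[nu]_x (f x)%:E = \int[mu]_x ((f x)%:E * (w x)%:E))%E.
Proof.
under [LHS]eq_integral do rewrite fimfunE -fsumEFin//.
rewrite [LHS]ge0_integral_fsum//; last 2 first.
  - by move=> r; exact/measurable_EFinP/measurableT_comp.
  - by move=> n x _; rewrite EFinM nnfun_muleindic_ge0.
under [RHS]eq_integral.
  move=> x xD; rewrite fimfunE -fsumEFin// muleC ge0_mule_fsumr; last first.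
    by move=> r; rewrite EFinM nnfun_muleindic_ge0.
  over.
rewrite [RHS]ge0_integral_fsum//; last 2 first.
  - move=> r; apply/measurable_EFinP; apply: measurable_funM => //.
    by apply: measurable_funM => //; exact: measurable_indic.
  - by move=> n x _; rewrite mule_ge0 ?[X in (_ <= X)%E]EFinM ?nnfun_muleindic_ge0 ?lee_fin.
apply: eq_fsbigr => r _.
rewrite integralZl_indic_nnsfun//= integral_indic//= setIT.
have mP : measurable (f @^-1` [set r]) by exact: measurable_sfunP.
rewrite nuE//.
(* Taking [r] out of the integral requires [0 <= r], which is known only for values that [f]
   attains. *)
have [rf|rf] := pselect (exists x, f x = r); last first.
  have -> : f @^-1` [set r] = set0.
    by rewrite -subset0 => x /= fx; apply: rf; exists x.
  by rewrite integral_set0 mule0 integral0_eq// => x _; rewrite indic0 mulr0 mule0.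
have r0 : (0 <= r%:E)%E by case: rf => x <-; rewrite lee_fin.
rewrite [X in (_ * X)%E]integral_mkcond -ge0_integralZl//; last 2 first.
- apply/(measurable_restrictT _ _).1 => //.
  by apply/measurable_EFinP; exact: measurable_funTS.
- by move=> x _; rewrite patchE; case: ifP => _; rewrite lee_fin.
apply: eq_integral => x _; rewrite patchE indicE.
by case: ifPn => xr; rewrite /= ?mulr1 ?mulr0 ?mule0// muleC.
Qed.

Lemma ge0_integral_density (f : T -> \bar R) :
  measurable_fun setT f -> (forall x, 0 <= f x)%E ->
  (\int[nu]_x f x = \int[mu]_x (f x * (w x)%:E))%E.
Proof.
move=> mf f0.
pose f_ := nnsfun_approx measurableT mf.
have ndf x : {homo (fun n => (f_ n x)%:E) : a b / (a <= b)%N >-> (a <= b)%E}.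
  by move=> a b ab; rewrite lee_fin; exact/lefP/nd_nnsfun_approx.
transitivity (lim (\int[nu]_x (f_ n x)%:E @[n --> \oo])%E).
  rewrite -monotone_convergence//=.
  - apply: eq_integral => ? /[!inE] xD; apply/esym/cvg_lim => //=.
    exact: cvg_nnsfun_approx.
  - by move=> n; exact/measurable_EFinP/measurable_funTS.
  - by move=> n ? _; rewrite lee_fin.
transitivity (lim (\int[mu]_x ((f_ n x)%:E * (w x)%:E) @[n --> \oo])%E).
  by apply: congr_lim; apply/funext => n; exact: ge0_integral_density_nnsfun.
rewrite -monotone_convergence//=.
- apply: eq_integral => x _; apply/cvg_lim => //.
  by apply: cvgeZr => //; exact: cvg_nnsfun_approx.
- move=> n; apply/measurable_EFinP; apply: measurable_funM => //.
- by move=> n x _; rewrite -EFinM lee_fin mulr_ge0.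
- by move=> x _ a b ab; rewrite lee_pmul// ?lee_fin//; apply: (ndf x).
Qed.

End density.

(** * The standard normal law on tuples *)

Section standard_gaussian.
Context {R : realType}.

Definition cons_tuple n (p : R * n.-tuple R) : n.+1.-tuple R :=
  [tuple of p.1 :: p.2].

Lemma measurable_cons_tuple n :
  measurable_fun setT (@cons_tuple n : _ -> n.+1.-tuple R).
Proof. exact: measurable_cons. Qed.

HB.instance Definition _ n :=
  isMeasurableFun.Build _ _ _ _ (@cons_tuple n) (@measurable_cons_tuple n).

(** Retypes [normal_prob], a law on [measurableTypeR R], as a law on [R], the type of the tuple
    coordinates. *)
Definition idTR : measurableTypeR R -> R := idfun.

HB.instance Definition _ :=
  @isMeasurableFun.Build _ _ _ _ idTR (@measurable_id _ _ setT).

Definition stdnormal : probability R R :=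
  distribution (normal_prob 0 1) idTR.

(** Follows the recursion of [lebesgue_int], head coordinate first, so that the two are compared by
    induction on [n]. *)
Fixpoint gauss (n : nat) : probability (n.-tuple R) R :=
  match n with
  | 0 => dirac [tuple]
  | n'.+1 => distribution (stdnormal \x gauss n')%E (@cons_tuple n')
  end.

Lemma ge0_integral_gaussS n (f : n.+1.-tuple R -> \bar R) :
  measurable_fun setT f -> (forall y, 0 <= f y)%E ->
  (\int[gauss n.+1]_y f y =
   \int[stdnormal]_x \int[gauss n]_t f (cons_tuple (x, t)))%E.
Proof.
move=> mf f0; rewrite ge0_integral_distribution//.
rewrite fubini_tonelli1//; last by move=> p; exact: f0.
by apply: measurableT_comp => //; exact: measurable_cons_tuple.
Qed.

Lemma ge0_integral_gaussS' n (f : n.+1.-tuple R -> \bar R) :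
  measurable_fun setT f -> (forall y, 0 <= f y)%E ->
  (\int[gauss n.+1]_y f y =
   \int[gauss n]_t \int[stdnormal]_x f (cons_tuple (x, t)))%E.
Proof.
move=> mf f0; rewrite ge0_integral_distribution//.
rewrite fubini_tonelli2//; last by move=> p; exact: f0.
by apply: measurableT_comp => //; exact: measurable_cons_tuple.
Qed.

Lemma integral_gauss0 (f : 0.-tuple R -> \bar R) :
  measurable_fun setT f -> (\int[gauss 0]_y f y = f [tuple])%E.
Proof. by move=> mf; rewrite integral_dirac// diracT mul1e. Qed.

Definition upd_tuple n (y : n.-tuple R) (i : 'I_n) (x : R) : n.-tuple R :=
  [tuple if j == i then x else tnth y j | j < n].

Lemma tnth_upd_tuple n (y : n.-tuple R) i x j :
  tnth (upd_tuple y i x) j = if j == i then x else tnth y j.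
Proof. by rewrite tnth_mktuple. Qed.

Lemma measurable_upd_tuple n i :
  measurable_fun setT (fun p : R * n.-tuple R => upd_tuple p.2 i p.1).
Proof.
apply/measurable_fun_tnthP => j /=.
rewrite (_ : _ \o _ = fun p : R * n.-tuple R =>
    if j == i then p.1 else tnth p.2 j); last first.
  by apply/funext => p /=; rewrite tnth_upd_tuple.
case: (j == i); first exact: measurable_fst.
exact: (measurableT_comp (measurable_tnth j)
  (measurable_snd : measurable_fun setT (@snd R (n.-tuple R)))).
Qed.

Lemma upd_cons_tuple0 n (t : n.-tuple R) y x :
  upd_tuple (cons_tuple (y, t)) ord0 x = cons_tuple (x, t).
Proof.
apply: eq_from_tnth => j; rewrite tnth_upd_tuple.
by case: (unliftP ord0 j) => [k|] ->; rewrite ?eqxx //= !tnthS.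
Qed.

Lemma upd_cons_tupleS n (t : n.-tuple R) y x i :
  upd_tuple (cons_tuple (y, t)) (lift ord0 i) x = cons_tuple (y, upd_tuple t i x).
Proof.
apply: eq_from_tnth => j; rewrite tnth_upd_tuple.
case: (unliftP ord0 j) => [k|] -> //=.
by rewrite (inj_eq lift_inj) !tnthS tnth_upd_tuple.
Qed.

Lemma measurable_cons_tuple1 n x :
  measurable_fun setT (fun t : n.-tuple R => cons_tuple (x, t)).
Proof. exact: (measurable_cons (measurable_cst x) (@measurable_id _ _ setT)). Qed.

(* Resampling a coordinate leaves the law unchanged; this is the only form of
   independence that is needed. *)
Lemma ge0_integral_gauss_resample n (i : 'I_n) (f : n.-tuple R -> \bar R) :
  measurable_fun setT f -> (forall y, 0 <= f y)%E ->
  (\int[gauss n]_y f y =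
   \int[gauss n]_y \int[stdnormal]_x f (upd_tuple y i x))%E.
Proof.
elim: n i f => [[]//|n IHn] i f mf f0.
have mupd : measurable_fun setT (fun p : n.+1.-tuple R * R => f (upd_tuple p.1 i p.2)).
  apply: (measurableT_comp mf).
  apply: (measurableT_comp (measurable_upd_tuple i)
    (g := fun p : n.+1.-tuple R * R => (p.2, p.1))).
  exact: measurable_fun_pair.
have mF : measurable_fun setT (fun y => \int[stdnormal]_x f (upd_tuple y i x))%E.
  exact: (measurable_fun_fubini_tonelli_F _ mupd (fun p => f0 _)).
rewrite [RHS]ge0_integral_gaussS//; last by move=> y; exact: integral_ge0.
case: (unliftP ord0 i) mupd mF => [j|] -> mupd mF.
- rewrite ge0_integral_gaussS//; apply: eq_integral => y _.
  rewrite (IHn j) //; last exact: measurableT_comp (measurable_cons_tuple1 y).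
  by under [RHS]eq_integral do under eq_integral do rewrite upd_cons_tupleS.
(* For the head coordinate Tonelli is used in the other order: the old head is integrated innermost,
   where the resampled integrand is constant. *)
- rewrite ge0_integral_gaussS'//.
  under [RHS]eq_integral do under eq_integral do under eq_integral do rewrite upd_cons_tuple0.
  by rewrite integral_cst//= probability_setT mule1.
Qed.

End standard_gaussian.

(** * Affine images of the standard normal law *)

Section affine.
Context {R : realType}.
Local Notation leb := (@lebesgue_measure R).

Definition affine1 (a s x : R) : R := a + s * x.

Lemma measurable_affine1 (a s : R) : measurable_fun setT (affine1 a s).
Proof. by apply: measurable_funD => //; exact: measurable_funM. Qed.

Definition affine_lebesgue (a s : R) : {measure set (measurableTypeR R) -> \bar R} :=
  measure_function_pushforward__canonical__measure_function_Measure
    (@lebesgue_measure R) (measurable_affine1 a s :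
      @measurable_fun _ _ (measurableTypeR R) (measurableTypeR R) setT (affine1 a s)).

(** By uniqueness of Lebesgue measure only half-open intervals have to be checked; their preimages
    are shorter by the factor [s]. *)
Lemma lebesgue_measure_affine (a s : R) (s0 : 0 < s) (A : set R) :
  measurable A ->
  leb A = mscale (NngNum (ltW s0)) (affine_lebesgue a s) A.
Proof.
move=> mA; apply: lebesgue_measure_unique => // X [[u v] /= _ <-].
rewrite /mscale/= /pushforward.
have -> : affine1 a s @^-1` `]u, v] = `](u - a) / s, (v - a) / s]%classic.
  apply/seteqP; split => x /=; rewrite !in_itv/= /affine1;
  by rewrite ltr_pdivrMr// ler_pdivlMr// ltrBlDl lerBrDl ![x * s]mulrC.
rewrite !lebesgue_measure_itv/= !lte_fin ltr_pM2r ?invr_gt0// ltrD2r.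
case: ifPn => _; last by rewrite mule0.
by rewrite -!EFinD -EFinM; congr EFin; field; rewrite gt_eqF.
Qed.

Lemma ge0_integral_lebesgue_affine (a s : R) (f : R -> \bar R) : 0 < s ->
  measurable_fun setT f -> (forall x, 0 <= f x)%E ->
  (\int[leb]_x f x = s%:E * \int[leb]_x f (affine1 a s x))%E.
Proof.
move=> s0 mf f0.
have := @eq_measure_integral _ _ _ setT
  (mscale (NngNum (ltW s0)) (affine_lebesgue a s)) leb f.
move=> ->; last by move=> A mA _; apply: lebesgue_measure_affine.
rewrite ge0_integral_mscale//=; congr (_ * _)%E.
exact: (@ge0_integral_pushforward _ _ (measurableTypeR R) (measurableTypeR R)
  R _ (measurable_affine1 a s) leb setT).
Qed.

Lemma ge0_integral_stdnormal (f : R -> \bar R) :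
  measurable_fun setT f -> (forall x, 0 <= f x)%E ->
  (\int[stdnormal]_x f x = \int[leb]_x (f x * (normal_pdf 0 1 x)%:E))%E.
Proof.
move=> mf f0; rewrite ge0_integral_distribution//.
apply: (@ge0_integral_density _ _ R leb (normal_prob 0 1) (normal_pdf 0 1)) => //.
  exact: measurable_normal_pdf.
by move=> x; exact: normal_pdf_ge0.
Qed.

Lemma normal_pdf_gt0 (m s x : R) : s != 0 -> 0 < normal_pdf m s x.
Proof.
by move=> s0; rewrite normal_pdfE// mulr_gt0 ?normal_peak_gt0 ?expR_gt0.
Qed.

(** Likelihood ratio of N(a, s^2) against N(0, 1). *)
Definition lratio (a s y : R) : R := normal_pdf a s y / normal_pdf 0 1 y.

Lemma lratio_ge0 a s y : 0 <= lratio a s y.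
Proof. by rewrite divr_ge0 ?normal_pdf_ge0. Qed.

Lemma lratioE a s y : s != 0 -> lratio a s y =
  normal_peak s / normal_peak 1 *
  expR (- (y - a) ^+ 2 / (s ^+ 2 *+ 2) + y ^+ 2 / 2).
Proof.
move=> s0; rewrite /lratio !normal_pdfE ?oner_eq0// /normal_fun.
rewrite subr0 expr1n expRD invfM -[(expR (- y ^+ 2 / _))^-1]expRN.
rewrite (_ : - (- y ^+ 2 / (1 *+ 2)) = y ^+ 2 / 2); last by field.
by rewrite mulrACA.
Qed.

Lemma measurable_lratio s : s != 0 ->
  measurable_fun setT (fun p : R * R => lratio p.1 s p.2).
Proof.
move=> s0.
rewrite (_ : (fun p => _) = fun p : R * R => normal_peak s / normal_peak 1 *
  expR (- (p.2 - p.1) ^+ 2 / (s ^+ 2 *+ 2) + p.2 ^+ 2 / 2)); last first.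
  by apply/funext => p; rewrite lratioE.
apply: measurable_funM => //; apply: measurableT_comp => //.
apply: measurable_funD; apply: measurable_funM => //.
  apply: measurableT_comp => //; apply: measurable_funX.
  by apply: measurable_funB.
by apply: measurable_funX.
Qed.

Lemma measurable_lratio1 a s : s != 0 -> measurable_fun setT (lratio a s).
Proof.
move=> s0.
exact: (measurableT_comp (measurable_lratio s0) (measurable_fun_pair (measurable_cst a) (@measurable_id _ _ setT))).
Qed.

Lemma normal_pdf_affine1 (a s x : R) : 0 < s ->
  s * normal_pdf a s (affine1 a s x) = normal_pdf 0 1 x.
Proof.
move=> s0; rewrite !normal_pdfE ?oner_eq0 ?gt_eqF// mulrA; congr (_ * _).
  rewrite /normal_peak expr1n mul1r -mulrnAr sqrtrM ?sqr_ge0// sqrtr_sqr gtr0_norm//.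
  by rewrite invfM mulrA divff ?mul1r// gt_eqF.
rewrite /normal_fun /affine1; congr expR.
by field; rewrite gt_eqF.
Qed.

Lemma ge0_integral_stdnormal_affine (a s : R) (f : R -> \bar R) : 0 < s ->
  measurable_fun setT f -> (forall x, 0 <= f x)%E ->
  (\int[stdnormal]_x f (affine1 a s x) =
   \int[stdnormal]_x (f x * (lratio a s x)%:E))%E.
Proof.
move=> s0 mf f0; have sN0 : s != 0 by rewrite gt_eqF.
have mg : measurable_fun setT (fun x => f x * (normal_pdf a s x)%:E)%E.
  by apply: emeasurable_funM => //; apply/measurable_EFinP; exact: measurable_normal_pdf.
have mw : measurable_fun setT (fun x => f x * (lratio a s x)%:E)%E.
  by apply: emeasurable_funM => //; apply/measurable_EFinP; exact: measurable_lratio1.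
have ma : measurable_fun setT (fun x => f (affine1 a s x)).
  by apply: (measurableT_comp mf); exact: measurable_affine1.
rewrite !ge0_integral_stdnormal//; last first.
  by move=> x; rewrite mule_ge0// lee_fin lratio_ge0.
transitivity (\int[leb]_x (f x * (normal_pdf a s x)%:E))%E; last first.
  apply: eq_integral => x _; rewrite -muleA -EFinM; congr (_ * _%:E)%E.
  by rewrite /lratio divfK// gt_eqF// normal_pdf_gt0// oner_eq0.
rewrite [RHS](@ge0_integral_lebesgue_affine a s)//; last first.
  by move=> x; rewrite mule_ge0// lee_fin normal_pdf_ge0.
rewrite -[RHS]ge0_integralZl//; last 3 first.
- by apply: (measurableT_comp mg); exact: measurable_affine1.
- by move=> x _; rewrite mule_ge0// lee_fin normal_pdf_ge0.
- by rewrite lee_fin ltW.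
apply: eq_integral => x _; rewrite muleCA -EFinM normal_pdf_affine1//.
Qed.

End affine.

(** * Likelihood ratios and Lebesgue densities in dimension n *)

Section gauss_affine.
Context {R : realType}.
Local Notation leb := (@lebesgue_measure R).

Definition affine n (a : 'I_n -> R) (s : R) (y : n.-tuple R) : n.-tuple R :=
  [tuple affine1 (a i) s (tnth y i) | i < n].

Lemma measurable_affine n a s : measurable_fun setT (@affine n a s).
Proof.
apply/measurable_fun_tnthP => j.
rewrite (_ : _ \o _ = affine1 (a j) s \o (@tnth n R ^~ j)); last first.
  by apply/funext => y; rewrite /= tnth_mktuple.
exact: (measurableT_comp (measurable_affine1 _ _) (measurable_tnth j)).
Qed.

Lemma affine_cons n (a : 'I_n.+1 -> R) s x t :
  affine a s (cons_tuple (x, t)) =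
  cons_tuple (affine1 (a ord0) s x, affine (a \o lift ord0) s t).
Proof.
apply: eq_from_tnth => j; rewrite tnth_mktuple.
by case: (unliftP ord0 j) => [k|] -> //=; rewrite !tnthS tnth_mktuple.
Qed.

Lemma measurable_prod_lratio n (a : 'I_n -> R) s : s != 0 ->
  measurable_fun setT (fun y : n.-tuple R => \prod_(i < n) lratio (a i) s (tnth y i)).
Proof.
move=> s0; apply: measurable_prod => i _.
exact: (measurableT_comp (measurable_lratio1 _ s0) (measurable_tnth i)).
Qed.

Lemma prod_lratio_ge0 n (a : 'I_n -> R) s (y : n.-tuple R) :
  0 <= \prod_(i < n) lratio (a i) s (tnth y i).
Proof. by apply: prodr_ge0 => i _; exact: lratio_ge0. Qed.

Lemma ge0_integral_gauss_affine n (a : 'I_n -> R) s (f : n.-tuple R -> \bar R) :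
  0 < s -> measurable_fun setT f -> (forall y, 0 <= f y)%E ->
  (\int[gauss n]_y f (affine a s y) =
   \int[gauss n]_y (f y * (\prod_(i < n) lratio (a i) s (tnth y i))%:E))%E.
Proof.
move=> s0; have sN0 : s != 0 by rewrite gt_eqF.
elim: n a f => [|n IHn] a f mf f0.
  rewrite !integral_gauss0.
  - by rewrite big_ord0 mule1; congr f; rewrite tuple0.
  - apply: emeasurable_funM => //; apply/measurable_EFinP.
    exact: measurable_prod_lratio.
  - by apply: (measurableT_comp mf); exact: measurable_affine.
have mg : measurable_fun setT
    (fun y => f y * (\prod_(i < n.+1) lratio (a i) s (tnth y i))%:E)%E.
  apply: emeasurable_funM => //; apply/measurable_EFinP.
  exact: measurable_prod_lratio.
rewrite !ge0_integral_gaussS//; last 2 first.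
- by move=> y; rewrite mule_ge0// lee_fin prod_lratio_ge0.
- by apply: (measurableT_comp mf); exact: measurable_affine.
under eq_integral do under eq_integral do rewrite affine_cons.
have mfc x : measurable_fun setT (fun t => f (cons_tuple (x, t))).
  by apply: (measurableT_comp mf); exact: measurable_cons_tuple1.
have mpl : measurable_fun setT (fun t : n.-tuple R => \prod_(i < n) lratio ((a \o lift ord0) i) s (tnth t i)).
  exact: measurable_prod_lratio.
pose G x := (\int[gauss n]_t (f (cons_tuple (x, t)) *
  (\prod_(i < n) lratio ((a \o lift ord0) i) s (tnth t i))%:E))%E.
transitivity (\int[stdnormal]_x G (affine1 (a ord0) s x))%E.
  apply: eq_integral => x _.
  exact: (IHn (a \o lift ord0) (fun t => f (cons_tuple (affine1 (a ord0) s x, t)))).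
rewrite ge0_integral_stdnormal_affine//; last 2 first.
- apply: (measurable_fun_fubini_tonelli_F (fun p : R * n.-tuple R => f (cons_tuple p) *
     (\prod_(i < n) lratio ((a \o lift ord0) i) s (tnth p.2 i))%:E)%E).
    apply: emeasurable_funM.
      by apply: (measurableT_comp mf); exact: measurable_cons_tuple.
    by apply/measurable_EFinP; apply: (measurableT_comp mpl).
  by move=> p; rewrite mule_ge0// lee_fin prod_lratio_ge0.
- by move=> x; apply: integral_ge0 => t _; rewrite mule_ge0// lee_fin prod_lratio_ge0.
apply: eq_integral => x _.
rewrite -ge0_integralZr//; last 3 first.
- by apply: emeasurable_funM => //; apply/measurable_EFinP.
- by move=> t _; rewrite mule_ge0// lee_fin prod_lratio_ge0.
- by rewrite lee_fin lratio_ge0.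
apply: eq_integral => t _; rewrite -muleA -EFinM; congr (_ * _%:E)%E.
rewrite big_ord_recl mulrC; congr (_ * _).
by apply: eq_bigr => i _; rewrite /= tnthS.
Qed.

(** Replaces Lebesgue integrals by integrals against the probability [gauss n]: a Lebesgue density
    only has to be divided by the standard normal one. *)
Lemma lebesgue_int_gauss n (g : n.-tuple R -> \bar R) :
  measurable_fun setT g -> (forall y, 0 <= g y)%E ->
  (lebesgue_int (fun y => g y * (\prod_(i < n) normal_pdf 0 1 (tnth y i))%:E) =
   \int[gauss n]_y g y)%E.
Proof.
elim: n g => [|n IHn] g mg g0.
  by rewrite integral_gauss0//= big_ord0 mule1.
rewrite ge0_integral_gaussS// ge0_integral_stdnormal; last 2 first.
- apply: (measurable_fun_fubini_tonelli_F (fun p : R * n.-tuple R => g (cons_tuple p))) => //.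
  by apply: (measurableT_comp mg); exact: measurable_cons_tuple.
- by move=> x; exact: integral_ge0.
have mgc x : measurable_fun setT (fun t => g (cons_tuple (x, t))).
  by apply: (measurableT_comp mg); exact: measurable_cons_tuple1.
apply: eq_integral => x _.
rewrite -ge0_integralZr//; last by rewrite lee_fin normal_pdf_ge0.
rewrite -IHn; last 2 first.
- by apply: emeasurable_funM.
- by move=> t; rewrite mule_ge0// lee_fin normal_pdf_ge0.
congr lebesgue_int; apply/funext => t.
rewrite -muleA -EFinM big_ord_recl; congr (_ * (_ * _)%:E)%E.
by apply: eq_bigr => i _; rewrite tnthS.
Qed.

End gauss_affine.

(** * Inverse of the equi-correlation matrix *)

Section equicorr_quadratic_form.
Context {R : realType}.
Variables (n : nat) (rho : R).
Hypothesis rho01 : 0 <= rho < 1.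

Local Notation J := (const_mx 1 : 'M[R]_n).

Let onesM : J *m J = n%:R *: J.
Proof.
apply/matrixP => i j; rewrite !mxE.
under eq_bigr do rewrite !mxE mulr1.
by rewrite sumr_const card_ord mulr1.
Qed.

(** Sherman-Morrison formula: the matrix is [(1 - rho) I + rho J] with [J *m J = n J]. *)
Lemma invmx_equicorr :
  invmx (equicorr n rho) =
  (1 - rho)^-1 *: (1%:M - (rho / (1 - rho + n%:R * rho)) *: J).
Proof.
have [rho0 rho1] := andP rho01.
have D0 : 1 - rho + n%:R * rho != 0.
  by rewrite gt_eqF// ltr_pwDl ?subr_gt0// mulr_ge0.
have s0 : 1 - rho != 0 by rewrite gt_eqF// subr_gt0.
have -> : equicorr n rho = (1 - rho) *: 1%:M + rho *: J.
  apply/matrixP => i j; rewrite !mxE; case: (i == j) => /=; ring.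
set G := RHS.
have eG : ((1 - rho) *: 1%:M + rho *: J) *m G = 1%:M.
  rewrite /G -scalemxAr mulmxDl !mulmxBr -!scalemxAl -!scalemxAr !mul1mx !mulmx1 onesM.
  apply/matrixP => i j; rewrite !mxE; field.
  by rewrite D0 s0.
have [uG _] := mulmx1_unit eG.
by rewrite -[LHS]mulmx1 -[X in _ *m X = _]eG mulKmx.
Qed.

Lemma equicorr_quad_form (v : 'rV[R]_n) :
  (v *m invmx (equicorr n rho) *m v^T) 0 0 =
  (1 - rho)^-1 * (\sum_i v 0 i ^+ 2
     - rho / (1 - rho + n%:R * rho) * (\sum_i v 0 i) ^+ 2).
Proof.
rewrite invmx_equicorr -scalemxAr -scalemxAl mxE; congr (_ * _).
rewrite mulmxBr mulmxBl mulmx1 -scalemxAr -scalemxAl !mxE.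
congr (_ - _ * _).
  by apply: eq_bigr => i _; rewrite !mxE expr2.
rewrite expr2 mulr_sumr; apply: eq_bigr => i _; rewrite !mxE.
by congr (_ * _); apply: eq_bigr => j _; rewrite !mxE mulr1.
Qed.

End equicorr_quadratic_form.

(** * The equi-correlated density as a mixture over the common factor *)

Section mixture.
Context {R : realType}.
Variables (n : nat) (rho : R) (m : 'rV[R]_n).
Hypothesis rho01 : 0 <= rho < 1.
Local Notation leb := (@lebesgue_measure R).
Local Notation quad y := (((\row_i (tnth y i - m 0 i)) *m invmx (equicorr n rho)
   *m (\row_i (tnth y i - m 0 i))^T) 0 0).

(** The model density relative to the standard normal one, up to a constant. *)
Definition equicorr_weight (y : n.-tuple R) : R :=
  expR (- quad y / 2) / \prod_(i < n) normal_pdf 0 1 (tnth y i).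

Lemma prod_normal_pdf_gt0 (y : n.-tuple R) :
  0 < \prod_(i < n) normal_pdf 0 1 (tnth y i).
Proof. by apply: prodr_gt0 => i _; rewrite normal_pdf_gt0// oner_eq0. Qed.

Lemma equicorr_weight_gt0 y : 0 < equicorr_weight y.
Proof. by rewrite divr_gt0 ?expR_gt0 ?prod_normal_pdf_gt0. Qed.

Lemma measurable_equicorr_weight : measurable_fun setT equicorr_weight.
Proof.
have mt i : measurable_fun setT (fun y : n.-tuple R => tnth y i - m 0 i).
  by apply: measurable_funB => //; exact: measurable_tnth.
have mq : measurable_fun setT (fun y : n.-tuple R => quad y).
  under eq_fun do rewrite equicorr_quad_form//.
  apply: measurable_funM => //; apply: measurable_funB; last apply: measurable_funM => //.
    apply: measurable_sum => i; under eq_fun do rewrite mxE.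
    exact: measurable_funX.
  apply: measurable_funX; apply: measurable_sum => i; under eq_fun do rewrite mxE.
  exact: mt.
rewrite (_ : equicorr_weight = fun y => expR (- quad y / 2 -
   \sum_(i < n) ln (normal_pdf 0 1 (tnth y i)))); last first.
  apply/funext => y; rewrite /equicorr_weight expRD expRN expR_sum.
  congr (_ / _); apply: eq_bigr => i _.
  by rewrite lnK// posrE normal_pdf_gt0// oner_eq0.
apply: measurableT_comp => //; apply: measurable_funB.
  by apply: measurable_funM => //; exact: measurableT_comp.
apply: measurable_sum => i; apply: measurableT_comp => //.
exact: (measurableT_comp (measurable_normal_pdf _ _) (measurable_tnth i)).
Qed.

Let s := Num.sqrt (1 - rho).
Let D := 1 - rho + n%:R * rho.
Let tau := Num.sqrt ((1 - rho) / D).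

Let s_gt0 : 0 < s.
Proof. by rewrite sqrtr_gt0 subr_gt0; case/andP: rho01. Qed.

Let D_gt0 : 0 < D.
Proof. by have /andP[r0 r1] := rho01; rewrite ltr_pwDl ?subr_gt0// mulr_ge0. Qed.

Let tau_gt0 : 0 < tau.
Proof. by have /andP[r0 r1] := rho01; rewrite sqrtr_gt0 divr_gt0 ?subr_gt0. Qed.

Let cst_mixture := normal_peak s ^+ n * normal_peak 1 / normal_peak tau.

(** Complete the square in [z]: given [y], the common factor is normal with mean [b] and standard
    deviation [tau], and the remaining exponent is the quadratic form of
    [invmx (equicorr n rho)]. *)
Lemma integral_mixture (y : n.-tuple R) :
  (\int[stdnormal]_z
     (\prod_(i < n) lratio (m 0 i + Num.sqrt rho * z) s (tnth y i))%:E =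
   (cst_mixture * equicorr_weight y)%:E)%E.
Proof.
have /andP[r0 r1] := rho01.
have sN0 : s != 0 by rewrite gt_eqF.
rewrite ge0_integral_stdnormal; last 2 first.
- apply/measurable_EFinP; apply: measurable_prod => i _.
  apply: (measurableT_comp (measurable_lratio sN0)
    (g := fun z => (m 0 i + Num.sqrt rho * z, tnth y i))).
  apply: measurable_fun_pair => //.
  exact: (@measurable_affine1 _ (m 0 i) (Num.sqrt rho)).
- by move=> z; rewrite lee_fin; apply: prodr_ge0 => i _; exact: lratio_ge0.
pose v := \row_i (tnth y i - m 0 i).
pose b := Num.sqrt rho * (\sum_i v 0 i) / D.
transitivity (\int[leb]_z ((cst_mixture * equicorr_weight y)%:E * (normal_pdf b tau z)%:E))%E.
  apply: eq_integral => z _; rewrite -!EFinM; congr EFin.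
  rewrite /lratio prodf_div /equicorr_weight.
  rewrite [RHS]mulrAC mulrA [LHS]mulrAC; congr (_ / _).
  rewrite (eq_bigr (fun i => normal_peak s *
      expR (- (v 0 i - Num.sqrt rho * z) ^+ 2 / (s ^+ 2 *+ 2)))); last first.
    by move=> i _; rewrite (normal_pdfE _ sN0) /normal_fun /v mxE opprD addrA.
  rewrite big_split/= prodr_const card_ord -expR_sum.
  rewrite !normal_pdfE ?oner_eq0 ?gt_eqF// /cst_mixture /normal_fun.
  rewrite [RHS](_ : _ = normal_peak s ^+ n * normal_peak 1 * (normal_peak tau / normal_peak tau) *
    (expR (- quad y / 2) * expR (- (z - b) ^+ 2 / (tau ^+ 2 *+ 2)))); last by ring.
  rewrite divff ?gt_eqF ?normal_peak_gt0 ?gt_eqF// mulr1.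
  rewrite [LHS](_ : _ = normal_peak s ^+ n * normal_peak 1 *
    (expR (\sum_(i < n) (- (v 0 i - Num.sqrt rho * z) ^+ 2 / (s ^+ 2 *+ 2))) *
     expR (- (z - 0) ^+ 2 / (1 ^+ 2 *+ 2)))); last by ring.
  congr (_ * _); rewrite -!expRD; congr expR.
  rewrite equicorr_quad_form// -/v -/D.
  rewrite -mulr_suml sumrN.
  rewrite (eq_bigr (fun i => v 0 i ^+ 2 - 2 * Num.sqrt rho * z * v 0 i + rho * z ^+ 2)); last first.
    by move=> i _; rewrite sqrrB exprMn sqr_sqrtr//; ring.
  rewrite big_split/= sumrB -mulr_sumr sumr_const card_ord -mulr_natr.
  rewrite /tau /s /b !sqr_sqrtr ?subr_ge0 ?divr_ge0 ?(ltW r1) ?subr_ge0 ?(ltW D_gt0)//; last exact: ltW.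
  set S1 := \sum_(i < n) v 0 i; set S2 := \sum_(i < n) v 0 i ^+ 2.
  have := D_gt0; rewrite /D; set q := Num.sqrt rho => DD.
  have -> : rho = q ^+ 2 by rewrite sqr_sqrtr.
  have DD' : 1 - q ^+ 2 + n%:R * q ^+ 2 != 0 by rewrite sqr_sqrtr// gt_eqF.
  have q1 : 1 - q ^+ 2 != 0 by rewrite sqr_sqrtr// gt_eqF// subr_gt0.
  by field; rewrite DD' q1.
rewrite ge0_integralZl//.
- by rewrite integral_normal_pdf mule1.
- by apply/measurable_EFinP; exact: measurable_normal_pdf.
- by move=> z _; rewrite lee_fin normal_pdf_ge0.
- rewrite lee_fin mulr_ge0// ?(ltW (equicorr_weight_gt0 _))//.
  by rewrite divr_ge0 ?mulr_ge0 ?exprn_ge0 ?normal_peak_ge0.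
Qed.

End mixture.

(** * Recovering the common factor from the density *)

Section gaussian_vector_law.
Context {R : realType} d (T : measurableType d) (P : probability T R).
Variables (n : nat) (rho : R) (m : 'rV[R]_n) (Y : {RV P >-> n.-tuple R}).
Hypothesis rho01 : 0 <= rho < 1.
Hypothesis YG : gaussian_vector Y m (equicorr n rho).

Definition mean_shift (z : R) (i : 'I_n) : R := m 0 i + Num.sqrt rho * z.

Let s := Num.sqrt (1 - rho).
Let s_gt0 : 0 < s.
Proof. by rewrite sqrtr_gt0 subr_gt0; case/andP: rho01. Qed.

Let mw (c : R) : measurable_fun setT (fun y => c * equicorr_weight rho m y).
Proof. by apply: measurable_funM => //; exact: measurable_equicorr_weight. Qed.

(** [K] is kept abstract, with its sign only; total mass will determine it. *)
Let mixture_cst : exists2 K, 0 <= K & forall f : n.-tuple R -> \bar R,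
  measurable_fun setT f -> (forall y, 0 <= f y)%E ->
  (\int[stdnormal]_z \int[gauss n]_y f (affine (mean_shift z) s y) =
   \int[gauss n]_y (f y * (K * equicorr_weight rho m y)%:E))%E.
Proof.
eexists; last first.
  move=> f mf f0.
  under eq_integral do rewrite ge0_integral_gauss_affine//.
  have mL : measurable_fun setT (fun p : R * n.-tuple R =>
     \prod_(i < n) lratio (mean_shift p.1 i) s (tnth p.2 i)).
    apply: measurable_prod => i _.
    apply: (measurableT_comp (measurable_lratio _)
      (g := fun p : R * n.-tuple R => (mean_shift p.1 i, tnth p.2 i))).
      by rewrite gt_eqF.
    apply: measurable_fun_pair.
      exact: (measurableT_comp (@measurable_affine1 _ (m 0 i) (Num.sqrt rho))
       (measurable_fst : measurable_fun setT (@fst R (n.-tuple R)))).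
    exact: (measurableT_comp (measurable_tnth i)
      (measurable_snd : measurable_fun setT (@snd R (n.-tuple R)))).
  have L0 p : 0 <= \prod_(i < n) lratio (mean_shift p.1 i) s (tnth p.2 i) :> R.
    exact: prod_lratio_ge0.
  rewrite (fubini_tonelli (fun p : R * n.-tuple R => f p.2 *
    (\prod_(i < n) lratio (mean_shift p.1 i) s (tnth p.2 i))%:E)%E); last 2 first.
  - apply: emeasurable_funM; last exact/measurable_EFinP.
    exact: (measurableT_comp mf (measurable_snd : measurable_fun setT (@snd R (n.-tuple R)))).
  - by move=> p; rewrite mule_ge0// lee_fin.
  apply: eq_integral => y _ /=.
  rewrite ge0_integralZl//; last 2 first.
  - apply/measurable_EFinP.
    exact: (measurableT_comp mL (measurable_fun_pair (@measurable_id _ _ setT) (measurable_cst y))).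
  - by move=> z _; rewrite lee_fin (L0 (z, y)).
  by rewrite (integral_mixture m rho01).
by rewrite divr_ge0 ?mulr_ge0 ?exprn_ge0 ?normal_peak_ge0.
Qed.

Let det_cst := (Num.sqrt ((2 * pi) ^+ n * \det (equicorr n rho)))^-1.

Let distribution_density (A : set (n.-tuple R)) : measurable A ->
  (distribution P Y A =
   \int[gauss n]_(y in A) (det_cst * equicorr_weight rho m y)%:E)%E.
Proof.
move=> mA; rewrite YG// [RHS]integral_mkcond -lebesgue_int_gauss//; last 2 first.
- apply/(measurable_restrictT _ _).1 => //.
  by apply: measurable_funTS; apply/measurable_EFinP.
- move=> y; rewrite patchE; case: ifP => _//; rewrite lee_fin mulr_ge0//.
    by rewrite invr_ge0 sqrtr_ge0.
  exact/ltW/equicorr_weight_gt0.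
congr lebesgue_int; apply/funext => y; rewrite patchE indicE.
case: ifPn => yA; rewrite ?mul0e ?mul0r// mul1r /multinormal_pdf -EFinM -/det_cst.
rewrite -mulrA /equicorr_weight divfK//.
by rewrite gt_eqF// prod_normal_pdf_gt0.
Qed.

Lemma gaussian_vector_law (f : n.-tuple R -> \bar R) :
  measurable_fun setT f -> (forall y, 0 <= f y)%E ->
  (\int[P]_w f (Y w) =
   \int[stdnormal]_z \int[gauss n]_y f (affine (mean_shift z) s y))%E.
Proof.
have [K K0 KP] := mixture_cst.
have c0 : 0 <= det_cst by rewrite invr_ge0 sqrtr_ge0.
have dens g : measurable_fun setT g -> (forall y, 0 <= g y)%E ->
    (\int[P]_w g (Y w) = \int[gauss n]_y (g y * (det_cst * equicorr_weight rho m y)%:E))%E.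
  move=> mg g0; rewrite -(ge0_integral_distribution Y)//.
  apply: (@ge0_integral_density _ _ R (gauss n) (distribution P Y)
     (fun y => det_cst * equicorr_weight rho m y)) => //.
  by move=> y; rewrite mulr_ge0// ltW// equicorr_weight_gt0.
(* Both laws are multiples of [equicorr_weight]; testing them on the constant 1 equates the factors,
   so the determinant is never computed. *)
suff detE : det_cst = K by move=> mf f0; rewrite detE in dens; rewrite dens// KP.
pose I := (\int[gauss n]_y (equicorr_weight rho m y)%:E)%E.
have I0 : (0 <= I)%E.
  by apply: integral_ge0 => y _; rewrite lee_fin ltW// equicorr_weight_gt0.
have IE c : 0 <= c ->
   (\int[gauss n]_y (1 * (c * equicorr_weight rho m y)%:E) = c%:E * I)%E.
  move=> c0'; rewrite -ge0_integralZl//.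
  - by apply: eq_integral => y _; rewrite mul1e EFinM.
  - by apply/measurable_EFinP; exact: measurable_equicorr_weight.
  - by move=> y _; rewrite lee_fin ltW// equicorr_weight_gt0.
have := KP (cst 1%E) (measurable_cst _) (fun _ => lee01).
under eq_integral do rewrite integral_cst//= probability_setT mule1.
rewrite integral_cst//= probability_setT mule1 IE// => KI.
have := dens (cst 1%E) (measurable_cst _) (fun _ => lee01).
rewrite integral_cst//= probability_setT mule1 IE// => cI.
(* The integral [I] could a priori be infinite; [K * I = 1] rules this out. *)
move: I0 KI cI; case: (I) => [r| |]//.
- move=> r0 [KI] [cI].
  have rN0 : r != 0 by apply: contra_eq_neq KI => ->; rewrite mulr0 oner_eq0.
  by apply: (mulIf rN0); rewrite -KI -cI.
- move=> _ + _; rewrite mulr_infty; case: sgrP => //; rewrite ?mul0e ?mul1e//.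
  by move=> _ [] /eqP; rewrite oner_eq0.
  by move=> K_lt0; move: K0; rewrite leNgt K_lt0.
Qed.

End gaussian_vector_law.

(** * Monotonicity and symmetry of the normal tail *)

Section normal_tail.
Context {R : realType}.
Implicit Types a b x h t : R.
Local Notation leb := (@lebesgue_measure R).
Local Notation N := (normal_prob (0 : R) 1).
Local Notation phi := (normal_pdf (0 : R) 1).

Lemma normal_pdf01E x : phi x = normal_peak 1 * expR (- x ^+ 2 / 2).
Proof. by rewrite normal_pdfE ?oner_eq0// /normal_fun subr0 expr1n. Qed.

Lemma normal_probE (A : set R) : measurable A ->
  N A = (\int[leb]_x ((\1_A x)%:E * (phi x)%:E))%E.
Proof.
move=> mA; rewrite /normal_prob [LHS]integral_mkcond; apply: eq_integral => x _.
by rewrite patchE indicE; case: ifP => _; rewrite ?mul1e ?mul0e.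
Qed.

Lemma PhibarE x : N `]x, +oo[ = (Phibar x)%:E.
Proof. by rewrite /Phibar fineK// fin_num_measure. Qed.

Lemma Phibar_ge0 x : 0 <= Phibar x.
Proof. by rewrite -lee_fin -PhibarE. Qed.

Lemma Phibar_le1 x : Phibar x <= 1.
Proof. by rewrite -lee_fin -PhibarE probability_le1. Qed.

Let normal_prob_itv a b : a <= b ->
  N `]a, b] = (Phibar a - Phibar b)%:E.
Proof.
move=> ab; rewrite EFinB -!PhibarE.
have -> : `]a, +oo[%classic = `]a, b]%classic `|` `]b, +oo[%classic.
  apply/seteqP; split => x /=; rewrite !in_itv/= ?andbT.
    by move=> ax; case: (leP x b) => xb; [left; rewrite ax|right].
  by case=> [/andP[]//|]; exact: le_lt_trans.
rewrite measureU//; last first.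
  apply/seteqP; split => x //=; rewrite !in_itv/= ?andbT => -[/andP[_ xb]].
  by rewrite ltNge xb.
by rewrite addeK// fin_num_measure.
Qed.

Lemma Phibar_diff_le a b (u : R) : a <= b ->
  (forall x, a < x <= b -> phi x <= u) -> Phibar a - Phibar b <= (b - a) * u.
Proof.
move=> ab hu; rewrite -lee_fin -normal_prob_itv// /normal_prob.
have -> : ((b - a) * u)%:E = (\int[leb]_(x in `]a, b]) (cst u%:E) x)%E.
  rewrite integral_cst//= lebesgue_measure_itv/= lte_fin.
  move: ab; rewrite le_eqVlt => /orP[/eqP->|ab].
    by rewrite ltxx mule0 subrr mul0r.
  by rewrite ab -EFinB -EFinM mulrC.
have [xab|/set0P/negP/negPn/eqP xab] := pselect (`]a, b]%classic !=set0); last first.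
  by rewrite xab !integral_set0.
have u0 : 0 <= u.
  by case: xab => x /=; rewrite in_itv/= => /hu; apply: le_trans; exact: normal_pdf_ge0.
apply: ge0_le_integral => //.
- by move=> x _; rewrite lee_fin normal_pdf_ge0.
- by apply/measurable_EFinP; apply: measurable_funTS; exact: measurable_normal_pdf.
Qed.

Lemma Phibar_diff_ge a b (l : R) : a <= b -> 0 <= l ->
  (forall x, a < x <= b -> l <= phi x) -> (b - a) * l <= Phibar a - Phibar b.
Proof.
move=> ab l0 hl; rewrite -lee_fin -normal_prob_itv// /normal_prob.
have -> : ((b - a) * l)%:E = (\int[leb]_(x in `]a, b]) (cst l%:E) x)%E.
  rewrite integral_cst//= lebesgue_measure_itv/= lte_fin.
  move: ab; rewrite le_eqVlt => /orP[/eqP->|ab].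
    by rewrite ltxx mule0 subrr mul0r.
  by rewrite ab -EFinB -EFinM mulrC.
apply: ge0_le_integral => //.
- by apply/measurable_EFinP; apply: measurable_funTS; exact: measurable_normal_pdf.
Qed.

Lemma ltr_Phibar a b : a < b -> Phibar b < Phibar a.
Proof.
move=> ab; rewrite -subr_gt0.
(* The density at the point [|a| + |b|], which dominates [|x|] for all [x] in the interval. *)
pose l := normal_peak 1 * expR (- (`|a| + `|b|) ^+ 2 / 2) : R.
have l0 : 0 < l by rewrite mulr_gt0 ?normal_peak_gt0 ?expR_gt0 ?oner_eq0.
apply: (@lt_le_trans _ _ ((b - a) * l)); first by rewrite mulr_gt0// subr_gt0.
apply: Phibar_diff_ge; rewrite ?ltW// => x /andP[ax xb].
rewrite normal_pdf01E ler_pM2l ?normal_peak_gt0 ?oner_eq0// ler_expR.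
rewrite ler_pM2r ?invr_gt0// lerN2 -real_normK ?num_real//.
rewrite lerXn2r ?nnegrE ?addr_ge0// ler_norml.
have := ler_norm b; have := ler_norm (- a); rewrite normrN.
have := normr_ge0 a; have := normr_ge0 b; lra.
Qed.

Lemma ler_Phibar a b : a <= b -> Phibar b <= Phibar a.
Proof. by rewrite le_eqVlt => /predU1P[->//|/ltr_Phibar/ltW]. Qed.

Lemma ltr_Phibar_inj a b : Phibar b < Phibar a -> a < b.
Proof. by rewrite !ltNge; apply: contraNN; exact: ler_Phibar. Qed.

Lemma ler_Phibar_inj a b : Phibar b <= Phibar a -> a <= b.
Proof. by rewrite !leNgt; apply: contraNN; exact: ltr_Phibar. Qed.

Lemma measurable_Phibar : measurable_fun setT (@Phibar R).
Proof. by apply: nonincreasing_measurable => // a b ab; exact: ler_Phibar. Qed.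

(** Lebesgue measure and the density are both invariant under negation. *)
Lemma stdnormal_lt x : stdnormal `]-oo, (- x)[%classic = (Phibar x)%:E.
Proof.
rewrite -PhibarE [LHS](_ : _ = N `]-oo, (- x)[)// !normal_probE//.
have := @ge0_integral_pushforward _ _ (measurableTypeR R) (measurableTypeR R) R
  (-%R) _ leb setT (fun y => (\1_(`]-oo, (- x)[) y)%:E * (phi y)%:E)%E.
have mf : measurable_fun [set: measurableTypeR R]
    (fun y : R => (\1_(`]-oo, (- x)[) y)%:E * (phi y)%:E)%E.
  by apply: emeasurable_funM; apply/measurable_EFinP => //; exact: measurable_normal_pdf.
move=> /(_ (@oppr_measurable R setT) measurableT mf).
rewrite preimage_setT => h.
transitivity (\int[leb]_y (((\1_(`]-oo, (- x)[) (- y))%:E * (phi (- y))%:E)))%E.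
  rewrite -h; last by move=> y _; rewrite mule_ge0// lee_fin normal_pdf_ge0.
  by apply: eq_measure_integral => A mA _; exact/esym/lebesgue_measureN.
apply: eq_integral => y _; rewrite !indicE !normal_pdf01E sqrrN.
by rewrite !mem_setE !in_itv/= ltrN2 andbT.
Qed.

End normal_tail.

(** * Tail estimates and the quantile function *)

Section normal_tail_estimates.
Context {R : realType}.
Implicit Types a b x h t : R.
Local Notation leb := (@lebesgue_measure R).
Local Notation N := (normal_prob (0 : R) 1).
Local Notation phi := (normal_pdf (0 : R) 1).

Let normal_set1 x : N [set x] = 0%E.
Proof.
have /null_content_dominatesP := @normal_prob_dominates R 0 1.
by apply => //; exact: lebesgue_measure_set1.
Qed.

Lemma stdnormal_ge x : stdnormal `[x, +oo[%classic = (Phibar x)%:E.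
Proof.
rewrite -PhibarE [LHS](_ : _ = N `[x, +oo[)// -(setU1itv false)// measureU//; last first.
  by apply/seteqP; split => y //= [->]; rewrite in_itv/= ltxx.
by rewrite [X in (X + _)%E]normal_set1 add0e.
Qed.

Lemma stdnormal_le x : stdnormal `]-oo, (- x)]%classic = (Phibar x)%:E.
Proof.
rewrite -stdnormal_lt -(setUitv1 true)// measureU//; last first.
  by apply/seteqP; split => y //= -[+ yx]; rewrite yx in_itv/= ltxx.
by rewrite [X in (_ + X)%E]normal_set1 adde0.
Qed.

Lemma PhibarN x : Phibar (- x) = 1 - Phibar x.
Proof.
have : (Phibar x + Phibar (- x))%:E = 1%:E :> \bar R.
  rewrite EFinD -(PhibarE (- x)) -(stdnormal_le x) [X in (X + _)%E](_ : _ = N `]-oo, - x])//.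
  rewrite -measureU//; last first.
    apply/seteqP; split => y //=; rewrite !in_itv/= ?andbT => -[yx].
    by rewrite ltNge yx.
  rewrite -(probability_setT N); congr (N _).
  apply/seteqP; split => y //= _; rewrite !in_itv/= ?andbT.
  by case: (leP y (- x)); [left|right].
by case=> <-; ring.
Qed.

Lemma Phibar0 : Phibar 0 = 1 / 2 :> R.
Proof. by have := PhibarN 0; rewrite oppr0; lra. Qed.

(** Translating by [h] multiplies the density at [y] by [expR (- h * y - h^2 / 2)], and [y > x] on
    the tail. *)
Lemma Phibar_shift x h : 0 <= h ->
  Phibar (x + h) <= expR (- (h * x) - h ^+ 2 / 2) * Phibar x.
Proof.
move=> h0; rewrite -lee_fin EFinM -!PhibarE !normal_probE//.
have mphi A : measurable A ->
    measurable_fun setT (fun x => (\1_A x)%:E * (phi x)%:E)%E.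
  by move=> mA; apply: emeasurable_funM; apply/measurable_EFinP => //; exact: measurable_normal_pdf.
have pos A y : (0 <= (\1_A y)%:E * (phi y)%:E)%E.
  by rewrite mule_ge0// lee_fin normal_pdf_ge0.
rewrite (@ge0_integral_lebesgue_affine _ h 1)//; last exact: mphi.
rewrite mul1e -ge0_integralZl//; last exact: mphi.
have mA := measurableT_comp (mphi _ (measurable_itv `]x + h, +oo[)) (measurable_affine1 h 1).
apply: ge0_le_integral => //.
  by apply: emeasurable_funM; [exact: measurable_cst|exact: mphi].
move=> y _; rewrite !indicE !mem_setE !in_itv/= !andbT /affine1 mul1r.
rewrite addrC ltrD2l.
case: (ltP x y) => xy; rewrite ?mul0e ?mule0// !mul1e -EFinM lee_fin.
rewrite !normal_pdf01E mulrCA ler_wpM2l ?normal_peak_ge0// -expRD ler_expR.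
have : h * x <= h * y by rewrite ler_wpM2l// ltW.
by rewrite sqrrD; lra.
Qed.

Lemma Phibar_le_exp x : 0 <= x -> Phibar x <= expR (- x ^+ 2 / 2) / 2.
Proof.
move=> x0; have := Phibar_shift 0 x0; rewrite add0r mulr0 oppr0 add0r Phibar0.
by rewrite mul1r mulNr.
Qed.

Lemma normal_pdf01_le a x : 0 <= a -> a <= x -> phi x <= phi a.
Proof.
move=> a0 ax; rewrite !normal_pdf01E ler_pM2l ?normal_peak_gt0 ?oner_eq0//.
by rewrite ler_expR ler_pM2r// lerN2 lerXn2r// nnegrE// (le_trans a0).
Qed.

(** Mass of the window from [x] to [x + 1 / (x + 1)], over which the exponent drops by at most
    [1 + 1 / 2]. *)
Lemma Phibar_ge x : 0 <= x ->
  normal_peak 1 * expR (- x ^+ 2 / 2 - 3 / 2) / (x + 1) <= Phibar x.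
Proof.
move=> x0; have x1 : 0 < x + 1 by lra.
pose e := (x + 1)^-1.
have e0 : 0 < e by rewrite invr_gt0.
have xe : x * e + e = 1 by rewrite /e -[X in _ + X]mul1r -mulrDl divff// gt_eqF.
have xe0 : 0 <= x * e by rewrite mulr_ge0// ltW.
have : (x + e - x) * phi (x + e) <= Phibar x - Phibar (x + e).
  apply: Phibar_diff_ge; rewrite ?normal_pdf_ge0 ?lerDl ?(ltW e0)// => y /andP[xy ye].
  by apply: normal_pdf01_le => //; rewrite (le_trans x0)// ltW.
rewrite [x + e - x]addrAC subrr add0r.
move=> /le_trans; move=> /(_ (Phibar x)); rewrite gerBl Phibar_ge0 => /(_ isT).
apply: le_trans; rewrite [leLHS]mulrC ler_pM2l// normal_pdf01E.
rewrite ler_pM2l ?normal_peak_gt0 ?oner_eq0// ler_expR.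
have e1 : e <= 1 by lra.
have : e ^+ 2 <= 1 by rewrite expr_le1// ltW.
rewrite sqrrD; lra.
Qed.

Definition tail_cst : R := normal_peak 1 * expR (- (3 / 2)).

Lemma tail_cst_gt0 : 0 < tail_cst.
Proof. by rewrite mulr_gt0 ?normal_peak_gt0 ?oner_eq0 ?expR_gt0. Qed.

(** Trades [1 / (x + 1)] for [expR (- x)], so that later comparisons concern exponents only. *)
Lemma Phibar_ge_exp x : 0 <= x -> tail_cst * expR (- x ^+ 2 / 2 - x) <= Phibar x.
Proof.
move=> x0; apply: le_trans (Phibar_ge x0); rewrite /tail_cst -!mulrA.
rewrite ler_pM2l ?normal_peak_gt0 ?oner_eq0// !expRD mulrCA.
rewrite -[leRHS]mulrA ler_pM2l ?expR_gt0// ler_pM2l ?expR_gt0//.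
rewrite expRN lef_pV2 ?posrE ?expR_gt0//; last by lra.
by rewrite addrC expR_ge1Dx.
Qed.

Lemma Phibar_gt0 x : 0 < Phibar x.
Proof.
apply: lt_le_trans (ler_Phibar (ler_norm x)).
apply: lt_le_trans (Phibar_ge_exp (normr_ge0 x)).
by rewrite mulr_gt0 ?tail_cst_gt0 ?expR_gt0.
Qed.

(** The increment is at most [h * phi (x - h)]. By [Phibar_ge] and [h * x <= 1], the density at
    [x - h] is at most [expR 3 * (x + 1) * Phibar x]. This turns errors on the centre and the scale
    into relative errors on p-values. *)
Lemma Phibar_sub x h : 0 <= h -> h <= x -> h * (x + 1) <= 1 ->
  Phibar (x - h) <= Phibar x * (1 + expR 3 * (h * (x + 1))).
Proof.
move=> h0 hx hx1; have x0 : 0 <= x by exact: le_trans hx.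
have x1 : 0 < x + 1 by lra.
rewrite mulrDr mulr1 -lerBlDl.
apply: (@le_trans _ _ (h * phi (x - h))).
  rewrite [X in X * _](_ : h = x - (x - h)); last by ring.
  apply: Phibar_diff_le; first by lra.
  by move=> y /andP[xy _]; apply: normal_pdf01_le; rewrite ?subr_ge0// ltW.
rewrite [leRHS](_ : _ = h * (Phibar x * (x + 1) * expR 3)); last by ring.
rewrite ler_wpM2l// normal_pdf01E.
have := Phibar_ge x0; rewrite ler_pdivrMr// => H.
apply: le_trans (ler_wpM2r (expR_ge0 3) H).
rewrite -mulrA -expRD ler_wpM2l ?normal_peak_ge0// ler_expR sqrrB.
have := sqr_ge0 h; have : h * x <= 1 by lra.
lra.
Qed.

Lemma continuous_Phibar : continuous (@Phibar R).
Proof.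
have lip a b : a <= b -> `|Phibar a - Phibar b| <= (b - a) * normal_peak 1.
  move=> ab; rewrite ger0_norm ?subr_ge0 ?ler_Phibar//.
  by apply: Phibar_diff_le => // y _; rewrite normal_pdf_ub// oner_eq0.
have {}lip a b : `|Phibar a - Phibar b| <= normal_peak 1 * `|a - b|.
  rewrite mulrC; case: (leP a b) => ab.
    by rewrite (distrC a) (ger0_norm (_ : 0 <= b - a)) ?subr_ge0// lip.
  rewrite (distrC (Phibar a)) (ger0_norm (_ : 0 <= a - b)) ?subr_ge0 ?(ltW ab)//.
  exact/lip/ltW.
have k0 : 0 < normal_peak 1 :> R by rewrite normal_peak_gt0// oner_eq0.
move=> x; apply/cvgrPdist_le => e e0.
near=> y; apply: le_trans (lip _ _) _.
rewrite mulrC -ler_pdivlMr//.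
near: y; apply: cvgr_dist_le; rewrite ?divr_gt0//; exact: cvg_id.
Unshelve. all: by end_near. Qed.

Lemma Phibar_surj t : 0 < t < 1 -> exists x, Phibar x = t.
Proof.
(* The point where the bound of [Phibar_le_exp] equals [u / 2]; it serves for [t] and, by symmetry,
   for [1 - t]. *)
have bnd u : 0 < u < 1 -> exists2 b : R, 0 <= b & Phibar b <= u.
  move=> /andP[u0 u1]; exists (Num.sqrt (- (2 * ln u))); first exact: sqrtr_ge0.
  apply: le_trans (Phibar_le_exp (sqrtr_ge0 _)) _.
  rewrite sqr_sqrtr; last by rewrite oppr_ge0 pmulr_rle0// ln_le0// ltW.
  by rewrite opprK mulrAC divff// mul1r lnK ?posrE//; lra.
move=> /andP[t0 t1].
have [b b0 bt] := bnd _ (introT andP (conj t0 t1)).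
have [|a a0 at_] := bnd (1 - t); first by lra.
have aN : t <= Phibar (- a) by rewrite PhibarN; lra.
have ab : - a <= b by lra.
have h : Num.min (Phibar (- a)) (Phibar b) <= t <= Num.max (Phibar (- a)) (Phibar b).
  by rewrite ge_min bt orbT/= le_max aN.
have [x _ xt] := IVT ab (continuous_subspaceT continuous_Phibar) h.
by exists x.
Qed.

Lemma Phibar_invK t : 0 < t < 1 -> Phibar (Phibar_inv t) = t.
Proof.
move=> /Phibar_surj[x xt]; rewrite /Phibar_inv.
exact: (@xgetPex _ 0 [set x | Phibar x = t] (ex_intro _ x xt)).
Qed.

End normal_tail_estimates.

(** * Order statistics through counts *)

Section sorted_counts.
Context {R : realType}.

(** The link between ranks and counts, shared by order statistics and ordered p-values; afterwards
    only cardinalities are handled. *)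
Lemma sort_nth_le (s : seq R) k x : (k < size s)%N ->
  (nth 0 (sort <=%R s) k <= x) = (k < count (fun z : R => (z <= x)%R) s)%N.
Proof.
move=> ks; rewrite -(count_sort <=%R).
set t := sort _ _.
have st : sorted <=%R t by apply: sort_sorted; exact: le_total.
have kt : (k < size t)%N by rewrite size_sort.
have mono i j : (i <= j)%N -> (j < size t)%N -> nth 0 t i <= nth 0 t j.
  move=> ij jt; apply: (sorted_leq_nth le_trans le_refl 0 st) => //.
  by rewrite inE (leq_ltn_trans ij).
apply/idP/idP => [kx|].
  rewrite -(cat_take_drop k.+1 t) count_cat ltn_addr//.
  have : all (fun z : R => (z <= x)%R) (take k.+1 t).
    apply/(all_nthP 0) => i; rewrite size_take_min => ik.
    have {}ik : (i < k.+1)%N by apply: leq_trans ik (geq_minl _ _).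
    by rewrite nth_take//; apply: le_trans kx; exact: mono.
  by rewrite all_count => /eqP ->; rewrite size_take_min (minn_idPl _).
apply: contraTT; rewrite -ltNge => kx.
rewrite -leqNgt -(cat_take_drop k t) count_cat.
have -> : count (fun z : R => (z <= x)%R) (drop k t) = 0%N.
  apply/eqP; rewrite -leqn0 leqNgt -has_count; apply/(has_nthP 0) => -[i].
  rewrite size_drop nth_drop => ik; apply/negP; rewrite -ltNge.
  by apply: lt_le_trans kx _; apply: mono; rewrite ?leq_addr// -ltn_subRL.
rewrite addn0; apply: leq_trans (count_size _ _) _.
by rewrite size_take_min geq_minl.
Qed.

Definition count_le n (y : n.-tuple R) (x : R) : nat :=
  #|[set i | (tnth y i <= x)%R]%SET|.

Lemma order_stat_le n (y : n.-tuple R) q x : (0 < q <= n)%N ->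
  (order_stat y q <= x) = (q <= count_le y x)%N.
Proof.
case: q => //= q qn; rewrite /order_stat sort_nth_le ?size_tuple//.
rewrite -[X in count _ X]map_tnth_enum count_map /count_le.
rewrite (eq_card (B := [pred i | tnth y i <= x])); last by move=> i; rewrite !inE.
rewrite cardE enumT /enum_mem size_filter.
by congr (_ < _)%N; apply: eq_count => i; rewrite /= ?inE.
Qed.

Lemma order_statP n (y : n.-tuple R) q : (0 < q <= n)%N ->
  (q <= count_le y (order_stat y q))%N.
Proof. by move=> qn; rewrite -order_stat_le. Qed.

Lemma order_stat_mono n (y : n.-tuple R) q q' : (0 < q')%N -> (q' <= q <= n)%N ->
  order_stat y q' <= order_stat y q.
Proof.
move=> q'0 /andP[q'q qn].
rewrite order_stat_le; last by rewrite q'0; exact: leq_trans qn.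
by apply: (leq_trans q'q); apply: order_statP; rewrite (leq_trans q'0).
Qed.

Let order_stat_update_le n (y y' : n.-tuple R) (i : 'I_n) q : (0 < q <= n)%N ->
  (forall j, j != i -> tnth y j = tnth y' j) ->
  order_stat y q < tnth y i -> order_stat y' q < tnth y' i ->
  order_stat y q <= order_stat y' q -> order_stat y' q <= order_stat y q.
Proof.
move=> qn yy' yi y'i le; rewrite order_stat_le//.
apply: leq_trans (order_statP y qn) _; apply/subset_leq_card/fintype.subsetP => j.
rewrite !inE; case: (eqVneq j i) => [->|ji]; last by rewrite yy'.
by rewrite leNgt yi.
Qed.

(** A coordinate above the [q]-th order statistic does not contribute to the count that determines
    it. *)
Lemma order_stat_update n (y y' : n.-tuple R) (i : 'I_n) q : (0 < q <= n)%N ->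
  (forall j, j != i -> tnth y j = tnth y' j) ->
  order_stat y q < tnth y i -> order_stat y' q < tnth y' i ->
  order_stat y q = order_stat y' q.
Proof.
move=> qn yy' yi y'i; apply/eqP; rewrite eq_le; apply/andP.
have y'y j : j != i -> tnth y' j = tnth y j by move=> /yy' ->.
have /orP[le|le] := le_total (order_stat y q) (order_stat y' q).
  by split=> //; exact: (order_stat_update_le qn yy' yi y'i).
by split=> //; exact: (order_stat_update_le qn y'y y'i yi).
Qed.

End sorted_counts.

(** * Step-up procedures restricted to a set of hypotheses *)

Section step_up.
Context {R : realType}.
Variables (n : nat) (A : {set 'I_n}) (alpha : R).
Implicit Types p : 'I_n -> R.

(** [A] is the full set for the BH procedure and the set of nulls for Simes' inequality; levels are
    divided by [n] in both cases, not by the size of [A]. *)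
Definition hits p (l : nat) : nat := #|[set i in A | (p i <= alpha * l%:R / n%:R)%R]%SET|.

Definition step_up_count p : nat := \max_(l < n.+1 | (l <= hits p l)%N) l.

Definition step_up p : {set 'I_n} :=
  [set i in A | (p i <= alpha * (step_up_count p)%:R / n%:R)%R]%SET.

Lemma step_up_countP p : (step_up_count p <= hits p (step_up_count p))%N.
Proof.
have [|l lP lE] := @eq_bigmax_cond _ [pred l : 'I_n.+1 | (l <= hits p l)%N]
    (fun l : 'I_n.+1 => l : nat).
  by apply/card_gt0P; exists ord0.
by rewrite /step_up_count lE.
Qed.

Lemma step_up_count_max p l : (l <= n)%N -> (l <= hits p l)%N -> (l <= step_up_count p)%N.
Proof.
move=> ln lP; have ln' : (l < n.+1)%N by [].
exact: (@leq_bigmax_cond _ (fun l : 'I_n.+1 => (l <= hits p l)%N) (fun l : 'I_n.+1 => l : nat) (Ordinal ln')).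
Qed.

Lemma step_up_count_le p : (step_up_count p <= n)%N.
Proof. by apply/bigmax_leqP => l _; rewrite -ltnS. Qed.

Lemma hits_mono p l l' : 0 <= alpha -> (l <= l')%N -> (hits p l <= hits p l')%N.
Proof.
move=> a0 ll'; apply/subset_leq_card/fintype.subsetP => i; rewrite !inE => /andP[-> pi]/=.
by apply: le_trans pi _; rewrite ler_wpM2r ?invr_ge0// ler_wpM2l// ler_nat.
Qed.

(** If there were more rejections than the count, their number would be a larger admissible level,
    as [hits] is nondecreasing. *)
Lemma card_step_up p : 0 <= alpha -> #|step_up p| = step_up_count p.
Proof.
move=> a0; apply/eqP; rewrite eqn_leq step_up_countP andbT.
apply: step_up_count_max; first by rewrite -[leqRHS]card_ord max_card.
exact/hits_mono/step_up_countP.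
Qed.

Let step_up_count_update_le p p' i : 0 <= alpha ->
  (forall j, j != i -> p j = p' j) -> i \in step_up p -> i \in step_up p' ->
  (step_up_count p <= step_up_count p')%N -> (step_up_count p' <= step_up_count p)%N.
Proof.
move=> a0 pp' ip ip' le; apply: step_up_count_max; first exact: step_up_count_le.
apply: leq_trans (step_up_countP p') _.
apply/subset_leq_card/fintype.subsetP => j; rewrite !inE.
case: (eqVneq j i) => [->|ji]; last by rewrite pp'.
move=> /andP[-> _]/=; move: ip; rewrite inE => /andP[_ pi].
by apply: le_trans pi _; rewrite ler_wpM2r ?invr_ge0// ler_wpM2l// ler_nat.
Qed.

(** Leave-one-out property: at the larger of the two counts, [i] is a hit for both arrays and the
    other entries agree, so that level is admissible for both. *)
Lemma step_up_count_update p p' i : 0 <= alpha ->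
  (forall j, j != i -> p j = p' j) -> i \in step_up p -> i \in step_up p' ->
  step_up_count p = step_up_count p'.
Proof.
move=> a0 pp' ip ip'; apply/eqP; rewrite eqn_leq.
have p'p j : j != i -> p' j = p j by move=> /pp' ->.
have /orP[le|le] := leq_total (step_up_count p) (step_up_count p').
  by rewrite le; exact: (step_up_count_update_le a0 pp' ip ip').
by rewrite le andbT; exact: (step_up_count_update_le a0 p'p ip' ip).
Qed.

End step_up.

Section BH_step_up.
Context {R : realType}.
Variables (n : nat) (alpha u s : R) (y : n.-tuple R).

Lemma pval_ord_le l : (l <= n)%N ->
  (pval_ord y u s l <= alpha * l%:R / n%:R) =
  (l <= hits [set: 'I_n]%SET alpha (pval y u s) l)%N.
Proof.
case: l => [|l] ln; first by rewrite /pval_ord/= mulr0 mul0r lexx.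
rewrite /pval_ord [nth _ _ _]/= sort_nth_le; last by rewrite size_map size_enum_ord.
rewrite count_map /hits.
rewrite (eq_card (B := [pred i | pval y u s i <= alpha * l.+1%:R / n%:R])); last first.
  by move=> i; rewrite !inE.
rewrite cardE enumT /enum_mem size_filter.
by congr (_ < _)%N; apply: eq_count => i; rewrite /= ?inE.
Qed.

Lemma BH_countE : BH_count alpha u s y = step_up_count [set: 'I_n]%SET alpha (pval y u s).
Proof. by apply: eq_bigl => l; rewrite pval_ord_le// -ltnS. Qed.

Lemma BH_step_up : BH alpha u s y = step_up [set: 'I_n]%SET alpha (pval y u s).
Proof. by apply/setP => i; rewrite !inE BH_countE. Qed.

End BH_step_up.

(** * Measurability of the procedures *)

Section measurable_finite.
Context d (T : measurableType d) (I : finType).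

(** The procedures depend on the data through finitely many comparisons; any predicate of these,
    even one quantified over all subsets, gives a finite union of finite intersections. *)
Lemma measurable_bool_array (b : T -> I -> bool) (F : {ffun I -> bool} -> Prop) :
  (forall i, measurable [set t | b t i]) ->
  measurable [set t | F [ffun i => b t i]].
Proof.
move=> mb.
rewrite (_ : mkset _ = \bigcup_(a in [set a | F a]) \bigcap_(i in [set: I])
    [set t | b t i = a i]); last first.
  apply/seteqP; split => t /=.
    by move=> Ft; exists [ffun i => b t i] => //= i _; rewrite /= ffunE.
  move=> [a Fa ta]; rewrite (_ : [ffun _ => _] = a)//.
  by apply/ffunP => i; rewrite ffunE; exact: ta.
apply: fin_bigcup_measurable; first exact: finite_finset.
move=> a _; apply: fin_bigcap_measurable => //.
move=> i _; case: (a i); first exact: mb.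
rewrite (_ : mkset _ = ~` [set t | b t i]); first exact: measurableC.
by apply/seteqP; split => t /=; case: (b t i).
Qed.

Lemma measurable_fun_bool_array d' (U : measurableType d')
    (b : T -> I -> bool) (f : {ffun I -> bool} -> U) :
  (forall i, measurable [set t | b t i]) ->
  measurable_fun setT (fun t => f [ffun i => b t i]).
Proof.
move=> mb _ B mB; rewrite setTI.
exact: (@measurable_bool_array b (fun a => B (f a))).
Qed.

End measurable_finite.

Section measurable_real.
Context {R : realType} d (T : measurableType d).
Implicit Types f g : T -> R.

Lemma measurable_fun_le_set f :
  (forall x, measurable [set t | f t <= x]) -> measurable_fun setT f.
Proof.
move=> mf; apply: (measurability _ (RGenOInfty.measurableE R)).
move=> _ [_ [x ->] <-]; rewrite setTI.
rewrite (_ : _ @^-1` _ = ~` [set t | f t <= x]); first exact: measurableC.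
by apply/seteqP; split => t /=; rewrite in_itv/= andbT ltNge => /negP.
Qed.

(** Written as [x * (x^2)^(-1)], a real power of a nonnegative base; both sides vanish at 0. *)
Lemma measurable_inv : measurable_fun setT (fun x : R => x^-1).
Proof.
rewrite (_ : (fun x => _) = fun x : R => x * (x ^+ 2) `^ (- 1)).
  apply: measurable_funM => //.
  by apply: (measurableT_comp (measurable_powR _)); exact: measurable_funX.
apply/funext => x; have [->|x0] := eqVneq x 0; first by rewrite invr0 mul0r.
by rewrite powR_inv1 ?sqr_ge0// expr2 invfM mulrA divff// mul1r.
Qed.

Lemma measurable_fun_div f g :
  measurable_fun setT f -> measurable_fun setT g ->
  measurable_fun setT (fun t => f t / g t).
Proof.
move=> mf mg; apply: measurable_funM => //.
exact: (measurableT_comp measurable_inv).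
Qed.

Lemma measurable_le_set f g :
  measurable_fun setT f -> measurable_fun setT g ->
  measurable [set t | f t <= g t].
Proof.
move=> mf mg; have := measurable_fun_ler mf mg => /(_ measurableT [set true]).
by rewrite setTI; apply.
Qed.

End measurable_real.

Section measurable_procedures.
Context {R : realType} (n : nat).
Local Notation tup := (n.-tuple R).

Lemma measurable_order_stat q : (0 < q <= n)%N ->
  measurable_fun setT (fun y : tup => order_stat y q).
Proof.
move=> qn; apply: measurable_fun_le_set => x.
pose F (a : {ffun 'I_n -> bool}) := (q <= #|[set i | a i]%SET|)%N.
rewrite (_ : mkset _ = [set y : tup | F [ffun i => tnth y i <= x]]).
  refine (@measurable_bool_array _ tup _ (fun y i => tnth y i <= x) F _) => i.
  exact: (measurable_le_set (measurable_tnth i) (measurable_cst x)).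
suff E y : (order_stat y q <= x) = F [ffun i => tnth y i <= x].
  by apply/seteqP; split => y /=; rewrite E.
by rewrite order_stat_le// /F; congr (_ <= _)%N; apply: eq_card => i; rewrite !inE ffunE.
Qed.

Lemma measurable_sigma_plus k0 : (0 < qn R n <= n)%N -> (0 < qn' R n <= n)%N ->
  measurable_fun setT (fun y : tup => sigma_plus k0 y).
Proof.
move=> q1 q2; apply: measurable_funM => //.
by apply: measurable_funB; exact: measurable_order_stat.
Qed.

Lemma measurable_theta_plus k0 : (0 < qn R n <= n)%N -> (0 < qn' R n <= n)%N ->
  measurable_fun setT (fun y : tup => theta_plus k0 y).
Proof.
move=> q1 q2; apply: measurable_funD; first exact: measurable_order_stat.
by apply: measurable_funM => //; exact: measurable_sigma_plus.
Qed.

Lemma measurable_pval (u s : tup -> R) i :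
  measurable_fun setT u -> measurable_fun setT s ->
  measurable_fun setT (fun y : tup => pval y (u y) (s y) i).
Proof.
move=> mu ms; apply: (measurableT_comp measurable_Phibar).
apply: measurable_fun_div => //; apply: measurable_funB => //.
exact: measurable_tnth.
Qed.

(** A finite object that determines both the rejections and [FDPbar]: measurability and invariance
    need to be shown for it alone. *)
Definition pval_array (alpha u s : R) (y : tup) : {ffun 'I_n * 'I_n.+1 -> bool} :=
  [ffun il : 'I_n * 'I_n.+1 => pval y u s il.1 <= alpha * (il.2 : nat)%:R / n%:R].

Lemma measurable_pval_array d (T : measurableType d) alpha (u s : tup -> R)
    (f : {ffun 'I_n * 'I_n.+1 -> bool} -> T) :
  measurable_fun setT u -> measurable_fun setT s ->
  measurable_fun setT (fun y : tup => f (pval_array alpha (u y) (s y) y)).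
Proof.
move=> mu ms; refine (@measurable_fun_bool_array _ tup _ _ _ (fun y (il : 'I_n * 'I_n.+1) =>
  pval y (u y) (s y) il.1 <= alpha * (il.2 : nat)%:R / n%:R) f _) => i.
exact: (measurable_le_set (measurable_pval _ mu ms) (measurable_cst _)).
Qed.

Lemma measurable_set_pval_array alpha (u s : tup -> R)
    (F : {ffun 'I_n * 'I_n.+1 -> bool} -> Prop) :
  measurable_fun setT u -> measurable_fun setT s ->
  measurable [set y : tup | F (pval_array alpha (u y) (s y) y)].
Proof.
move=> mu ms; refine (@measurable_bool_array _ tup _ (fun y (il : 'I_n * 'I_n.+1) =>
  pval y (u y) (s y) il.1 <= alpha * (il.2 : nat)%:R / n%:R) F _) => i.
exact: (measurable_le_set (measurable_pval _ mu ms) (measurable_cst _)).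
Qed.

End measurable_procedures.

(** * Equivariance under a common shift and scale *)

Section equivariance.
Context {R : realType} (n : nat).
Local Notation tup := (n.-tuple R).
Variables (c s : R).
Hypothesis s0 : 0 < s.
Local Notation aff := (affine (fun _ : 'I_n => c) s).

Lemma order_stat_affine (y : tup) q : (0 < q <= n)%N ->
  order_stat (aff y) q = affine1 c s (order_stat y q).
Proof.
move=> qn.
have E x : (order_stat (aff y) q <= x) = (affine1 c s (order_stat y q) <= x).
  have affE z : (affine1 c s z <= x) = (z <= (x - c) / s).
    by rewrite /affine1 ler_pdivlMr// lerBrDl mulrC.
  rewrite order_stat_le// affE order_stat_le//; congr (_ <= _)%N.
  by apply: eq_card => i; rewrite !inE tnth_mktuple affE.
by apply/eqP; rewrite eq_le E lexx -E lexx.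
Qed.

Lemma sigma_plus_affine k0 (y : tup) : (0 < qn R n <= n)%N -> (0 < qn' R n <= n)%N ->
  sigma_plus k0 (aff y) = s * sigma_plus k0 y.
Proof.
move=> q1 q2; rewrite /sigma_plus !order_stat_affine// /affine1 mulrA; congr (_ / _).
ring.
Qed.

Lemma theta_plus_affine k0 (y : tup) : (0 < qn R n <= n)%N -> (0 < qn' R n <= n)%N ->
  theta_plus k0 (aff y) = affine1 c s (theta_plus k0 y).
Proof.
move=> q1 q2; rewrite /theta_plus sigma_plus_affine// order_stat_affine// /affine1.
ring.
Qed.

Lemma pval_affine (y : tup) u v :
  pval (aff y) (affine1 c s u) (s * v) =1 pval y u v.
Proof.
move=> i; rewrite /pval tnth_mktuple /affine1; congr Phibar.
rewrite opprD addrACA subrr add0r -mulrBr -mulf_div divff ?mul1r// gt_eqF//.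
Qed.

End equivariance.

(** * Reduction to independent shifted coordinates *)

Section array_procedures.
Context {R : realType} (n : nat).
Local Notation tup := (n.-tuple R).
Local Notation array := {ffun 'I_n * 'I_n.+1 -> bool}.
Implicit Types (a : array) (A : {set 'I_n}) (m : 'rV[R]_n).

Definition arr_count A a : nat :=
  \max_(l < n.+1 | (l <= #|[set i in A | a (i, l)]|)%N) l.

Definition arr_set A a : {set 'I_n} := [set i in A | a (i, inord (arr_count A a))].

Definition arr_FDPbar a (S : {set 'I_n}) : R :=
  \big[Num.min/1]_(1 <= l < n.+1)
    ((\sum_(i in S) (~~ a (i, inord l))%:R + l%:R - 1) / (maxn #|S| 1)%:R).

Lemma step_up_countE alpha A (y : tup) u s :
  step_up_count A alpha (pval y u s) = arr_count A (pval_array alpha u s y).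
Proof.
apply: eq_bigl => l; congr (_ <= _)%N; apply: eq_card => i.
by rewrite !inE ffunE.
Qed.

Lemma step_upE alpha A (y : tup) u s :
  step_up A alpha (pval y u s) = arr_set A (pval_array alpha u s y).
Proof.
apply/setP => i; rewrite !inE ffunE/= -step_up_countE inordK//.
by rewrite ltnS step_up_count_le.
Qed.

Lemma BHE alpha (y : tup) u s : 0 <= alpha ->
  BH alpha u s y = arr_set [set: 'I_n]%SET (pval_array alpha u s y).
Proof. by move=> a0; rewrite BH_step_up// step_upE. Qed.

Lemma FDPbarE alpha (y : tup) u s S :
  FDPbar alpha u s y S = arr_FDPbar (pval_array alpha u s y) S.
Proof.
apply: eq_big_nat => l /andP[_ ln]; congr ((_ + _ - _) / _).
by apply: eq_bigr => i _; rewrite ffunE/= inordK// ltNge.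
Qed.

Definition plus_array alpha k0 (y : tup) : array :=
  pval_array alpha (theta_plus k0 y) (sigma_plus k0 y) y.

Lemma plus_array_affine alpha k0 c s (y : tup) : 0 < s ->
  (0 < qn R n <= n)%N -> (0 < qn' R n <= n)%N ->
  plus_array alpha k0 (affine (fun _ : 'I_n => c) s y) = plus_array alpha k0 y.
Proof.
move=> s0 q1 q2; apply/ffunP => il; rewrite !ffunE theta_plus_affine//.
by rewrite sigma_plus_affine// pval_affine.
Qed.

Definition shift (v : 'I_n -> R) (y : tup) : tup := affine v 1 y.

Lemma tnth_shift v y i : tnth (shift v y) i = v i + tnth y i.
Proof. by rewrite tnth_mktuple /affine1 mul1r. Qed.

Lemma measurable_shift (v : 'I_n -> R) : measurable_fun setT (shift v).
Proof. exact: measurable_affine. Qed.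

(** Isolates the common shift and scale, which [plus_array_affine] then discards; [z] disappears
    with them and only [m / sqrt (1 - rho)] remains. *)
Lemma affine_mean_shift rho m z (y : tup) : 0 <= rho < 1 ->
  affine (mean_shift rho m z) (Num.sqrt (1 - rho)) y =
  affine (fun _ : 'I_n => Num.sqrt rho * z) (Num.sqrt (1 - rho))
    (shift (((Num.sqrt (1 - rho))^-1 *: m) 0) y).
Proof.
move=> /andP[r0 r1]; apply: eq_from_tnth => i; rewrite !tnth_mktuple.
rewrite /affine1 /mean_shift mxE mul1r mulrDr mulrA divff ?gt_eqF ?sqrtr_gt0 ?subr_gt0//.
by rewrite mul1r addrA [Num.sqrt rho * z + _]addrC.
Qed.

End array_procedures.

Section transfer.
Context {R : realType} d (T : measurableType d) (P : probability T R).
Variables (n : nat) (rho : R) (m : 'rV[R]_n) (Y : {RV P >-> n.-tuple R}).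
Hypothesis rho01 : 0 <= rho < 1.
Hypothesis YG : gaussian_vector Y m (equicorr n rho).
Hypothesis q1 : (0 < qn R n <= n)%N.
Hypothesis q2 : (0 < qn' R n <= n)%N.
Let m' := ((Num.sqrt (1 - rho))^-1 *: m) 0.
Local Notation array := {ffun 'I_n * 'I_n.+1 -> bool}.

Lemma integral_plus_array alpha k0 (f : array -> R) : (forall a, 0 <= f a) ->
  (\int[P]_w (f (plus_array alpha k0 (Y w)))%:E =
   \int[gauss n]_y (f (plus_array alpha k0 (shift m' y)))%:E)%E.
Proof.
move=> f0.
have mf : measurable_fun setT (fun y : n.-tuple R => f (plus_array alpha k0 y)).
  apply: measurable_pval_array; first exact: measurable_theta_plus.
  exact: measurable_sigma_plus.
rewrite (gaussian_vector_law rho01 YG (f := fun y => (f (plus_array alpha k0 y))%:E)).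
- have s0 : 0 < Num.sqrt (1 - rho).
    by rewrite sqrtr_gt0 subr_gt0; case/andP: rho01.
  under eq_integral do under eq_integral do
    rewrite affine_mean_shift// plus_array_affine//.
  by rewrite integral_cst//= probability_setT mule1.
- exact/measurable_EFinP.
- by move=> y; rewrite lee_fin.
Qed.

Lemma probability_plus_array alpha k0 (F : array -> Prop) :
  P [set w | F (plus_array alpha k0 (Y w))] =
  gauss n [set y | F (plus_array alpha k0 (shift m' y))].
Proof.
have mF : measurable [set y : n.-tuple R | F (plus_array alpha k0 y)].
  apply: measurable_set_pval_array; first exact: measurable_theta_plus.
  exact: measurable_sigma_plus.
have := @integral_plus_array alpha k0 (fun a => \1_(F : set array) a) (fun a => ler0n _ _).
have E (U : Type) (g : U -> n.-tuple R) :
    (fun w => (\1_(F : set array) (plus_array alpha k0 (g w)))%:E : \bar R) =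
    (fun w => (\1_([set w | F (plus_array alpha k0 (g w))]) w)%:E).
  apply/funext => w; rewrite !indicE; congr ((nat_of_bool _)%:R%:E).
rewrite !E !integral_indic ?setIT//.
- by rewrite -[X in measurable X]setTI; exact: (measurable_shift m' measurableT mF).
- have mY : measurable_fun setT Y by exact: measurable_funPT.
  by rewrite -[X in measurable X]setTI; exact: (mY measurableT _ mF).
Qed.

End transfer.

(** Meant for the oracle, whose raw p-values are not invariant under shifts; for [rho = 0] the
    common shift is zero. *)
Lemma integral_independent {R : realType} d (T : measurableType d) (P : probability T R)
    n (m : 'rV[R]_n) (Y : {RV P >-> n.-tuple R}) (f : n.-tuple R -> \bar R) :
  gaussian_vector Y m (equicorr n 0) ->
  measurable_fun setT f -> (forall y, 0 <= f y)%E ->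
  (\int[P]_w f (Y w) = \int[gauss n]_y f (shift (m 0%R) y))%E.
Proof.
move=> YG mf f0; have r01 : 0 <= (0 : R) < 1 by rewrite lexx ltr01.
rewrite (gaussian_vector_law r01 YG)//.
have E z y : affine (mean_shift 0 m z) (Num.sqrt (1 - 0)) y = shift (m 0) y :> n.-tuple R.
  apply: eq_from_tnth => i; rewrite !tnth_mktuple.
  by rewrite /mean_shift sqrtr0 mul0r addr0 subr0 sqrtr1.
under eq_integral do under eq_integral do rewrite E.
by rewrite integral_cst//= probability_setT mule1.
Qed.

(** * Leave-one-out bound for one null coordinate *)

Section leave_one_out.
Context {R : realType} (n k0 : nat).
Variables (alpha dt ds : R) (A : {set 'I_n}) (v : 'I_n -> R).
Local Notation tup := (n.-tuple R).
Hypothesis alpha01 : 0 < alpha < 1 / 2.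
Hypothesis q1 : (0 < qn R n <= n)%N.
Hypothesis q2 : (0 < qn' R n <= qn R n)%N.
Hypothesis xq0 : 0 <= Phibar_inv ((qn R n)%:R / n%:R : R).
Hypothesis ds1 : ds < 1.

(** One-sided: false discoveries are created by a centre or a scale that is too small. *)
Definition good_fit (y : tup) : bool :=
  (- dt <= theta_plus k0 y) && (1 - ds <= sigma_plus k0 y).

Definition plus_pval (y : tup) : 'I_n -> R :=
  pval y (theta_plus k0 y) (sigma_plus k0 y).

Local Notation count y := (step_up_count A alpha (plus_pval y)).
Local Notation rejected y := (step_up A alpha (plus_pval y)).

Let n0 : (0 < n)%N.
Proof. by case/andP: q1 => /leq_trans; apply. Qed.

Let nR0 : (0 : R) < n%:R.
Proof. by rewrite ltr0n. Qed.

Let q2n : (0 < qn' R n <= n)%N.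
Proof.
by case/andP: q1 => _ qn1; case/andP: q2 => -> /leq_trans; apply.
Qed.

Lemma rejected_count_gt0 y i : i \in rejected y -> (0 < count y)%N.
Proof.
by move=> iy; rewrite -(card_step_up A (plus_pval y) (ltW (proj1 (andP alpha01)))); apply/card_gt0P; exists i.
Qed.

Lemma level_itv l : (0 < l <= n)%N -> 0 < alpha * l%:R / n%:R < 1 / 2.
Proof.
move=> /andP[l0 ln]; have /andP[a0 a1] := alpha01.
rewrite divr_gt0 ?mulr_gt0 ?ltr0n//=; apply: le_lt_trans a1.
by rewrite ler_pdivrMr// ler_wpM2l ?(ltW a0)// ler_nat.
Qed.

Lemma Phibar_inv_ge0 (t : R) : 0 < t <= 1 / 2 -> 0 <= Phibar_inv t.
Proof.
move=> /andP[t0 t1]; apply: ler_Phibar_inj.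
by rewrite Phibar_invK ?t0/= ?Phibar0//; lra.
Qed.

Lemma rejected_ge y i : good_fit y -> i \in rejected y ->
  theta_plus k0 y + sigma_plus k0 y * Phibar_inv (alpha * (count y)%:R / n%:R)
  <= tnth y i.
Proof.
move=> /andP[gt gs] iy; have c0 := rejected_count_gt0 iy.
have /andP[l0 l1] : 0 < alpha * (count y)%:R / n%:R < 1 / 2.
  by apply: level_itv; rewrite c0 step_up_count_le.
have s0 : 0 < sigma_plus k0 y by apply: lt_le_trans gs; rewrite subr_gt0.
move: iy; rewrite inE => /andP[_]; move: l0 l1; set t := (_ / n%:R) => l0 l1.
have tE : Phibar (Phibar_inv t) = t by apply: Phibar_invK; rewrite l0/=; lra.
rewrite -[X in _ <= X]tE => /ler_Phibar_inj.
by rewrite ler_pdivlMr// lerBrDl mulrC.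
Qed.

(** The threshold exceeds [Y_(q_n)] by [sigma_plus] times the sum of two quantiles, one nonnegative
    by [xq0], the other positive because the level is below 1/2. *)
Lemma rejected_gt y i : good_fit y -> i \in rejected y ->
  order_stat y (qn R n) < tnth y i.
Proof.
move=> gy iy; apply: lt_le_trans (rejected_ge gy iy).
have c0 := rejected_count_gt0 iy.
have /andP[l0 l1] : 0 < alpha * (count y)%:R / n%:R < 1 / 2.
  by apply: level_itv; rewrite c0 step_up_count_le.
have s0 : 0 < sigma_plus k0 y.
  by case/andP: gy => _ gs; apply: lt_le_trans gs; rewrite subr_gt0.
rewrite /theta_plus -addrA ltrDl; apply: ltr_wpDl; first by rewrite mulr_ge0// ltW.
rewrite mulr_gt0//.
apply: ltr_Phibar_inj; move: l0 l1; set t := (_ / n%:R) => l0 l1.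
by rewrite Phibar_invK ?Phibar0 ?l0//=; lra.
Qed.

Lemma rejected_ge_good y i : good_fit y -> i \in rejected y ->
  (1 - ds) * Phibar_inv (alpha * (count y)%:R / n%:R) - dt <= tnth y i.
Proof.
move=> gy iy; apply: le_trans (rejected_ge gy iy).
have c0 := rejected_count_gt0 iy.
have /andP[l0 l1] : 0 < alpha * (count y)%:R / n%:R < 1 / 2.
  by apply: level_itv; rewrite c0 step_up_count_le.
have X0 : 0 <= Phibar_inv (alpha * (count y)%:R / n%:R).
  by apply: Phibar_inv_ge0; rewrite l0 ltW.
by case/andP: gy => gt gs; rewrite addrC lerD// ler_wpM2r.
Qed.

(** By [rejected_gt] both order statistics, hence the estimators and the other p-values, are
    unchanged; then [step_up_count_update] applies. *)
Lemma rejected_count_update y y' i : (forall j, j != i -> tnth y j = tnth y' j) ->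
  good_fit y -> i \in rejected y -> good_fit y' -> i \in rejected y' ->
  count y = count y'.
Proof.
move=> yy' gy iy gy' iy'.
have le_q (z : tup) : order_stat z (qn' R n) <= order_stat z (qn R n).
  case/andP: q1 => _ qn1; case/andP: q2 => q20 qq.
  apply: order_stat_mono; first exact: q20.
  by apply/andP; split.
have gty := rejected_gt gy iy; have gty' := rejected_gt gy' iy'.
have oq : order_stat y (qn R n) = order_stat y' (qn R n).
  exact: (order_stat_update q1 yy' gty gty').
have oq' : order_stat y (qn' R n) = order_stat y' (qn' R n).
  exact: (order_stat_update q2n yy' (le_lt_trans (le_q _) gty) (le_lt_trans (le_q _) gty')).
have sE : sigma_plus k0 y = sigma_plus k0 y' by rewrite /sigma_plus oq oq'.
have tE : theta_plus k0 y = theta_plus k0 y' by rewrite /theta_plus oq sE.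
apply: (step_up_count_update (ltW (proj1 (andP alpha01))) _ iy iy') => j ji.
by rewrite /plus_pval sE tE /pval yy'.
Qed.

(** With exact parameters, [ds = dt = 0], the tail equals [alpha * l / n], so [B] is thought of as
    slightly above [alpha / n]. *)
Variable B : R.
Hypothesis tailB : forall l, (0 < l <= n)%N ->
  Phibar ((1 - ds) * Phibar_inv (alpha * l%:R / n%:R) - dt) <= B * l%:R.

(** On a good fit, the sum over the nulls is the false discovery proportion; without rejections both
    numerator and quotient are 0. *)
Definition loo_weight (i : 'I_n) (y : tup) : R :=
  (good_fit y && (i \in rejected y))%:R / (count y)%:R.

Lemma loo_weight_ge0 i y : 0 <= loo_weight i y.
Proof. by rewrite divr_ge0. Qed.

Lemma measurable_loo_weight i : measurable_fun setT (loo_weight i).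
Proof.
have mt : measurable_fun setT (fun y : tup => theta_plus k0 y).
  exact: measurable_theta_plus.
have ms : measurable_fun setT (fun y : tup => sigma_plus k0 y).
  exact: measurable_sigma_plus.
rewrite (_ : loo_weight i = fun y => \1_([set z : tup | good_fit z]) y *
  ((i \in arr_set A (plus_array alpha k0 y))%:R /
   (arr_count A (plus_array alpha k0 y))%:R)); last first.
  apply/funext => y; rewrite /loo_weight /plus_pval step_upE step_up_countE.
  by rewrite mulrA -natrM mulnb mem_setE.
apply: measurable_funM.
  apply: measurable_indic; rewrite (_ : [set z : tup | good_fit z] =
    [set y | (- dt : R) <= theta_plus k0 y] `&` [set y | (1 - ds : R) <= sigma_plus k0 y]).
    by apply: measurableI; [exact: (measurable_le_set (measurable_cst _) mt)|
      exact: (measurable_le_set (measurable_cst _) ms)].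
  by apply/seteqP; split => y /=; [case/andP|case=> yt ys; apply/andP].
exact: (@measurable_pval_array R n _ R alpha _ _
  (fun a => (i \in arr_set A a)%:R / (arr_count A a)%:R) mt ms).
Qed.

(* Once all coordinates but the i-th are frozen, the order statistics, hence
   the estimators and the number of rejections, take the same value for all
   values of the i-th coordinate that lead to its rejection. *)
Lemma integral_loo_weight i : v i = 0 ->
  (\int[gauss n]_y (loo_weight i (shift v y))%:E <= B%:E)%E.
Proof.
move=> vi.
have mf : measurable_fun setT (fun y : tup => (loo_weight i (shift v y))%:E).
  by apply/measurable_EFinP; exact: (measurableT_comp (measurable_loo_weight i) (measurable_shift v)).
rewrite (ge0_integral_gauss_resample i mf); last first.
  by move=> y; rewrite lee_fin loo_weight_ge0.
have B0 : 0 <= B.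
  have := @tailB n; rewrite n0 leqnn => /(_ isT) h.
  by rewrite -(pmulr_lge0 _ nR0); apply: le_trans h; exact: Phibar_ge0.
apply: (@le_trans _ _ (\int[gauss n]_y (cst B%:E) y)%E); last first.
  by rewrite integral_cst//= probability_setT mule1.
have mupd : measurable_fun setT (fun p : tup * R =>
    (loo_weight i (shift v (upd_tuple p.1 i p.2)))%:E).
  apply: (measurableT_comp mf).
  apply: (measurableT_comp (measurable_upd_tuple i) (g := fun p : tup * R => (p.2, p.1))).
  exact: measurable_fun_pair.
apply: ge0_le_integral => //.
- by move=> y _; apply: integral_ge0 => x _; rewrite lee_fin loo_weight_ge0.
- apply: (measurable_fun_fubini_tonelli_F _ mupd) => p.
  by rewrite lee_fin loo_weight_ge0.
move=> y _ /=.
pose z x := shift v (upd_tuple y i x).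
have zi x : tnth (z x) i = x by rewrite tnth_shift vi add0r tnth_upd_tuple eqxx.
have zj x x' j : j != i -> tnth (z x) j = tnth (z x') j.
  by move=> ji; rewrite !tnth_shift !tnth_upd_tuple (negbTE ji).
have [[x0 /andP[gx0 ix0]]|none] := pselect (exists x0, good_fit (z x0) && (i \in rejected (z x0))); last first.
  rewrite integral0_eq ?lee_fin// => x _; rewrite /loo_weight.
  by case: (boolP (_ && _)) => [h|_]; [exfalso; apply: none; exists x|rewrite mul0r].
pose l := count (z x0).
have l0 : (0 < l)%N by exact: rejected_count_gt0 ix0.
have ln : (l <= n)%N by exact: step_up_count_le.
have lR : (0 : R) < l%:R by rewrite ltr0n.
pose t := (1 - ds) * Phibar_inv (alpha * l%:R / n%:R) - dt.
(* The count being frozen at [l], the weight is at most [1 / l] and lives on a half-line of mass at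
   most [B * l]; the factors [l] cancel. *)
apply: (@le_trans _ _ (\int[stdnormal]_x (l%:R^-1 * \1_(`[t, +oo[) x)%:E)%E).
  apply: ge0_le_integral => //.
  - by move=> x _; rewrite lee_fin loo_weight_ge0.
  - exact: (measurableT_comp mupd (measurable_fun_pair (measurable_cst y) (@measurable_id _ _ setT))).
  - by apply/measurable_EFinP; apply: measurable_funM => //; exact: measurable_indic.
  move=> x _; rewrite lee_fin /loo_weight -/(z x).
  case: (boolP (_ && _)) => [/andP[gx ix]|_]; last by rewrite mul0r mulr_ge0.
  have lE : count (z x) = l by apply: (rejected_count_update (zj _ _) gx ix gx0 ix0).
  rewrite lE mulrC; apply: ler_wpM2l; first by rewrite invr_ge0 ler0n.
  rewrite indicE.
  have : t <= x by have := rejected_ge_good gx ix; rewrite lE zi.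
  by move=> tx; rewrite /= mem_setE in_itv/= tx.
under eq_integral do rewrite EFinM.
have mI : measurable_fun setT (fun x : R => (\1_(`[t, +oo[) x)%:E : \bar R).
  by apply/measurable_EFinP; exact: measurable_indic.
rewrite ge0_integralZl//.
rewrite integral_indic// setIT [X in (_ * X)%E](stdnormal_ge t).
rewrite -EFinM lee_fin ler_pdivrMl// mulrC.
by apply: tailB; rewrite l0.
Qed.

End leave_one_out.

(** * Chebyshev's inequality for counts of independent hits *)

Section chebyshev_counts.
Context {R : realType} (n : nat).
Variables (J : {set 'I_n}) (D : set R) (p : R).
Hypothesis mD : measurable D.
Hypothesis Dp : stdnormal D = p%:E.
Local Notation tup := (n.-tuple R).
Local Notation ind i := (fun y : tup => \1_D (tnth y i) : R).

Definition hit_count (y : tup) : R := \sum_(i <- enum J) \1_D (tnth y i).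

Local Notation M := (#|J|%:R * p).

Let mind i : measurable_fun setT (ind i).
Proof. exact: (measurableT_comp (measurable_indic mD) (measurable_tnth i)). Qed.

Let p0 : 0 <= p.
Proof. by rewrite -lee_fin -Dp. Qed.

Let int1D : (\int[stdnormal]_x (\1_D x)%:E = p%:E)%E.
Proof. by rewrite integral_indic// setIT. Qed.

Let integral_ind i : (\int[gauss n]_y (ind i y)%:E = p%:E)%E.
Proof.
rewrite (ge0_integral_gauss_resample i); last 2 first.
- exact/measurable_EFinP.
- by move=> y; rewrite lee_fin.
under eq_integral do under eq_integral do rewrite tnth_upd_tuple eqxx.
under eq_integral do rewrite int1D.
by rewrite integral_cst//= probability_setT mule1.
Qed.

Let integral_ind2 i j : i != j ->
  (\int[gauss n]_y (ind i y * ind j y)%:E = (p * p)%:E)%E.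
Proof.
move=> ij; rewrite (ge0_integral_gauss_resample i); last 2 first.
- by apply/measurable_EFinP; exact: measurable_funM.
- by move=> y; rewrite lee_fin mulr_ge0.
under eq_integral do under eq_integral do
  rewrite !tnth_upd_tuple eqxx eq_sym (negbTE ij) mulrC EFinM.
under eq_integral => y _.
  rewrite ge0_integralZl//; last by apply/measurable_EFinP; exact: measurable_indic.
  rewrite int1D muleC; over.
rewrite ge0_integralZl//.
- by rewrite integral_ind EFinM.
- exact/measurable_EFinP.
Qed.

Lemma hit_count_ge0 y : 0 <= hit_count y.
Proof. by apply: sumr_ge0. Qed.

Lemma measurable_hit_count : measurable_fun setT hit_count.
Proof. by apply: measurable_sum => i; exact: mind. Qed.

Let integral_hit_count : (\int[gauss n]_y (hit_count y)%:E = M%:E)%E.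
Proof.
under eq_integral do rewrite /hit_count -sumEFin.
rewrite ge0_integral_sum//.
- under eq_bigr do rewrite integral_ind.
  by rewrite sumEFin big_enum sumr_const mulr_natl.
- by move=> i; exact/measurable_EFinP.
Qed.

Let integral_hit_count2 :
  (\int[gauss n]_y (hit_count y ^+ 2)%:E <= (M + M ^+ 2)%:E)%E.
Proof.
have sqrE y : hit_count y ^+ 2 = \sum_(i <- enum J) \sum_(j <- enum J) ind i y * ind j y.
  rewrite expr2 mulr_suml; apply: eq_bigr => i _.
  by rewrite mulr_sumr.
under eq_integral do rewrite sqrE -sumEFin.
have mij i j : measurable_fun setT (fun y => (ind i y * ind j y)%:E).
  by apply/measurable_EFinP; exact: measurable_funM.
have ms i : measurable_fun setT (fun y => (\sum_(j <- enum J) ind i y * ind j y)%:E).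
  apply/measurable_EFinP; apply: measurable_sum => j.
  exact: measurable_funM.
rewrite ge0_integral_sum//; last first.
  by move=> i y _; rewrite lee_fin; apply: sumr_ge0 => j _; rewrite mulr_ge0.
have H i : i \in J -> (\int[gauss n]_y (\sum_(j <- enum J) ind i y * ind j y)%:E <=
    (p + #|J|%:R * (p * p))%:E)%E.
  move=> iJ; under eq_integral do rewrite -sumEFin.
  rewrite ge0_integral_sum//.
  rewrite big_enum/= (bigD1 i)//= EFinD leeD//.
    rewrite -[leRHS](integral_ind i); apply: ge0_le_integral => //.
    - exact/measurable_EFinP.
    by move=> y _; rewrite lee_fin !indicE; case: (_ \in _); rewrite ?mulr1 ?mulr0.
  rewrite (eq_bigr (fun=> (p * p)%:E)); last first.
    by move=> j /andP[_ ji]; rewrite integral_ind2// eq_sym.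
  rewrite sumEFin lee_fin [leRHS](_ : _ = \sum_(j in J) p * p); last first.
    by rewrite sumr_const mulr_natl.
  rewrite big_mkcondr; apply: ler_sum => j _.
  by case: ifP => // _; rewrite mulr_ge0.
rewrite big_enum/=; apply: (le_trans (lee_sum _ H)); rewrite sumEFin lee_fin sumr_const -[(p + _) *+ _]mulr_natl.
by rewrite le_eqVlt; apply/orP; left; apply/eqP; ring.
Qed.

Let integral_dev : (\int[gauss n]_y ((hit_count y - M) ^+ 2)%:E <= M%:E)%E.
Proof.
have mS := measurable_hit_count.
have M0 : 0 <= M by rewrite mulr_ge0.
have mdev : measurable_fun setT (fun y => ((hit_count y - M) ^+ 2)%:E).
  by apply/measurable_EFinP; apply: measurable_funX; exact: measurable_funB.
set V := (\int[gauss n]_y _)%E.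
have V0 : (0 <= V)%E by apply: integral_ge0 => y _; rewrite lee_fin sqr_ge0.
(* The cross term of the square is moved to the left, so that only nonnegative functions are
   integrated. *)
have : (V + (2 * M * M)%:E <= (M + M ^+ 2 + M ^+ 2)%:E)%E.
  have -> : (V + (2 * M * M)%:E = \int[gauss n]_y ((hit_count y) ^+ 2 + M ^+ 2)%:E)%E.
    have -> : ((2 * M * M)%:E = \int[gauss n]_y ((2 * M)%:E * (hit_count y)%:E))%E.
      rewrite ge0_integralZl//.
      - by rewrite integral_hit_count -EFinM.
      - exact/measurable_EFinP.
      - by move=> y _; rewrite lee_fin hit_count_ge0.
      - by rewrite lee_fin mulr_ge0.
    rewrite -ge0_integralD//.
    - by apply: eq_integral => y _; rewrite -EFinM -EFinD; congr EFin; ring.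
    - by move=> y _; rewrite lee_fin sqr_ge0.
    - by move=> y _; rewrite -EFinM lee_fin !mulr_ge0 ?hit_count_ge0.
    - by apply: emeasurable_funM => //; exact/measurable_EFinP.
  under eq_integral do rewrite EFinD.
  rewrite ge0_integralD//.
  - rewrite integral_cst//= probability_setT mule1 [leRHS]EFinD leeD//.
  - by move=> y _; rewrite lee_fin sqr_ge0.
  - by apply/measurable_EFinP; exact: measurable_funX.
  - by move=> y _; rewrite lee_fin sqr_ge0.
case: V V0 => [r| |]//= _; rewrite -EFinD !lee_fin.
by move=> h; nra.
Qed.

(** The variance of a binomial variable is at most its mean [M]. *)
Lemma hit_count_chebyshev (t : R) : 0 < t ->
  (gauss n [set y | (t <= `|hit_count y - M|)%R] <= (M / t ^+ 2)%:E)%E.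
Proof.
move=> t0.
have mS := measurable_hit_count.
have mE : measurable [set y : tup | t <= `|hit_count y - M|].
  apply: (measurable_le_set (measurable_cst t)).
  by apply: measurableT_comp => //; exact: measurable_funB.
have mdev : measurable_fun setT (fun y => ((hit_count y - M) ^+ 2)%:E).
  by apply/measurable_EFinP; apply: measurable_funX; exact: measurable_funB.
have t2 : 0 < t ^+ 2 by rewrite exprn_gt0.
have : ((t ^+ 2)%:E * gauss n [set y | (t <= `|hit_count y - M|)%R] <= M%:E)%E.
  apply: le_trans integral_dev.
  have mI : measurable_fun setT
      (fun y => (\1_([set y | t <= `|hit_count y - M|]) y)%:E : \bar R).
    by apply/measurable_EFinP; exact: measurable_indic.
  rewrite -[X in gauss n X]setIT -integral_indic// -ge0_integralZl//; last first.
    by rewrite lee_fin ltW.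
  apply: ge0_le_integral => //.
  - by move=> y _; rewrite -EFinM lee_fin mulr_ge0// ltW.
  - by apply: emeasurable_funM.
  move=> y _; rewrite -EFinM lee_fin indicE.
  case: (boolP (y \in _)) => [|_]; last by rewrite mulr0 sqr_ge0.
  rewrite inE/= => h.
  by rewrite mulr1 -[leRHS]real_normK ?num_real// lerXn2r ?nnegrE// ltW.
have : (0 <= gauss n [set y | (t <= `|hit_count y - M|)%R])%E by [].
have := probability_le1 (gauss n) mE.
case: (gauss n _) => [r| |]//= _ _; rewrite -EFinM !lee_fin ler_pdivlMr//.
by rewrite mulrC.
Qed.

End chebyshev_counts.

(** * Summing the leave-one-out bounds *)

Section false_discoveries.
Context {R : realType} (n k0 : nat).
Variables (alpha dt ds : R) (A : {set 'I_n}) (v : 'I_n -> R).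
Local Notation tup := (n.-tuple R).
Hypothesis alpha01 : 0 < alpha < 1 / 2.
Hypothesis q1 : (0 < qn R n <= n)%N.
Hypothesis q2 : (0 < qn' R n <= qn R n)%N.
Hypothesis xq0 : 0 <= Phibar_inv ((qn R n)%:R / n%:R : R).
Hypothesis ds1 : ds < 1.
Variable B : R.
Hypothesis tailB : forall l, (0 < l <= n)%N ->
  Phibar ((1 - ds) * Phibar_inv (alpha * l%:R / n%:R) - dt) <= B * l%:R.
Local Notation count y := (step_up_count A alpha (plus_pval k0 y)).
Local Notation rejected y := (step_up A alpha (plus_pval k0 y)).
Local Notation good := (good_fit k0 dt ds).

Let q2n : (0 < qn' R n <= n)%N.
Proof.
by case/andP: q1 => _ qn1; case/andP: q2 => -> /leq_trans; apply.
Qed.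

Lemma measurable_good_fit : measurable [set y : tup | good y].
Proof.
rewrite (_ : [set y : tup | good y] =
    [set y | (- dt : R) <= theta_plus k0 y] `&` [set y | (1 - ds : R) <= sigma_plus k0 y]).
  apply: measurableI; apply: (measurable_le_set (measurable_cst _)).
    exact: measurable_theta_plus.
  exact: measurable_sigma_plus.
by apply/seteqP; split => y /=; [case/andP|case=> yt ys; apply/andP].
Qed.

(** [A] is what the procedure tests, [I] the nulls among which errors are counted. On a bad fit the
    proportion is bounded by 1, otherwise by the sum of the weights. *)
Lemma integral_false_discoveries (I : {set 'I_n}) : (forall i, i \in I -> v i = 0) ->
  (\int[gauss n]_y (#|rejected (shift v y) :&: I|%:R / (maxn (count (shift v y)) 1)%:R)%:E
   <= gauss n [set y | ~~ good (shift v y)] + (#|I|%:R * B)%:E)%E.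
Proof.
pose f a : R := #|arr_set A a :&: I|%:R / (maxn (arr_count A a) 1)%:R.
move=> vI; have a0 : 0 <= alpha by case/andP: alpha01 => /ltW.
have mfa : measurable_fun setT (fun y : tup => f (plus_array alpha k0 y)).
  exact: (@measurable_pval_array R n _ R alpha _ _ f
    (measurable_theta_plus k0 q1 q2n) (measurable_sigma_plus k0 q1 q2n)).
pose W y := \sum_(i <- enum I) loo_weight k0 alpha dt ds A i (shift v y).
have mloo i : measurable_fun setT (fun y => (loo_weight k0 alpha dt ds A i (shift v y))%:E).
  apply/measurable_EFinP.
  exact: (measurableT_comp (measurable_loo_weight k0 alpha dt ds A q1 q2 i) (measurable_shift v)).
have mbad : measurable [set y : tup | ~~ good (shift v y)].
  rewrite (_ : mkset _ = ~` (shift v @^-1` [set y | good y])).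
    apply: measurableC; rewrite -[X in measurable X]setTI.
    exact: (measurable_shift v measurableT measurable_good_fit).
  by apply/seteqP; split => y /= /negP.
apply: (@le_trans _ _ (\int[gauss n]_y
    ((\1_([set y : tup | ~~ good (shift v y)]) y)%:E + (W y)%:E))%E).
  apply: ge0_le_integral => //.
  - rewrite (_ : (fun y => _) = fun y => (f (plus_array alpha k0 (shift v y)))%:E); last first.
      by apply/funext => y; rewrite /plus_pval step_upE step_up_countE.
    apply/measurable_EFinP; exact: (measurableT_comp mfa (measurable_shift v)).
  - apply: emeasurable_funD; first by apply/measurable_EFinP; exact: measurable_indic.
    by under eq_fun do rewrite /W -sumEFin; apply: emeasurable_sum.
  move=> y _; rewrite -EFinD lee_fin.
  set z := shift v y.
  have cE : #|rejected z| = count z by exact: card_step_up.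
  have [gz|gz] := boolP (good z); last first.
    rewrite indicE mem_set//= -[leLHS]addr0 lerD//; last first.
      by rewrite /W; apply: sumr_ge0 => i _; exact: loo_weight_ge0.
    rewrite ler_pdivrMr ?ltr0n ?leq_max ?orbT// mul1r ler_nat.
    by rewrite -cE leq_max subset_leq_card// subsetIl.
  rewrite indicE memNset/= ?gz// add0r.
  rewrite /W /loo_weight -/z gz big_enum/= -mulr_suml.
  have -> : \sum_(i in I) ((i \in rejected z)%:R : R) = #|rejected z :&: I|%:R.
    rewrite -sum1_card natr_sum big_mkcond [RHS]big_mkcond.
    by apply: eq_bigr => i _; rewrite finset.in_setI andbC; case: (i \in I); case: (i \in rejected z).
  have [c0|] := posnP (count z).
    suff -> : #|rejected z :&: I| = 0%N by rewrite !mul0r.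
    by apply/eqP; rewrite -leqn0 -c0 -cE subset_leq_card// subsetIl.
  by move=> c0; rewrite (maxn_idPl c0).
rewrite ge0_integralD//; last 3 first.
- by apply/measurable_EFinP; exact: measurable_indic.
- by move=> y _; rewrite lee_fin /W; apply: sumr_ge0 => i _; exact: loo_weight_ge0.
- by under eq_fun do rewrite /W -sumEFin; apply: emeasurable_sum.
rewrite integral_indic// setIT leeD2l//.
under eq_integral do rewrite /W -sumEFin.
rewrite ge0_integral_sum//; last by move=> i y _; rewrite lee_fin loo_weight_ge0.
rewrite big_enum/=; apply: (@le_trans _ _ (\sum_(i in I) B%:E)%E).
  by apply: lee_sum => i iI; apply: integral_loo_weight => //; exact: vI.
by rewrite sumEFin sumr_const mulr_natl.
Qed.

End false_discoveries.

(** * Deviations of order statistics *)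

Section order_stat_deviation.
Context {R : realType} (n : nat).
Variables (v : 'I_n -> R).
Local Notation tup := (n.-tuple R).

Lemma hit_count_le (J : {set 'I_n}) (x : R) (y : tup) :
  hit_count J `]-oo, x] y = #|[set i in J | (tnth y i <= x)%R]%SET|%:R.
Proof.
rewrite /hit_count big_enum/= -sum1_card natr_sum big_mkcond [RHS]big_mkcond.
apply: eq_bigr => i _; rewrite indicE mem_setE in_itv/= inE.
by case: (i \in J); case: (_ <= _).
Qed.

(** Means being nonnegative, [Y_(q) < - a] forces at least [q] of all [n] noise terms below [- a],
    where [(1 - delta) * q] are expected. *)
Lemma order_stat_lower q (delta a : R) : (0 < q <= n)%N -> 0 < delta < 1 ->
  (forall i, 0 <= v i) -> Phibar a = (1 - delta) * q%:R / n%:R ->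
  (gauss n [set y | (order_stat (shift v y) q < - a)%R] <=
   (1 / (delta ^+ 2 * q%:R))%:E)%E.
Proof.
move=> qn /andP[d0 d1] v0 aE; have /andP[q0 qn'] := qn.
have n0 : (0 : R) < n%:R by rewrite ltr0n (leq_trans q0).
have qR : (0 : R) < q%:R by rewrite ltr0n.
have t0 : 0 < delta * q%:R by rewrite mulr_gt0.
have ME : #|[set: 'I_n]%SET|%:R * Phibar a = (1 - delta) * q%:R.
  by rewrite cardsT card_ord aE mulrC divfK// gt_eqF.
have := hit_count_chebyshev [set: 'I_n]%SET (measurable_itv `]-oo, (- a)])
  (stdnormal_le a) t0.
rewrite ME => H.
apply: (@le_trans _ _ ((1 - delta) * q%:R / (delta * q%:R) ^+ 2)%:E).
  apply: le_trans H; apply: le_measure; rewrite ?inE.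
  - rewrite (_ : mkset _ = ~` [set y : tup | - a <= order_stat (shift v y) q]).
      apply: measurableC; apply: (measurable_le_set (measurable_cst _)).
      exact: (measurableT_comp (measurable_order_stat qn) (measurable_shift v)).
    by apply/seteqP; split => y /=; rewrite ltNge => /negP.
  - apply: (measurable_le_set (measurable_cst _)); apply: measurableT_comp => //.
    by apply: measurable_funB => //; exact: measurable_hit_count.
  - move=> y /= /ltW; rewrite order_stat_le// => qc.
    apply: le_trans (ler_norm _).
    have : (q%:R : R) <= hit_count [set: 'I_n]%SET `]-oo, (- a)] y.
      rewrite hit_count_le ler_nat (leq_trans qc)//.
      apply: subset_leq_card; apply/fintype.subsetP => i; rewrite !inE /=.
      by rewrite tnth_shift; apply: le_trans; rewrite lerDr.
    lra.
rewrite lee_fin ler_pdivrMr ?exprn_gt0// mul1r exprMn.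
rewrite [leRHS](_ : _ = q%:R); last by field; rewrite !gt_eqF.
by rewrite ler_piMl ?ltW//; lra.
Qed.

(** Alternatives may lie anywhere, so only nulls are counted: [Y_(q) > - b] leaves fewer than [q] of
    them below [- b], where at least [(1 + delta) * q] are expected. *)
Lemma order_stat_upper q (delta N b : R) : (0 < q <= n)%N -> 0 < delta <= 1 ->
  0 < N <= #|[set i | v i == 0]%SET|%:R -> Phibar b = (1 + delta) * q%:R / N ->
  (gauss n [set y | (- b < order_stat (shift v y) q)%R] <=
   (2 / (delta ^+ 2 * q%:R))%:E)%E.
Proof.
set J := [set i | v i == 0]%SET.
move=> qn /andP[d0 d1] /andP[N0 NJ] bE; have /andP[q0 qn'] := qn.
have qR : (0 : R) < q%:R by rewrite ltr0n.
pose M := #|J|%:R * Phibar b.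
have MN : (1 + delta) * q%:R <= M.
  by rewrite /M bE -mulrA [leRHS]mulrC -!mulrA ler_pM2l ?addr_gt0// ler_peMr ?(ltW qR)// ler_pdivlMl// mulr1.
have t0 : 0 < M - q%:R.
  rewrite subr_gt0; apply: lt_le_trans MN; rewrite ltr_pMl//; lra.
have := hit_count_chebyshev J (measurable_itv `]-oo, (- b)]) (stdnormal_le b) t0.
rewrite -/M => H.
apply: (@le_trans _ _ (M / (M - q%:R) ^+ 2)%:E).
  apply: le_trans H; apply: le_measure; rewrite ?inE.
  - rewrite (_ : mkset _ = ~` [set y : tup | order_stat (shift v y) q <= - b]).
      apply: measurableC; refine (measurable_le_set _ (measurable_cst _)).
      exact: (measurableT_comp (measurable_order_stat qn) (measurable_shift v)).
    by apply/seteqP; split => y /=; rewrite ltNge => /negP.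
  - apply: (measurable_le_set (measurable_cst _)); apply: measurableT_comp => //.
    by apply: measurable_funB => //; exact: measurable_hit_count.
  - move=> y /=; rewrite ltNge order_stat_le// -ltnNge => qc.
    rewrite distrC; apply: le_trans (ler_norm _); rewrite lerD2l lerN2.
    rewrite hit_count_le ler_nat; apply: leq_trans (ltnW qc).
    apply: subset_leq_card; apply/fintype.subsetP => i; rewrite !inE => /andP[/eqP vi].
    by rewrite tnth_shift vi add0r.
rewrite lee_fin ler_pdivrMr ?exprn_gt0// mulrAC ler_pdivlMr ?mulr_gt0 ?exprn_gt0//.
(* The mean [M] may be much larger than [(1 + delta) * q]; this comparison makes the bound
   [M / (M - q)^2] uniform in [M]. *)
have dM : M * delta <= (M - q%:R) * (1 + delta) by lra.
have M0 : 0 < M by apply: lt_le_trans MN; rewrite mulr_gt0// addr_gt0.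
have h1 : (M * delta) ^+ 2 <= ((M - q%:R) * (1 + delta)) ^+ 2.
  have d0' := ltW d0; have M0' := ltW M0; have t0' := ltW t0.
  by rewrite lerXn2r// nnegrE mulr_ge0// addr_ge0.
rewrite [(M * delta) ^+ 2]exprMn [(_ * (1 + delta)) ^+ 2]exprMn in h1.
have qM : q%:R * (1 + delta) <= M by rewrite mulrC.
rewrite -(ler_pM2l M0).
apply: (@le_trans _ _ (q%:R * (M ^+ 2 * delta ^+ 2))); first by rewrite le_eqVlt; apply/orP; left; apply/eqP; ring.
have h2 := ler_wpM2l (ltW qR) h1.
apply: (le_trans h2).
rewrite (_ : _ * _ = (M - q%:R) ^+ 2 * ((1 + delta) * (q%:R * (1 + delta)))); last by ring.
rewrite (_ : M * _ = (M - q%:R) ^+ 2 * (2 * M)); last by ring.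
rewrite ler_wpM2l ?sqr_ge0// ler_pM// ?mulr_ge0 ?addr_ge0 ?(ltW d0) ?(ltW qR)//; lra.
Qed.

End order_stat_deviation.

(** * Location and stability of the quantiles *)

Section quantiles.
Context {R : realType}.
Implicit Types (x y w c t : R) (n k q : nat).

(** [Phibar_shift] read backwards: a factor [expR c] on the level moves the quantile by at most
    [c / x]. The gain [1 / s] in the estimators comes from here. *)
Lemma quantile_shift x y c : x <= y -> Phibar x <= expR c * Phibar y ->
  (y - x) * x <= c.
Proof.
move=> xy h; have yx0 : 0 <= y - x by rewrite subr_ge0.
have := Phibar_shift x yx0; rewrite subrKC => h'.
have : 1 <= expR c * expR (- ((y - x) * x) - (y - x) ^+ 2 / 2).
  rewrite -(ler_pM2r (Phibar_gt0 x)) mul1r -mulrA.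
  by apply: (le_trans h); rewrite ler_pM2l ?expR_gt0.
rewrite -expRD -[X in X <= _]expR0 ler_expR; have := sqr_ge0 (y - x); lra.
Qed.

Lemma quantile_le x w : 0 <= w -> expR (- w ^+ 2 / 2) / 2 <= Phibar x -> x <= w.
Proof.
by move=> w0 h; apply: ler_Phibar_inj; apply: le_trans h; exact: Phibar_le_exp.
Qed.

(** The Gaussian exponents leave room, [(1/4)^2 / 2 < 1/4] and [(4/5)^2 / 2 < 3/4], for the
    constants and the linear term. The factor 20 covers [10 * (1 + delta)], with 10 from
    [n - k0 >= n / 10]. *)
Lemma eventually_tail_ge : exists2 S : R, 4 <= S & forall s, S <= s ->
  20 * expR (- s ^+ 2 / 4) <= Phibar (s / 4) /\
  20 * expR (- (3 / 4 * s ^+ 2)) <= Phibar (4 / 5 * s).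
Proof.
pose K : R := ln (20 / tail_cst).
have c0 := @tail_cst_gt0 R.
have KE : 20 = tail_cst * expR K :> R.
  by rewrite /K lnK ?posrE ?divr_gt0// mulrC divfK// gt_eqF.
exists (4 + 2 * `|K|); first by rewrite lerDl mulr_ge0.
move=> s hs; have := ler_norm K; have := normr_ge0 K => K0 KK.
have s4 : 4 <= s by lra.
have key a b : K + a <= b -> 20 * expR a <= tail_cst * expR b.
  by move=> ab; rewrite KE -mulrA ler_pM2l// -expRD ler_expR.
split; (apply: le_trans (Phibar_ge_exp _); first apply: key); try lra; nra.
Qed.

Variables (n k : nat) (s : R).
Hypothesis k9 : k%:R <= 9 / 10 * n%:R :> R.
Hypothesis nE : n%:R = expR (s ^+ 2).
Hypothesis s4 : 4 <= s.
Hypothesis tail1 : 20 * expR (- s ^+ 2 / 4) <= Phibar (s / 4).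
Hypothesis tail2 : 20 * expR (- (3 / 4 * s ^+ 2)) <= Phibar (4 / 5 * s).

Local Notation q := (qn R n).
Local Notation q' := (qn' R n).
Local Notation N := (n%:R - k%:R : R).

Lemma powR_sqr_ln r : (n%:R : R) `^ r = expR (r * s ^+ 2).
Proof. by rewrite nE /powR gt_eqF ?expR_gt0// expRK. Qed.

Lemma expR_ge2 r : 1 / 16 <= r -> 2 <= expR (r * s ^+ 2).
Proof.
move=> r0; apply: le_trans (expR_ge1Dx _).
have h4 := s4; have s16 : 16 <= s ^+ 2 by nra.
have : 1 / 16 * 16 <= r * s ^+ 2 by apply: ler_pM => //; lra.
lra.
Qed.

Lemma truncn_half (z : R) : 2 <= z -> z / 2 <= (Num.truncn z)%:R <= z.
Proof.
move=> z2; have /andP[h1 h2] : (Num.truncn z)%:R <= z < (Num.truncn z).+1%:R.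
  by apply: truncn_itv; lra.
rewrite h1 andbT; move: h2; rewrite -natr1; lra.
Qed.

Lemma qn_itv : expR (3 / 4 * s ^+ 2) / 2 <= q%:R <= expR (3 / 4 * s ^+ 2).
Proof. by rewrite /qn powR_sqr_ln; apply: truncn_half; apply: expR_ge2; lra. Qed.

Lemma qn'_itv : expR (1 / 4 * s ^+ 2) / 2 <= q'%:R <= expR (1 / 4 * s ^+ 2).
Proof. by rewrite /qn' powR_sqr_ln; apply: truncn_half; apply: expR_ge2; lra. Qed.

Lemma N_itv : n%:R / 10 <= N <= n%:R.
Proof. by have h9 := k9; rewrite lerBlDr lerDl ler0n andbT; lra. Qed.

Lemma n_gt0 : 0 < n%:R :> R.
Proof. by rewrite nE expR_gt0. Qed.

Lemma N_gt0 : 0 < N.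
Proof. by have /andP[+ _] := N_itv; apply: lt_le_trans; rewrite divr_gt0 ?n_gt0. Qed.

Lemma qn_gt0 : 0 < q%:R :> R.
Proof. by have /andP[+ _] := qn_itv; apply: lt_le_trans; rewrite divr_gt0 ?expR_gt0. Qed.

Lemma qn'_gt0 : 0 < q'%:R :> R.
Proof. by have /andP[+ _] := qn'_itv; apply: lt_le_trans; rewrite divr_gt0 ?expR_gt0. Qed.

Lemma qn'_le_qn : (0 < q' <= q)%N.
Proof.
rewrite -(ltr0n R) qn'_gt0/= -(ler_nat R).
have /andP[_ h1] := qn'_itv; have /andP[h2 _] := qn_itv.
apply: (le_trans h1); apply: le_trans h2.
rewrite ler_pdivlMr//.
rewrite (_ : 3 / 4 * s ^+ 2 = 1 / 4 * s ^+ 2 + 1 / 2 * s ^+ 2); last by field.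
by rewrite expRD ler_pM2l ?expR_gt0// expR_ge2//; lra.
Qed.

Lemma qn_le_n : (0 < q <= n)%N.
Proof.
rewrite -(ltr0n R) qn_gt0/= -(ler_nat R) nE.
by have /andP[_ h1] := qn_itv; apply: (le_trans h1); rewrite ler_expR; nra.
Qed.

Lemma qn_div_n : expR (- s ^+ 2 / 4) / 2 <= q%:R / n%:R <= expR (- s ^+ 2 / 4).
Proof.
have /andP[h1 h2] := qn_itv.
have E : expR (3 / 4 * s ^+ 2) = expR (- s ^+ 2 / 4) * n%:R.
  by rewrite nE -expRD; congr expR; field.
rewrite ler_pdivlMr ?n_gt0// ler_pdivrMr ?n_gt0// -E h2 andbT.
by apply: le_trans h1; rewrite E mulrAC.
Qed.

Lemma qn_div_N : q%:R / N <= 10 * expR (- s ^+ 2 / 4).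
Proof.
have /andP[_ h] := qn_div_n; have /andP[hN _] := N_itv.
rewrite ler_pdivrMr ?N_gt0//; move: h; rewrite ler_pdivrMr ?n_gt0// => h.
by have := ler_wpM2l (expR_ge0 (- s ^+ 2 / 4)) hN; lra.
Qed.

Lemma qn'_div_N : expR (- s ^+ 2) <= q'%:R / N <= 10 * expR (- (3 / 4 * s ^+ 2)).
Proof.
have /andP[h1 h2] := qn'_itv; have /andP[hN hn] := N_itv.
have E : expR (1 / 4 * s ^+ 2) = expR (- (3 / 4 * s ^+ 2)) * n%:R.
  by rewrite nE -expRD; congr expR; field.
rewrite ler_pdivlMr ?N_gt0// ler_pdivrMr ?N_gt0//; apply/andP; split.
  apply: (@le_trans _ _ (expR (- s ^+ 2) * n%:R)).
    by rewrite ler_wpM2l ?expR_ge0.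
  rewrite nE -expRD addNr expR0; apply: le_trans h1.
  by rewrite ler_pdivlMr// [leLHS]mul1r expR_ge2//; lra.
apply: (le_trans h2); rewrite E.
by have := ler_wpM2l (expR_ge0 (- (3 / 4 * s ^+ 2))) hN; lra.
Qed.

Variable delta : R.
Hypothesis delta0 : 0 < delta <= 1 / 2.

Let e1 := expR (- s ^+ 2 / 4).
Let e3 := expR (- (3 / 4 * s ^+ 2)).

Let e1_gt0 : 0 < e1. Proof. exact: expR_gt0. Qed.
Let e3_gt0 : 0 < e3. Proof. exact: expR_gt0. Qed.

Let e1_small : 20 * e1 <= 1.
Proof. exact: le_trans tail1 (Phibar_le1 _). Qed.

Let e3_small : e3 <= e1.
Proof. by rewrite ler_expR; have h := sqr_ge0 s; lra. Qed.

(** [x] and [x'] are the quantiles in [sigma_plus]. Typically [- a <= Y_(q)] and [Y_(q') <= - b],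
    which bounds the estimators below, while [Y_(q) <= - a2] and [- b2 <= Y_(q')] bound them above.
    Levels over [n] count all noise terms, levels over [N] only guaranteed nulls. *)
Local Notation x := (Phibar_inv (q%:R / n%:R) : R).
Local Notation x' := (Phibar_inv (q'%:R / N) : R).
Local Notation a := (Phibar_inv ((1 - delta) * q%:R / n%:R) : R).
Local Notation b := (Phibar_inv ((1 + delta) * q'%:R / N) : R).
Local Notation a2 := (Phibar_inv ((1 + delta) * q%:R / N) : R).
Local Notation b2 := (Phibar_inv ((1 - delta) * q'%:R / n%:R) : R).

Let qn_pos : 0 < q%:R / n%:R :> R.
Proof. by rewrite divr_gt0 ?qn_gt0 ?n_gt0. Qed.

Let qN_pos : 0 < q%:R / N.
Proof. by rewrite divr_gt0 ?qn_gt0 ?N_gt0. Qed.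

Let q'n_pos : 0 < q'%:R / n%:R :> R.
Proof. by rewrite divr_gt0 ?qn'_gt0 ?n_gt0. Qed.

Let q'N_pos : 0 < q'%:R / N.
Proof. by rewrite divr_gt0 ?qn'_gt0 ?N_gt0. Qed.

Let q'n_le : q'%:R / n%:R <= q'%:R / N.
Proof.
rewrite ler_pM2l ?qn'_gt0// lef_pV2 ?posrE ?n_gt0 ?N_gt0//.
by have /andP[] := N_itv.
Qed.

Let qn_le : q%:R / n%:R <= q%:R / N.
Proof.
rewrite ler_pM2l ?qn_gt0// lef_pV2 ?posrE ?n_gt0 ?N_gt0//.
by have /andP[] := N_itv.
Qed.

Lemma xE : Phibar x = q%:R / n%:R.
Proof.
apply: Phibar_invK; have := qn_pos; have := e1_gt0; have := e1_small.
by have /andP[_] := qn_div_n; rewrite -/e1; lra.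
Qed.

Lemma x'E : Phibar x' = q'%:R / N.
Proof.
apply: Phibar_invK; have := q'N_pos; have := e1_gt0; have := e1_small; have := e3_small.
by have /andP[_] := qn'_div_N; rewrite -/e3; lra.
Qed.

Lemma aE : Phibar a = (1 - delta) * q%:R / n%:R.
Proof.
apply: Phibar_invK; have := qn_pos; have := e1_gt0; have := e1_small; have := delta0.
by have /andP[_] := qn_div_n; rewrite -/e1 -!mulrA; nra.
Qed.

Lemma bE : Phibar b = (1 + delta) * q'%:R / N.
Proof.
apply: Phibar_invK; have := q'N_pos; have := e1_gt0; have := e1_small; have := e3_small.
by have /andP[_] := qn'_div_N; have := delta0; rewrite -/e3 -!mulrA; nra.
Qed.

Lemma a2E : Phibar a2 = (1 + delta) * q%:R / N.
Proof.
apply: Phibar_invK; have := qN_pos; have := e1_gt0; have := e1_small.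
by have := qn_div_N; have := delta0; rewrite -/e1 -!mulrA; nra.
Qed.

Lemma b2E : Phibar b2 = (1 - delta) * q'%:R / n%:R.
Proof.
apply: Phibar_invK; have := q'n_pos; have := e1_gt0; have := e1_small; have := e3_small.
by have /andP[_] := qn'_div_N; have := q'n_le; have := delta0; rewrite -/e3 -!mulrA; nra.
Qed.

(** The true orders of [x] and [x'] are [s / sqrt 2] and [s * sqrt (3 / 2)]. It is enough that both
    are of order [s] and that [3 / 4 < 4 / 5] separates them. *)
Lemma x_itv : s / 4 <= x <= 3 / 4 * s.
Proof.
have h4 := s4; have /andP[h1 h2] := qn_div_n.
apply/andP; split.
  apply: ler_Phibar_inj; rewrite xE; apply: le_trans tail1.
  by apply: (le_trans h2); have := e1_gt0; rewrite -/e1; lra.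
apply: quantile_le; first lra.
rewrite xE; apply: le_trans h1; rewrite ler_pM2r// ler_expR; nra.
Qed.

Lemma x'_itv : 4 / 5 * s <= x' <= 2 * s.
Proof.
have h4 := s4; have /andP[h1 h2] := qn'_div_N.
apply/andP; split.
  apply: ler_Phibar_inj; rewrite x'E; apply: le_trans tail2.
  by apply: (le_trans h2); have := e3_gt0; rewrite -/e3; lra.
apply: quantile_le; first lra.
rewrite x'E; apply: le_trans h1.
have := expR_gt0 (- s ^+ 2).
rewrite (_ : - (2 * s) ^+ 2 / 2 = - s ^+ 2 - s ^+ 2); last by field.
rewrite expRD; have : expR (- s ^+ 2) <= 1 by rewrite expR_le1 oppr_le0 sqr_ge0.
nra.
Qed.

Lemma b_ge : s / 4 <= b.
Proof.
have h4 := s4; have /andP[_] := qn'_div_N => h2.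
apply: ler_Phibar_inj; rewrite bE; apply: le_trans tail1.
by have := e1_gt0; have := e3_small; have := e3_gt0; have := delta0; have := q'N_pos;
   move: h2; rewrite -/e1 -/e3 -!mulrA; nra.
Qed.

Lemma a2_ge : s / 4 <= a2.
Proof.
have h4 := s4; have h2 := qn_div_N.
apply: ler_Phibar_inj; rewrite a2E; apply: le_trans tail1.
by have := e1_gt0; have := delta0; have := qN_pos; move: h2; rewrite -/e1 -!mulrA; nra.
Qed.

Let scale_le (u z e : R) : 0 <= u -> s / 4 <= z -> u * z <= e -> u * s <= 4 * e.
Proof.
by move=> u0 sz uz; have := ler_wpM2l u0 sz; lra.
Qed.

Lemma a_sub_le : (a - x) * s <= 8 * delta.
Proof.
have xa : x <= a.
  by apply: ler_Phibar_inj; rewrite xE aE -mulrA; have := qn_pos; have := delta0; nra.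
have : (a - x) * x <= 2 * delta.
  apply: quantile_shift => //; rewrite xE aE -[_ * _ / _]mulrA [leRHS]mulrA.
  rewrite ler_peMl ?(ltW qn_pos)//.
  have := expR_ge1Dx (2 * delta); have := delta0; nra.
move=> h; have /andP[xs _] := x_itv.
by have := scale_le (_ : 0 <= a - x) xs h; rewrite subr_ge0 => /(_ xa); lra.
Qed.

Lemma b_sub_le : (x' - b) * s <= 4 * delta.
Proof.
have bx : b <= x'.
  by apply: ler_Phibar_inj; rewrite x'E bE -mulrA; have := q'N_pos; have := delta0; nra.
have : (x' - b) * b <= delta.
  apply: quantile_shift => //; rewrite x'E bE -[_ * _ / _]mulrA.
  by rewrite ler_pM2r ?q'N_pos// expR_ge1Dx.
move=> h; have := scale_le (_ : 0 <= x' - b) b_ge h; rewrite subr_ge0 => /(_ bx); lra.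
Qed.

Local Notation r := (k%:R / n%:R : R).

Let N_div : N / n%:R = 1 - r.
Proof. by rewrite mulrBl divff// gt_eqF// n_gt0. Qed.

Let r_itv : 0 <= r <= 9 / 10.
Proof. by rewrite divr_ge0 ?ler0n//= ler_pdivrMr ?n_gt0. Qed.

(** [(1 + 10 r) (1 - r) >= 1] holds up to [r = 9 / 10]: the assumption [k0 <= 0.9 n] fixes the
    constant 10. *)
Let r_shift : 1 <= expR (10 * r) * (1 - r).
Proof. by have := expR_ge1Dx (10 * r); have := r_itv; nra. Qed.

Let div_N_le z : 0 <= z -> z / N <= expR (10 * r) * (z / n%:R).
Proof.
move=> z0; rewrite [z / n%:R](_ : _ = z / N * (1 - r)); last first.
  by rewrite -N_div mulrA divfK// gt_eqF// N_gt0.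
by rewrite mulrCA ler_peMr// divr_ge0// ltW// N_gt0.
Qed.

Lemma a2_sub_le : (x - a2) * s <= 4 * delta + 40 * r.
Proof.
have ax : a2 <= x.
  by apply: ler_Phibar_inj; rewrite xE a2E -mulrA; have := qn_le; have := qn_pos; have := delta0; nra.
have : (x - a2) * a2 <= delta + 10 * r.
  apply: quantile_shift => //; rewrite xE a2E -[_ * _ / _]mulrA expRD -mulrA.
  apply: ler_pM; rewrite ?(ltW qN_pos) ?expR_ge1Dx ?div_N_le ?(ltW qn_gt0)//.
  by have := delta0; lra.
move=> h; have := scale_le (_ : 0 <= x - a2) a2_ge h; rewrite subr_ge0 => /(_ ax); lra.
Qed.

Lemma b2_sub_le : (b2 - x') * s <= 8 * delta + 40 * r.
Proof.
have xb : x' <= b2.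
  by apply: ler_Phibar_inj; rewrite x'E b2E -mulrA; have := q'n_le; have := q'n_pos; have := delta0; nra.
have : (b2 - x') * x' <= 2 * delta + 10 * r.
  apply: quantile_shift => //; rewrite x'E b2E -[_ * _ / n%:R]mulrA [2 * delta + _]addrC expRD -[leRHS]mulrA.
  apply: (le_trans (div_N_le (ltW qn'_gt0))).
  rewrite ler_pM2l ?expR_gt0// [leRHS]mulrA ler_peMl ?(ltW q'n_pos)//.
  have := expR_ge1Dx (2 * delta); have := delta0; nra.
move=> h; have /andP[xs _] := x'_itv; have h4 := s4.
have xs' : s / 4 <= x' by lra.
have := scale_le (_ : 0 <= b2 - x') xs' h; rewrite subr_ge0 => /(_ xb) {}h.
have := r_itv; lra.
Qed.

End quantiles.

(** * Accuracy of the two estimators and its effect on levels *)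

Section fit_bounds.
Context {R : realType}.
Variables (n k : nat) (s delta : R).
Hypothesis k9 : k%:R <= 9 / 10 * n%:R :> R.
Hypothesis nE : n%:R = expR (s ^+ 2).
Hypothesis s4 : 4 <= s.
Hypothesis tail1 : 20 * expR (- s ^+ 2 / 4) <= Phibar (s / 4).
Hypothesis tail2 : 20 * expR (- (3 / 4 * s ^+ 2)) <= Phibar (4 / 5 * s).
Hypothesis delta0 : 0 < delta <= 1 / 2.

Local Notation q := (qn R n).
Local Notation q' := (qn' R n).
Local Notation N := (n%:R - k%:R : R).
Local Notation x := (Phibar_inv (q%:R / n%:R) : R).
Local Notation x' := (Phibar_inv (q'%:R / N) : R).
Local Notation a := (Phibar_inv ((1 - delta) * q%:R / n%:R) : R).
Local Notation b := (Phibar_inv ((1 + delta) * q'%:R / N) : R).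
Local Notation a2 := (Phibar_inv ((1 + delta) * q%:R / N) : R).
Local Notation b2 := (Phibar_inv ((1 - delta) * q'%:R / n%:R) : R).
Local Notation r := (k%:R / n%:R : R).

(** [240 = 20 * (8 + 4)], from [gap_ge] and the quantile errors [a_sub_le] and [b_sub_le];
    [188 = 8 + 240 * 3 / 4], since [x <= 3 / 4 * s]. *)
Definition ds_fit : R := 240 * delta / s ^+ 2.
Definition dt_fit : R := 188 * delta / s.

Let s_gt0 : 0 < s.
Proof. exact: lt_le_trans s4. Qed.

Let gap_ge : s / 20 <= x' - x.
Proof.
have h4 := s4.
have /andP[_ h1] := x_itv nE s4 tail1.
have /andP[h2 _] := x'_itv k9 nE s4 tail1 tail2.
lra.
Qed.

Let ratio_le (u e : R) : 0 <= e -> u * s <= e -> u / (x' - x) <= 20 * e / s ^+ 2.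
Proof.
move=> e0 us; have g := gap_ge; have sp := s_gt0.
have g0 : 0 < x' - x by apply: lt_le_trans g; rewrite divr_gt0.
rewrite ler_pdivrMr// mulrAC ler_pdivlMr ?exprn_gt0// expr2 mulrA.
have h1 : u * s * s <= e * s by rewrite ler_wpM2r// ltW.
have h2 : e * (s / 20) <= e * (x' - x) by rewrite ler_wpM2l.
lra.
Qed.

Lemma lower_fit (y : n.-tuple R) :
  - a <= order_stat y q -> order_stat y q' <= - b -> good_fit k dt_fit ds_fit y.
Proof.
move=> ha hb.
have g := gap_ge; have sp := s_gt0; have /andP[d0 d1] := delta0.
have g0 : 0 < x' - x by apply: lt_le_trans g; rewrite divr_gt0.
have h1 := a_sub_le nE s4 tail1 delta0.
have h2 := b_sub_le k9 nE s4 tail1 delta0.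
have hs : 1 - ds_fit <= sigma_plus k y.
  rewrite lerBlDl /sigma_plus -lerBlDr.
  have : 1 - (order_stat y q - order_stat y q') / (x' - x) =
     ((x' - x) - (order_stat y q - order_stat y q')) / (x' - x).
    by rewrite [RHS]mulrBl divff// gt_eqF.
  move=> ->; rewrite (_ : ds_fit = 20 * (12 * delta) / s ^+ 2); last first.
    by rewrite /ds_fit; congr (_ / _); ring.
  apply: ratio_le; first by rewrite mulr_ge0// ltW.
  have : ((x' - x) - (order_stat y q - order_stat y q')) * s <= ((a - x) + (x' - b)) * s.
    rewrite ler_pM2r//; lra.
  rewrite mulrDl; lra.
rewrite /good_fit hs andbT /theta_plus.
have /andP[x0 x1] := x_itv nE s4 tail1.
have xx : (1 - ds_fit) * x <= sigma_plus k y * x.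
  by rewrite ler_wpM2r//; apply: le_trans x0; rewrite divr_ge0 ?ltW.
have dsx : ds_fit * x <= 180 * delta / s.
  apply: (@le_trans _ _ (ds_fit * (3 / 4 * s))).
    by rewrite ler_wpM2l// /ds_fit divr_ge0 ?mulr_ge0 ?exprn_ge0// ltW.
  rewrite /ds_fit le_eqVlt; apply/orP; left; apply/eqP; field.
  by rewrite gt_eqF.
have ax : a - x <= 8 * delta / s by rewrite ler_pdivlMr.
have -> : - dt_fit = - (8 * delta / s) - 180 * delta / s.
  by rewrite /dt_fit; field; rewrite gt_eqF.
lra.
Qed.

(** The terms in [r] are the price of the alternatives, from comparing levels over [n - k] and over
    [n]. Here [1600 = 20 * (40 + 40)] and [1240 = 40 + 1600 * 3 / 4]. *)
Lemma upper_fit (y : n.-tuple R) :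
  order_stat y q <= - a2 -> - b2 <= order_stat y q' ->
  sigma_plus k y <= 1 + 1600 * (delta + r) / s ^+ 2 /\
  theta_plus k y <= 1240 * (delta + r) / s.
Proof.
move=> ha hb.
have g := gap_ge; have sp := s_gt0; have /andP[d0 d1] := delta0.
have r0 : 0 <= r by rewrite divr_ge0.
have g0 : 0 < x' - x by apply: lt_le_trans g; rewrite divr_gt0.
have h1 := a2_sub_le k9 nE s4 tail1 delta0.
have h2 := b2_sub_le k9 nE s4 tail1 tail2 delta0.
have hs : sigma_plus k y <= 1 + 1600 * (delta + r) / s ^+ 2.
  rewrite -lerBlDl /sigma_plus.
  have : (order_stat y q - order_stat y q') / (x' - x) - 1 =
     ((order_stat y q - order_stat y q') - (x' - x)) / (x' - x).
    by rewrite [RHS]mulrBl divff// gt_eqF.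
  move=> ->; rewrite (_ : 1600 * (delta + r) / s ^+ 2 = 20 * (80 * (delta + r)) / s ^+ 2); last first.
    by congr (_ / _); ring.
  apply: ratio_le; first by rewrite mulr_ge0// addr_ge0// ltW.
  have : ((order_stat y q - order_stat y q') - (x' - x)) * s <= ((x - a2) + (b2 - x')) * s.
    rewrite ler_pM2r//; lra.
  rewrite mulrDl; lra.
split=> //; rewrite /theta_plus.
have /andP[x0 x1] := x_itv nE s4 tail1.
have xp : 0 <= x by apply: le_trans x0; rewrite divr_ge0 ?ltW.
have xx : sigma_plus k y * x <= (1 + 1600 * (delta + r) / s ^+ 2) * x.
  by rewrite ler_wpM2r.
have c0 : 0 <= 1600 * (delta + r) / s ^+ 2.
  apply: divr_ge0; last exact: exprn_ge0 (ltW sp).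
  apply: mulr_ge0; first exact: ler0n.
  by apply: addr_ge0; [exact: ltW|exact: r0].
have dsx : 1600 * (delta + r) / s ^+ 2 * x <= 1200 * (delta + r) / s.
  apply: (@le_trans _ _ (1600 * (delta + r) / s ^+ 2 * (3 / 4 * s))).
    exact: ler_wpM2l.
  rewrite le_eqVlt; apply/orP; left; apply/eqP; field.
  by rewrite !gt_eqF ?(n_gt0 nE).
have ax : x - a2 <= 40 * (delta + r) / s by rewrite ler_pdivlMr//; lra.
have -> : 1240 * (delta + r) / s = 40 * (delta + r) / s + 1200 * (delta + r) / s.
  by rewrite -mulrDl; congr (_ / _); ring.
lra.
Qed.

(** Provides [tailB]. For tiny [alpha] the quantile could be far beyond [s]; raising the level to
    [alpha' = max alpha (1 / n)] keeps it below [2 * s] and costs only the term [1 / n] in the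
    factor. *)
Lemma tail_fit (x0 alpha : R) (l : nat) : 0 < x0 -> Phibar x0 = 4 / 10 ->
  668 * delta <= x0 -> 2004 * delta <= 1 ->
  0 < alpha < 4 / 10 -> (0 < l <= n)%N ->
  Phibar ((1 - ds_fit) * Phibar_inv (alpha * l%:R / n%:R) - dt_fit) <=
  (alpha + n%:R^-1) / n%:R * (1 + 2004 * expR 3 * delta) * l%:R.
Proof.
move=> x0p x0E dx d2 /andP[al0 al1] /andP[l0 ln].
have sp := s_gt0; have h4 := s4; have /andP[d0 d1] := delta0.
have np := n_gt0 nE.
pose alpha' := Num.max alpha n%:R^-1.
have a'0 : 0 < alpha' by rewrite lt_max al0.
have ninv : n%:R^-1 <= 4 / 10 :> R.
  rewrite nE -expRN; have : 20 * expR (- s ^+ 2 / 4) <= 1.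
    exact: le_trans tail1 (Phibar_le1 _).
  have : expR (- s ^+ 2) <= expR (- s ^+ 2 / 4).
    by rewrite ler_expR; have := sqr_ge0 s; lra.
  lra.
have a'1 : alpha' <= 4 / 10 by rewrite ge_max ninv ltW.
have a'le : alpha' <= alpha + n%:R^-1.
  by rewrite ge_max lerDl lerDr !ltW ?invr_gt0.
have lR : 1 <= l%:R :> R by rewrite ler1n.
have lnR : l%:R <= n%:R :> R by rewrite ler_nat.
have ln01 : 0 < (l%:R / n%:R : R) <= 1.
  have lp : (0 : R) < l%:R by exact: lt_le_trans lR.
  by apply/andP; split; [exact: divr_gt0|rewrite ler_pdivrMr// mul1r].
have /andP[u0 u1] := ln01; set u := (l%:R / n%:R : R) in u0 u1 ln01 *.
pose t := alpha * u; pose t' := alpha' * u.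
have t0 : 0 < t by exact: mulr_gt0.
have tt' : t <= t'.
  by rewrite /t /t' ler_wpM2r ?(ltW u0)// le_max lexx.
have t'4 : t' <= 4 / 10.
  by apply: le_trans a'1; rewrite /t' ler_piMr// ltW.
have t'01 : 0 < t' < 1 by rewrite (lt_le_trans t0 tt')/=; lra.
have t01 : 0 < t < 1 by rewrite t0/=; lra.
rewrite -[alpha * _ / _]mulrA -/u -/t.
have XX : Phibar_inv t' <= Phibar_inv t by apply: ler_Phibar_inj; rewrite !Phibar_invK.
set X := Phibar_inv t in XX *; set X' := Phibar_inv t' in XX.
have X'E : Phibar X' = t' by exact: Phibar_invK.
(* Levels below 0.4 keep the quantile away from 0, which makes [h <= X'] possible. *)
have X'0 : x0 <= X' by apply: ler_Phibar_inj; rewrite X'E x0E.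
have X's : X' <= 2 * s.
  apply: quantile_le; first lra.
  rewrite X'E (_ : - (2 * s) ^+ 2 / 2 = - s ^+ 2 - s ^+ 2); last by field.
  rewrite expRD expRN -nE /t' /u.
  have ni0 : (0 : R) < n%:R^-1 by rewrite invr_gt0.
  apply: (@le_trans _ _ (n%:R^-1 * n%:R^-1)).
    by have := mulr_gt0 ni0 ni0; lra.
  apply: ler_pM; [exact: ltW|exact: ltW| |].
    by rewrite le_max lexx orbT.
  by rewrite ler_peMl// ltW.
(* With [X' <= 2 * s], [668 = 2 * 240 + 188]; with [X' + 1 <= 3 * s], [2004 = 3 * 668]. *)
pose h := ds_fit * X' + dt_fit.
have ds0 : 0 <= ds_fit by rewrite divr_ge0 ?mulr_ge0 ?exprn_ge0// ltW.
have ds1 : ds_fit <= 1.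
  rewrite /ds_fit ler_pdivrMr ?exprn_gt0// mul1r; nra.
have h_le : h <= 668 * delta / s.
  have -> : 668 * delta / s = ds_fit * (2 * s) + dt_fit.
    by rewrite /ds_fit /dt_fit; field; rewrite gt_eqF.
  by rewrite lerD2r ler_wpM2l.
have dt0 : 0 <= dt_fit.
  by apply: divr_ge0; [apply: mulr_ge0; [exact: ler0n|exact: ltW]|exact: ltW].
have h0 : 0 <= h.
  by apply: addr_ge0 => //; apply: mulr_ge0 => //; exact: le_trans (ltW x0p) X'0.
have hs : h * s <= 668 * delta by rewrite -ler_pdivlMr.
have hX : h <= X' by nra.
have hX1 : h * (X' + 1) <= 2004 * delta.
  have : h * (X' + 1) <= h * (3 * s) by rewrite ler_wpM2l//; lra.
  lra.
apply: (@le_trans _ _ (Phibar (X' - h))).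
  apply: ler_Phibar; rewrite /h opprD addrA -[X in X - _ - _]mul1r -mulrBl lerD2r.
  by rewrite ler_wpM2l// subr_ge0.
apply: (le_trans (Phibar_sub h0 hX _)); first by lra.
rewrite X'E /t'.
have e3 := expR_gt0 (3 : R).
rewrite [leRHS](_ : _ = ((alpha + n%:R^-1) * u) * (1 + 2004 * expR 3 * delta)); last first.
  by rewrite /u; field; rewrite gt_eqF.
apply: ler_pM.
- by case/andP: t'01 => /ltW.
- by rewrite addr_ge0// mulr_ge0 ?mulr_ge0 ?(ltW e3)//; lra.
- by rewrite ler_wpM2r// ltW.
- rewrite lerD2l [leRHS](_ : _ = expR 3 * (2004 * delta)); last by ring.
  by rewrite ler_pM2l.
Qed.

End fit_bounds.

Lemma ds_fit_lt1 {R : realType} (s d : R) : 4 <= s -> 2004 * d <= 1 ->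
  ds_fit s d < 1.
Proof.
move=> s4 d1; rewrite /ds_fit ltr_pdivrMr ?exprn_gt0//; last lra.
have s16 : 16 <= s ^+ 2 by nra.
lra.
Qed.

(** * Control of false discoveries for large n *)

Section gauss_bounds.
Context {R : realType}.
Variables (n k : nat) (s : R).
Hypothesis k9 : k%:R <= 9 / 10 * n%:R :> R.
Hypothesis nE : n%:R = expR (s ^+ 2).
Hypothesis s4 : 4 <= s.
Hypothesis tail1 : 20 * expR (- s ^+ 2 / 4) <= Phibar (s / 4).
Hypothesis tail2 : 20 * expR (- (3 / 4 * s ^+ 2)) <= Phibar (4 / 5 * s).

(* [delta_fit ^ 2 * q'_n] has order [n ^ (1 / 16)], which makes Chebyshev's bound
   of order [n ^ (- 1 / 16)]. *)
Definition delta_fit : R := expR (- (3 / 32 * s ^+ 2)).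
Local Notation delta := delta_fit.
Hypothesis delta_half : delta <= 1 / 2.

Let delta0 : 0 < delta <= 1 / 2.
Proof. by rewrite expR_gt0. Qed.

Variable v : 'I_n -> R.
Hypothesis v0 : forall i, 0 <= v i.
Hypothesis vk : (n - k <= #|[set i | v i == 0%R]%SET|)%N.

Local Notation q := (qn R n).
Local Notation q' := (qn' R n).
Local Notation N := (n%:R - k%:R : R).
Local Notation err := (expR (- (1 / 16 * s ^+ 2))).
Local Notation a := (Phibar_inv ((1 - delta) * q%:R / n%:R) : R).
Local Notation b := (Phibar_inv ((1 + delta) * q'%:R / N) : R).
Local Notation a2 := (Phibar_inv ((1 + delta) * q%:R / N) : R).
Local Notation b2 := (Phibar_inv ((1 - delta) * q'%:R / n%:R) : R).
Local Notation ds := (ds_fit s delta).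
Local Notation dt := (dt_fit s delta).

Let N0 : 0 < N <= #|[set i | v i == 0%R]%SET|%:R.
Proof.
rewrite (N_gt0 k9 nE)/= lerBlDr -natrD ler_nat.
by rewrite addnC -leq_subLR.
Qed.

Let q'_delta : expR (1 / 16 * s ^+ 2) / 2 <= delta ^+ 2 * q'%:R.
Proof.
have /andP[h _] := qn'_itv nE s4.
have := ler_wpM2l (sqr_ge0 delta) h; apply: le_trans.
have -> : delta ^+ 2 = expR (- (3 / 16 * s ^+ 2)).
  by rewrite /delta_fit -expRM_natl; congr expR; field.
rewrite [leRHS]mulrA -expRD.
by rewrite le_eqVlt; apply/orP; left; apply/eqP; congr (expR _ / _); field.
Qed.

Let inv_dev (c : R) p : 0 <= c -> (q' <= p)%N ->
  c / (delta ^+ 2 * p%:R) <= 2 * c * err.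
Proof.
move=> c0 qp; have d2 : 0 < delta ^+ 2 by rewrite exprn_gt0// expR_gt0.
have e0 : 0 < expR (1 / 16 * s ^+ 2) by exact: expR_gt0.
have h : expR (1 / 16 * s ^+ 2) / 2 <= delta ^+ 2 * p%:R.
  by apply: (le_trans q'_delta); rewrite ler_pM2l// ler_nat.
have h0 : 0 < delta ^+ 2 * p%:R by apply: lt_le_trans h; rewrite divr_gt0.
rewrite ler_pdivrMr// expRN.
have := ler_wpM2l c0 h => h'.
rewrite mulrAC -mulrA; set E := expR _ in h h' e0 *.
rewrite [leRHS](_ : _ = 2 * E^-1 * (c * (delta ^+ 2 * p%:R))); last by ring.
apply: (@le_trans _ _ (2 * E^-1 * (c * (E / 2)))); last first.
  by rewrite ler_wpM2l// mulr_ge0// invr_ge0 ltW.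
by rewrite le_eqVlt; apply/orP; left; apply/eqP; field; rewrite gt_eqF.
Qed.

Let q1 : (0 < q <= n)%N. Proof. exact: (qn_le_n nE s4). Qed.
Let q2 : (0 < q' <= q)%N. Proof. exact: (qn'_le_qn nE s4). Qed.
Let q3 : (0 < q' <= n)%N.
Proof. by case/andP: q1 => _ h; case/andP: q2 => -> /leq_trans; apply. Qed.

Local Notation tup := (n.-tuple R).

Let mos p : (0 < p <= n)%N -> measurable_fun setT (fun y : tup => order_stat (shift v y) p).
Proof.
by move=> hp; exact: (measurableT_comp (measurable_order_stat hp) (measurable_shift v)).
Qed.

Let mlt p c : (0 < p <= n)%N -> measurable [set y : tup | order_stat (shift v y) p < c].
Proof.
move=> hp; rewrite (_ : mkset _ = ~` [set y : tup | c <= order_stat (shift v y) p]).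
  exact: (measurableC (measurable_le_set (measurable_cst _) (mos hp))).
by apply/seteqP; split => y /=; rewrite ltNge => /negP.
Qed.

Let mgt p c : (0 < p <= n)%N -> measurable [set y : tup | c < order_stat (shift v y) p].
Proof.
move=> hp; rewrite (_ : mkset _ = ~` [set y : tup | order_stat (shift v y) p <= c]).
  exact: (measurableC (measurable_le_set (mos hp) (measurable_cst _))).
by apply/seteqP; split => y /=; rewrite ltNge => /negP.
Qed.

Let delta01 : 0 < delta < 1.
Proof. by have := delta0; lra. Qed.

Let delta01' : 0 < delta <= 1.
Proof. by have := delta0; lra. Qed.

Let dev_low p c : (q' <= p <= n)%N -> Phibar c = (1 - delta) * p%:R / n%:R ->
  (gauss n [set y | (order_stat (shift v y) p < - c)%R] <= (2 * err)%:E)%E.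
Proof.
move=> /andP[qp pn] cE.
have hp : (0 < p <= n)%N by rewrite pn andbT; case/andP: q2 => /leq_trans/(_ qp).
apply: (le_trans (order_stat_lower hp delta01 v0 cE)).
by rewrite lee_fin; apply: (le_trans (inv_dev ler01 qp)); rewrite mulr1.
Qed.

Let dev_up p c : (q' <= p <= n)%N -> Phibar c = (1 + delta) * p%:R / N ->
  (gauss n [set y | (- c < order_stat (shift v y) p)%R] <= (4 * err)%:E)%E.
Proof.
move=> /andP[qp pn] cE.
have hp : (0 < p <= n)%N by rewrite pn andbT; case/andP: q2 => /leq_trans/(_ qp).
apply: (le_trans (order_stat_upper hp delta01' N0 cE)).
rewrite lee_fin; apply: (le_trans (inv_dev (ler0n _ 2) qp)).
by rewrite -natrM.
Qed.

Let qq : (q' <= q <= n)%N.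
Proof. by case/andP: q1 => _ ->; case/andP: q2 => _ ->. Qed.

Let qq' : (q' <= q' <= n)%N.
Proof. by case/andP: q3 => _ ->; rewrite leqnn. Qed.

Let mbad : measurable [set y : tup | ~~ good_fit k dt ds (shift v y)].
Proof.
rewrite (_ : mkset _ = ~` (shift v @^-1` [set y | good_fit k dt ds y])).
  apply: measurableC; rewrite -[X in measurable X]setTI.
  exact: (measurable_shift v measurableT (measurable_good_fit _ _ _ q1 q2)).
by apply/seteqP; split => y /= /negP.
Qed.

(** By [lower_fit] a bad fit forces one of two deviations: [2 * err] for [Y_(q)] too low and
    [4 * err] for [Y_(q')] too high. *)
Lemma probability_bad_fit :
  (gauss n [set y | ~~ good_fit k dt ds (shift v y)] <= (6 * err)%:E)%E.
Proof.
apply: (@le_trans _ _ (gauss n ([set y : tup | (order_stat (shift v y) q < - a)%R] `|`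
    [set y : tup | (- b < order_stat (shift v y) q')%R]))).
  apply: le_measure; rewrite ?inE//.
    by apply: measurableU; [exact: mlt|exact: mgt].
  move=> y /= /negP; apply: contra_notP => /not_orP[/negP + /negP].
  rewrite -!leNgt => ha hb.
  exact: (lower_fit k9 nE s4 tail1 tail2 delta0 ha hb).
apply: (le_trans (measureU2 _ _ _)); [exact: mlt|exact: mgt|].
apply: (@le_trans _ _ ((2 * err)%:E + (4 * err)%:E)%E).
  apply: leeD; first by apply: dev_low => //; exact: (aE nE s4 tail1 delta0).
  by apply: dev_up => //; exact: (bE k9 nE s4 tail1 delta0).
by rewrite -EFinD lee_fin; lra.
Qed.

Lemma probability_bad_upper_fit :
  (gauss n [set y | (order_stat (shift v y) q > - a2)%R \/
                    (order_stat (shift v y) q' < - b2)%R] <= (6 * err)%:E)%E.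
Proof.
rewrite (_ : mkset _ = [set y : tup | (- a2 < order_stat (shift v y) q)%R] `|`
    [set y : tup | (order_stat (shift v y) q' < - b2)%R])//.
apply: (le_trans (measureU2 _ _ _)); [exact: mgt|exact: mlt|].
apply: (@le_trans _ _ ((4 * err)%:E + (2 * err)%:E)%E).
  apply: leeD; first by apply: dev_up => //; exact: (a2E k9 nE s4 tail1 delta0).
  by apply: dev_low => //; exact: (b2E k9 nE s4 tail1 delta0).
by rewrite -EFinD lee_fin; lra.
Qed.

Variable x0 : R.
Hypothesis x0_gt0 : 0 < x0.
Hypothesis x0E : Phibar x0 = 4 / 10.
Hypothesis delta_x0 : 668 * delta <= x0.
Hypothesis delta_small : 2004 * delta <= 1.

(** [6] for a bad fit, [1] for the excess [1 / n <= err] in [alpha'], and the factor of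
    [delta <= err] in [tail_fit]. *)
Definition fdr_cst : R := 7 + 2004 * expR 3.

Lemma integral_false_discoveries_fit alpha (A I : {set 'I_n}) :
  0 < alpha < 4 / 10 -> (forall i, i \in I -> v i = 0) ->
  (\int[gauss n]_y (#|step_up A alpha (plus_pval k (shift v y)) :&: I|%:R /
      (maxn (step_up_count A alpha (plus_pval k (shift v y))) 1)%:R)%:E
   <= (#|I|%:R / n%:R * alpha + fdr_cst * err)%:E)%E.
Proof.
move=> al vI; have /andP[al0 al1] := al.
have np := n_gt0 nE; have /andP[d0 d1] := delta0.
pose C : R := 2004 * expR 3.
have C0 : 0 < C by rewrite mulr_gt0 ?ltr0n ?expR_gt0.
pose B := (alpha + n%:R^-1) / n%:R * (1 + C * delta).
have hB l : (0 < l <= n)%N ->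
    Phibar ((1 - ds) * Phibar_inv (alpha * l%:R / n%:R) - dt) <= B * l%:R.
  move=> hl.
  exact: (tail_fit nE s4 tail1 delta0 x0_gt0 x0E delta_x0 delta_small al hl).
have al' : 0 < alpha < 1 / 2 by lra.
have x_ge0 : 0 <= Phibar_inv (q%:R / n%:R : R).
  by have h4 := s4; have /andP[+ _] := x_itv nE s4 tail1; apply: le_trans; lra.
have ds1 : ds < 1.
  exact: ds_fit_lt1.
have := @integral_false_discoveries R n k alpha dt ds A v al' q1 q2 x_ge0 ds1 B hB I vI.
move=> /le_trans; apply.
apply: (@le_trans _ _ ((6 * err)%:E + (#|I|%:R * B)%:E)%E).
  by rewrite leeD2r// probability_bad_fit.
rewrite -EFinD lee_fin.
have In : #|I|%:R / n%:R <= 1 :> R.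
  by rewrite ler_pdivrMr// mul1r ler_nat -[leqRHS]card_ord max_card.
have In0 : 0 <= #|I|%:R / n%:R :> R by rewrite divr_ge0// ltW.
set u := #|I|%:R / n%:R in In In0 *.
have -> : #|I|%:R * B = u * ((alpha + n%:R^-1) * (1 + C * delta)).
  by rewrite /u /B; field; rewrite gt_eqF.
have ninv : n%:R^-1 <= err.
  by rewrite nE -expRN ler_expR; have := sqr_ge0 s; lra.
have ninv0 : 0 < n%:R^-1 :> R by rewrite invr_gt0.
have derr : delta <= err by rewrite ler_expR; have := sqr_ge0 s; lra.
have ninv1 : n%:R^-1 <= 1 / 2 :> R.
  rewrite nE -expRN; have := le_trans tail1 (Phibar_le1 _).
  have : expR (- s ^+ 2) <= expR (- s ^+ 2 / 4).
    by rewrite ler_expR; have := sqr_ge0 s; lra.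
  lra.
pose w := n%:R^-1 + (alpha + n%:R^-1) * (C * delta).
have wE : (alpha + n%:R^-1) * (1 + C * delta) = alpha + w by rewrite /w; ring.
have Cd : 0 <= C * delta by rewrite mulr_ge0// ltW.
have w0 : 0 <= w by rewrite addr_ge0 ?(ltW ninv0)// mulr_ge0// addr_ge0 ?(ltW ninv0)// ltW.
have w1 : w <= err + C * err.
  rewrite /w lerD//; apply: (@le_trans _ _ (C * delta)).
    by rewrite ler_piMl//; lra.
  by rewrite ler_pM2l.
have uw : u * w <= w by rewrite ler_piMl.
by rewrite wE mulrDr /fdr_cst -/C; lra.
Qed.

(** When only nulls are tested every rejection is false, so the false discovery proportion is the
    indicator that something is rejected. *)
Lemma probability_rejection_fit alpha (A : {set 'I_n}) :
  0 < alpha < 4 / 10 -> (forall i, i \in A -> v i = 0) ->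
  (gauss n [set y | (0 < step_up_count A alpha (plus_pval k (shift v y)))%N] <=
   (alpha + fdr_cst * err)%:E)%E.
Proof.
move=> al vA; have /andP[al0 al1] := al.
have ms : measurable [set y : tup | (0 < step_up_count A alpha (plus_pval k (shift v y)))%N].
  pose F a := (0 < arr_count A a)%N.
  rewrite (_ : mkset _ = shift v @^-1` [set y | F (plus_array alpha k y)]); last first.
    by apply/seteqP; split => y /=; rewrite /plus_pval step_up_countE.
  rewrite -[X in measurable X]setTI.
  apply: (measurable_shift v measurableT).
  exact: (@measurable_set_pval_array R n alpha _ _ F
    (measurable_theta_plus k q1 q3) (measurable_sigma_plus k q1 q3)).
have al' : (0 <= alpha) by exact: ltW.
apply: (@le_trans _ _ (#|A|%:R / n%:R * alpha + fdr_cst * err)%:E); last first.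
  rewrite lee_fin lerD2r ler_piMl// ler_pdivrMr ?(n_gt0 nE)// mul1r ler_nat.
  by rewrite -[leqRHS]card_ord max_card.
apply: le_trans (@integral_false_discoveries_fit alpha A A al vA).
rewrite -[X in gauss n X]setIT -integral_indic//.
rewrite le_eqVlt; apply/orP; left; apply/eqP; apply: eq_integral => y _.
congr EFin; rewrite indicE; set c := step_up_count _ _ _.
rewrite (_ : (y \in _) = (0 < c)%N); last by apply/idP/idP; rewrite inE.
have cE : #|step_up A alpha (plus_pval k (shift v y))| = c by exact: card_step_up.
have -> : step_up A alpha (plus_pval k (shift v y)) :&: A =
    step_up A alpha (plus_pval k (shift v y)).
  apply/setP => i; rewrite finset.in_setI [i \in step_up _ _ _]inE.
  by case: (i \in A); rewrite ?andbT.
rewrite cE; case: c {cE} => [|c]; first by rewrite mul0r.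
by rewrite (maxn_idPl _)// divff// pnatr_eq0.
Qed.

End gauss_bounds.

(** Unlike [qn_le_n] and [qn'_le_qn], available for every positive [n], so that measurability and
    the reduction to [gauss] cover small [n]. *)
Lemma quantile_ranks {R : realType} (n : nat) : (0 < n)%N ->
  (0 < qn R n <= n)%N /\ (0 < qn' R n <= qn R n)%N.
Proof.
move=> n0; have n1 : 1 <= n%:R :> R by rewrite ler1n.
have powR1 (e : R) : 0 <= e -> 1 <= n%:R `^ e :> R.
  by move=> e0; have := ler_powR n1 e0; rewrite powRr0.
have q'q : n%:R `^ (1 / 4) <= n%:R `^ (3 / 4) :> R by apply: ler_powR => //; lra.
have qn1 : n%:R `^ (3 / 4) <= n%:R :> R.
  by have := @ler_powR _ _ n1 (3 / 4) 1; rewrite powRr1//; apply; lra.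
rewrite /qn /qn' !truncn_gt0 !powR1/=; [|lra|lra].
split; last exact: le_truncn.
by rewrite -[leqRHS](@natrK R n); exact: le_truncn.
Qed.

(** * Simes' inequality and the bound on the proportion *)

Section simes.
Context {R : realType} (n : nat).
Variables (m : 'rV[R]_n) (alpha u s : R) (y : n.-tuple R).

(* Were [FDP m S] larger than the [l]-th term of the minimum, at least [l] of
   the null [p]-values would be at most [alpha * l / n]. *)
Lemma FDP_le_FDPbar (S : {set 'I_n}) :
  step_up_count (H0 m) alpha (pval y u s) = 0%N ->
  FDP m S <= FDPbar alpha u s y S.
Proof.
move=> c0; rewrite /FDPbar big_nat_cond.
have S0 : (0 : R) < (maxn #|S| 1)%:R by rewrite ltr0n leq_max orbT.
apply: (big_ind (fun z => FDP m S <= z)).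
- by rewrite /FDP ler_pdivrMr// mul1r ler_nat leq_max subset_leq_card// subsetIl.
- by move=> a b ha hb; rewrite le_min ha.
move=> l; rewrite andbT ltnS => /andP[l1 ln].
rewrite /FDP ler_pM2r ?invr_gt0//.
have hl : (hits (H0 m) alpha (pval y u s) l < l)%N.
  rewrite ltnNge; apply/negP => hl.
  by have := step_up_count_max ln hl; rewrite c0 leqNgt l1.
pose T := [set i in S | (alpha * l%:R / n%:R < pval y u s i)%R]%SET.
have -> : \sum_(i in S) (alpha * l%:R / n%:R < pval y u s i)%R%:R = #|T|%:R :> R.
  rewrite -sum1_card natr_sum big_mkcond [RHS]big_mkcond.
  by apply: eq_bigr => i _; rewrite inE; case: (i \in S); case: (_ < _).
have : (#|S :&: H0 m| <= #|T| + l.-1)%N.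
  apply: (@leq_trans (#|T| + hits (H0 m) alpha (pval y u s) l)).
    apply: leq_trans (leq_card_setU _ _).
    apply/subset_leq_card/fintype.subsetP => i; rewrite !inE => /andP[-> ->] /=.
    by rewrite ltNge; case: (_ <= _).
  by rewrite leq_add2l -ltnS prednK.
rewrite -(ler_nat R) natrD => /le_trans; apply.
by rewrite -addrA lerD2l -subn1 natrB.
Qed.

End simes.

(** * Conditions valid from some rank on *)

Section eventual_conditions.
Context {R : realType}.

Lemma eventually_fit : exists S x0 : R, [/\ 4 <= S, 0 < x0, Phibar x0 = 4 / 10 &
  forall s, S <= s ->
  [/\ 20 * expR (- s ^+ 2 / 4) <= Phibar (s / 4),
      20 * expR (- (3 / 4 * s ^+ 2)) <= Phibar (4 / 5 * s),
      delta_fit s <= 1 / 2, 668 * delta_fit s <= x0 & 2004 * delta_fit s <= 1]].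
Proof.
have [S1 S14 hS1] := @eventually_tail_ge R.
have [x0 x0E] : exists x0 : R, Phibar x0 = 4 / 10 by apply: Phibar_surj; lra.
have x0p : 0 < x0 by apply: ltr_Phibar_inj; rewrite Phibar0 x0E; lra.
pose eta := Num.min (x0 / 668) (1 / 2004).
have eta0 : 0 < eta by rewrite lt_min; apply/andP; split; lra.
(* For [s >= 4] one has [delta_fit s <= 8 / (3 * s)], which is at most [eta] once [s >= 8 / eta]. *)
exists (Num.max S1 (8 / eta)), x0; split; [by rewrite le_max S14|exact: x0p|exact: x0E|].
move=> s; rewrite ge_max => /andP[s1 s2].
have s4 : 4 <= s by exact: le_trans s1.
have [t1 t2] := hS1 _ s1.
have dE : delta_fit s <= eta.
  rewrite /delta_fit expRN.
  have h : s * (3 / 8) <= expR (3 / 32 * s ^+ 2).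
    by apply: le_trans (expR_ge1Dx _); nra.
  have h0 : 0 < s * (3 / 8) by lra.
  apply: (@le_trans _ _ (s * (3 / 8))^-1).
    by rewrite lef_pV2// posrE expR_gt0.
  rewrite -[leRHS]invrK lef_pV2 ?posrE ?invr_gt0//.
  move: s2; rewrite ler_pdivrMr// => s2.
  rewrite -[leLHS]mul1r ler_pdivrMr//; nra.
have d1 : delta_fit s <= x0 / 668 by apply: (le_trans dE); rewrite ge_min lexx.
have d2 : delta_fit s <= 1 / 2004 by apply: (le_trans dE); rewrite ge_min lexx orbT.
by split; [exact: t1|exact: t2|lra|lra|lra].
Qed.

End eventual_conditions.

(** * Expectations and probabilities in the original model *)

Section model_reduction.
Context {R : realType} (n k0 : nat) (rho : R) (m : 'rV[R]_n).
Context d (T : measurableType d) (P : probability T R) (Y : {RV P >-> n.-tuple R}).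
Hypothesis n0 : (0 < n)%N.
Hypothesis rho01 : 0 <= rho < 1.
Hypothesis YG : gaussian_vector Y m (equicorr n rho).
Local Notation m' := (((Num.sqrt (1 - rho))^-1 *: m) 0).

Lemma expectation_BH alpha (f : {set 'I_n} -> R) : 0 <= alpha ->
  (forall S, 0 <= f S) ->
  ('E_P[fun w => f (BH alpha (theta_plus k0 (Y w)) (sigma_plus k0 (Y w)) (Y w))] =
   \int[gauss n]_y
     (f (step_up [set: 'I_n]%SET alpha (plus_pval k0 (shift m' y))))%:E)%E.
Proof.
move=> a0 f0; have [q1 q2] := @quantile_ranks R n n0.
have q3 : (0 < qn' R n <= n)%N.
  by case/andP: q1 => _ h; case/andP: q2 => -> /leq_trans; apply.
rewrite unlock; under eq_integral do rewrite BHE//.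
rewrite (@integral_plus_array R d T P n rho m Y rho01 YG q1 q3 alpha k0
  (fun a => f (arr_set [set: 'I_n]%SET a)) (fun a => f0 _)).
by apply: eq_integral => y _; rewrite /plus_pval step_upE.
Qed.

(** If the step-up procedure on the nulls rejects nothing, [FDP_le_FDPbar] holds for all [S]
    simultaneously. *)
Lemma probability_FDPbar alpha :
  (1 - P [set w | forall S : {set 'I_n},
           (FDP m S <= FDPbar alpha (theta_plus k0 (Y w)) (sigma_plus k0 (Y w)) (Y w) S)%R]
   <= gauss n [set y | (0 < step_up_count (H0 m) alpha (plus_pval k0 (shift m' y)))%N])%E.
Proof.
have [q1 q2] := @quantile_ranks R n n0.
have q3 : (0 < qn' R n <= n)%N.
  by case/andP: q1 => _ h; case/andP: q2 => -> /leq_trans; apply.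
pose F a := forall S : {set 'I_n}, FDP m S <= arr_FDPbar a S.
have -> : P [set w | forall S : {set 'I_n},
    (FDP m S <= FDPbar alpha (theta_plus k0 (Y w)) (sigma_plus k0 (Y w)) (Y w) S)%R] =
    gauss n [set y | F (plus_array alpha k0 (shift m' y))].
  rewrite -(@probability_plus_array R d T P n rho m Y rho01 YG q1 q3 alpha k0 F).
  congr (P _); apply/seteqP; split => w /= h S; first by rewrite -FDPbarE.
  by rewrite FDPbarE.
have meas (G : {ffun 'I_n * 'I_n.+1 -> bool} -> Prop) :
    measurable [set y | G (plus_array alpha k0 (shift m' y))].
  rewrite (_ : mkset _ = shift m' @^-1` [set y | G (plus_array alpha k0 y)])//.
  rewrite -[X in measurable X]setTI; apply: (measurable_shift m' measurableT).
  exact: (@measurable_set_pval_array R n alpha _ _ G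
    (measurable_theta_plus k0 q1 q3) (measurable_sigma_plus k0 q1 q3)).
rewrite -probability_setC//.
apply: le_measure; rewrite ?inE.
- exact: measurableC.
- rewrite (_ : mkset _ = [set y | (fun a => (0 < arr_count (H0 m) a)%N)
      (plus_array alpha k0 (shift m' y))]).
    exact: (meas (fun a => (0 < arr_count (H0 m) a)%N)).
  by apply/seteqP; split => y /=; rewrite /plus_pval step_up_countE.
- move=> y /=; apply: contra_notP => /negP; rewrite -eqn0Ngt => /eqP c0 S.
  by rewrite -FDPbarE; exact: FDP_le_FDPbar.
Qed.

End model_reduction.

Lemma measurable_step_up {R : realType} (n k0 : nat) (alpha : R) A (v : 'I_n -> R)
    (f : {set 'I_n} -> R) : (0 < n)%N ->
  measurable_fun setT (fun y => f (step_up A alpha (plus_pval k0 (shift v y)))).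
Proof.
move=> n0; have [q1 q2] := @quantile_ranks R n n0.
have q3 : (0 < qn' R n <= n)%N.
  by case/andP: q1 => _ h; case/andP: q2 => -> /leq_trans; apply.
rewrite (_ : (fun y => _) = fun y => f (arr_set A (plus_array alpha k0 (shift v y)))).
  have mf := @measurable_pval_array R n _ R alpha _ _ (fun a => f (arr_set A a))
    (measurable_theta_plus k0 q1 q3) (measurable_sigma_plus k0 q1 q3).
  exact: (measurableT_comp mf (measurable_shift v)).
by apply/funext => y; rewrite /plus_pval step_upE.
Qed.

(** * The non-asymptotic bounds *)

Section expected_proportions.
Context {R : realType}.

Lemma null_cards (n : nat) (m : 'rV[R]_n) (c : R) : 0 < c ->
  (forall i, 0 <= m 0 i) ->
  (n - n1 m <= #|[set i | (c *: m) 0%R i == 0%R]%SET|)%N.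
Proof.
move=> c0 m0; rewrite leq_subLR -[leqLHS]card_ord -cardsT.
apply: leq_trans (leq_card_setU _ _); apply/subset_leq_card/fintype.subsetP => i _.
rewrite !inE mxE mulf_eq0 gt_eqF//= lt0r m0 andbT.
by case: (m 0 i == 0).
Qed.

Lemma FDP_ge0 (n : nat) (m : 'rV[R]_n) S : 0 <= FDP m S.
Proof. by rewrite divr_ge0. Qed.

Lemma FDP_le1 (n : nat) (m : 'rV[R]_n) S : FDP m S <= 1.
Proof.
rewrite /FDP ler_pdivrMr ?ltr0n ?leq_max ?orbT// mul1r ler_nat leq_max.
by rewrite subset_leq_card// subsetIl.
Qed.

Lemma FDP_control : exists2 c : R, 0 < c &
  forall (n : nat) (alpha rho : R) (m : 'rV[R]_n) (k0 : nat)
      (d : measure_display) (T : measurableType d) (P : probability T R)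
      (Y : {RV P >-> n.-tuple R}),
    (2 <= n)%N -> 0 < alpha < 4 / 10 -> 0 <= rho < 1 ->
    (forall i, 0 <= m 0 i) ->
    (n1 m <= k0)%N -> k0%:R <= 9 / 10 * n%:R :> R ->
    gaussian_vector Y m (equicorr n rho) ->
    (maxe ('E_P[fun w => FDP m (BH alpha (theta_plus k0 (Y w))
                                   (sigma_plus k0 (Y w)) (Y w))]
           - ((n0 m)%:R / n%:R * alpha)%:E) 0
       <= (c * (ln n%:R / n%:R `^ (1 / 16)))%:E)%E
    /\
    (maxe ((1 - alpha)%:E
           - P [set w | forall S : {set 'I_n},
                  (FDP m S <= FDPbar alpha (theta_plus k0 (Y w))
                                (sigma_plus k0 (Y w)) (Y w) S)%R]) 0
       <= (c * (ln n%:R / n%:R `^ (1 / 16)))%:E)%E.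
Proof.
have [S [x0 [S4 x0p x0E hS]]] := @eventually_fit R.
have ln2 : 0 < ln 2 :> R by rewrite ln_gt0// ltr1n.
have c1 : 0 < @fdr_cst R by rewrite addr_gt0 ?mulr_gt0 ?ltr0n ?expR_gt0.
have c2 : 0 < expR (S ^+ 2) / ln 2 :> R by rewrite divr_gt0 ?expR_gt0.
(* The first summand serves [n >= expR (S^2)]. For smaller [n] the rate is at least
   [ln 2 / expR (S^2)], so the second summand makes the bound at least 1 and hence trivial. *)
exists (@fdr_cst R + expR (S ^+ 2) / ln 2); first exact: addr_gt0.
move=> n alpha rho m k0 d T P Y n2 al rho01 m0 nk k9 YG.
have /andP[al0 al1] := al.
have n0' : (0 < n)%N by exact: ltnW.
have nR1 : 1 <= n%:R :> R by rewrite ler1n.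
have nR : 0 < n%:R :> R by rewrite ltr0n.
pose s := Num.sqrt (ln (n%:R : R)).
have lnn : 0 <= ln (n%:R : R) by rewrite ln_ge0.
have s2 : s ^+ 2 = ln n%:R by rewrite sqr_sqrtr.
have nE : n%:R = expR (s ^+ 2) by rewrite s2 lnK// posrE.
have s0 : 0 <= s by rewrite sqrtr_ge0.
have sr : 0 < Num.sqrt (1 - rho) by rewrite sqrtr_gt0 subr_gt0; case/andP: rho01.
set m' := ((Num.sqrt (1 - rho))^-1 *: m).
have m'0 i : 0 <= m' 0 i by rewrite mxE mulr_ge0// invr_ge0 ltW.
have pow0 : 0 < n%:R `^ (1 / 16) :> R by rewrite powR_gt0.
set rate := ln n%:R / n%:R `^ (1 / 16).
have rate0 : 0 <= rate by rewrite divr_ge0// ltW.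
set c := @fdr_cst R + expR (S ^+ 2) / ln 2.
pose E1 := (\int[gauss n]_y (FDP m (step_up [set: 'I_n]%SET alpha (plus_pval k0 (shift (m' 0%R) y))))%:E)%E.
pose E2 := gauss n [set y | (0 < step_up_count (H0 m) alpha (plus_pval k0 (shift (m' 0%R) y)))%N].
suff [h1 h2] : (E1 <= ((n0 m)%:R / n%:R * alpha + c * rate)%:E)%E /\
               (E2 <= (alpha + c * rate)%:E)%E.
  have cr0 : 0 <= c * rate by rewrite mulr_ge0// ltW// addr_gt0.
  split; rewrite ge_max lee_fin cr0 andbT.
    rewrite (expectation_BH k0 n0' rho01 YG (ltW al0) (@FDP_ge0 n m)) -/E1.
    by rewrite leeBlDr// -EFinD addrC.
  have := probability_FDPbar k0 n0' rho01 YG alpha; rewrite -/m' -/E2.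
  set Pr := P _; move=> h; have {}h := le_trans h h2.
  by rewrite EFinB addeAC leeBlDr// -EFinD [c * rate + _]addrC.
have n1R : (1 : R) <= n%:R by [].
have mE1 : measurable_fun setT (fun y =>
    (FDP m (step_up [set: 'I_n]%SET alpha (plus_pval k0 (shift (m' 0%R) y))))%:E).
  apply/measurable_EFinP.
  exact: (@measurable_step_up R n k0 alpha [set: 'I_n]%SET (m' 0%R) (FDP m) n0').
have mE2 : measurable [set y : n.-tuple R | (0 < step_up_count (H0 m) alpha (plus_pval k0 (shift (m' 0%R) y)))%N].
  have := @measurable_le_set R _ (n.-tuple R) _ _ (measurable_cst (1 : R))
   (@measurable_step_up R n k0 alpha (H0 m) (m' 0%R) (fun S => #|S|%:R) n0').
  congr measurable; apply/seteqP; split => y /=;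
  by rewrite (card_step_up _ _ (ltW al0)) ler1n.
have [sS|sS] := leP S s; last first.
  suff cr1 : 1 <= c * rate.
    split; last first.
      apply: (le_trans (probability_le1 _ mE2)); rewrite lee_fin; lra.
    apply: (@le_trans _ _ (\int[gauss n]_y cst 1%E y)%E).
      apply: ge0_le_integral => //.
      - by move=> y _; rewrite lee_fin FDP_ge0.
      - by move=> y _; rewrite lee_fin FDP_le1.
    rewrite integral_cst//= probability_setT mule1 lee_fin.
    by apply: (le_trans cr1); rewrite lerDr; apply: mulr_ge0; [exact: divr_ge0|exact: ltW].
  have nS : n%:R <= expR (S ^+ 2) by rewrite nE ler_expR lerXn2r ?nnegrE// ?ltW// (le_lt_trans s0).
  have powS : n%:R `^ (1 / 16) <= expR (S ^+ 2).
    apply: le_trans nS; have := @ler_powR _ _ n1R (1 / 16) 1.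
    by rewrite powRr1 ?(le_trans ler01)//; apply; lra.
  have lnge : ln 2 <= ln (n%:R : R) by rewrite ler_ln ?posrE// ler_nat.
  have rge : ln 2 / expR (S ^+ 2) <= rate.
    apply: ler_pM => //; first exact: ltW.
    by rewrite lef_pV2 ?posrE ?expR_gt0.
  apply: (@le_trans _ _ ((expR (S ^+ 2) / ln 2) * (ln 2 / expR (S ^+ 2)))).
    by rewrite mulrA divfK ?gt_eqF// divff// gt_eqF// expR_gt0.
  apply: ler_pM => //; rewrite ?divr_ge0 ?expR_ge0 ?(ltW ln2)//.
  by rewrite /c lerDr ltW.
have [t1 t2 d1 d2 d3] := hS _ sS.
have s4 : 4 <= s by exact: le_trans sS.
have vk : (n - k0 <= #|[set i | m' 0%R i == 0%R]%SET|)%N.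
  apply: leq_trans (null_cards _ m0); last by rewrite invr_gt0.
  exact: leq_sub2l.
have H0v i : i \in H0 m -> m' 0 i = 0.
  by rewrite inE mxE => /eqP ->; rewrite mulr0.
have errr : @fdr_cst R * expR (- (1 / 16 * s ^+ 2)) <= c * rate.
  have rE : rate = s ^+ 2 * expR (- (1 / 16 * s ^+ 2)).
    by rewrite /rate (powR_sqr_ln nE) -s2 expRN.
  have e0 := expR_gt0 (- (1 / 16 * s ^+ 2)).
  apply: (@le_trans _ _ (@fdr_cst R * rate)).
    rewrite ler_pM2l// rE ler_peMl ?(ltW e0)//; nra.
  by rewrite ler_wpM2r// /c lerDl ltW.
split.
  apply: (@le_trans _ _ ((n0 m)%:R / n%:R * alpha + @fdr_cst R * expR (- (1 / 16 * s ^+ 2)))%:E).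
    rewrite /E1; under eq_integral do rewrite /FDP (card_step_up _ _ (ltW al0)).
    exact: (@integral_false_discoveries_fit R n k0 s k9 nE s4 t1 t2 d1 (m' 0%R) m'0 vk
      x0 x0p x0E d2 d3 alpha _ _ al H0v).
  by rewrite lee_fin lerD2l.
apply: (@le_trans _ _ (alpha + @fdr_cst R * expR (- (1 / 16 * s ^+ 2)))%:E).
  exact: (@probability_rejection_fit R n k0 s k9 nE s4 t1 t2 d1 (m' 0%R) m'0 vk
    x0 x0p x0E d2 d3 alpha _ al H0v).
by rewrite lee_fin lerD2l.
Qed.

End expected_proportions.

(** * Power: stability of the oracle rejections *)

Section power_comparison.
Context {R : realType} (n : nat).
Variables (alpha eps u s du ds : R) (z : n.-tuple R).
Local Notation c1 := (step_up_count [set: 'I_n]%SET alpha (pval z 0 1)).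
Local Notation X := (Phibar_inv (alpha * c1%:R / n%:R) : R).
Local Notation h := (ds * X + du).

(** Each oracle rejection keeps a perturbed p-value of at most [(1 + eps)] times the oracle
    threshold. So [c1] is still an admissible count at level [alpha * (1 + eps)], and the new
    threshold is no smaller. *)
Lemma BH_subset_perturbed : 0 < alpha < 1 / 2 -> 0 <= eps -> (0 < c1)%N ->
  0 < s -> s <= 1 + ds -> u <= du -> 0 <= ds -> 0 <= h -> h <= X ->
  h * (X + 1) <= 1 -> expR 3 * (h * (X + 1)) <= eps ->
  step_up [set: 'I_n]%SET alpha (pval z 0 1) \subset
  step_up [set: 'I_n]%SET (alpha * (1 + eps)) (pval z u s).
Proof.
move=> al e0 c0 s0 sds udu ds0 h0 hX h1 heps; have /andP[al0 al1] := al.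
have a0' : 0 <= alpha by exact: ltW.
have tI : 0 < alpha * c1%:R / n%:R < 1 / 2.
  have np : 0 < n%:R :> R.
    by rewrite ltr0n; apply: leq_trans c0 _; exact: step_up_count_le.
  apply/andP; split; first by rewrite divr_gt0// mulr_gt0// ltr0n.
  apply: le_lt_trans al1.
  by rewrite ler_pdivrMr// ler_pM2l// ler_nat; exact: step_up_count_le.
have /andP[t0 t1] := tI; set t := alpha * c1%:R / n%:R in t0 t1 h0 hX h1 heps *.
have XE : Phibar (Phibar_inv t) = t by apply: Phibar_invK; rewrite t0/=; lra.
set Xt := Phibar_inv t in XE h0 hX h1 heps *.
set ht := ds * Xt + du in h0 hX h1 heps *.
have key i : i \in step_up [set: 'I_n]%SET alpha (pval z 0 1) ->
    pval z u s i <= t * (1 + eps).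
  rewrite inE => /andP[_]; rewrite -/t -{1}XE /pval => /ler_Phibar_inj.
  rewrite subr0 divr1 => Xz.
  apply: (@le_trans _ _ (Phibar (Xt - ht))).
    apply: ler_Phibar; rewrite ler_pdivlMr//.
    (* The choice [h = ds * X + du] gives [(X - h) * (1 + ds) = X - du - ds * h], at most
       [X - du]. *)
    have : (Xt - ht) * s <= (Xt - ht) * (1 + ds) by rewrite ler_wpM2l// subr_ge0.
    have : 0 <= ds * ht by rewrite mulr_ge0.
    rewrite /ht; lra.
  apply: (le_trans (Phibar_sub h0 hX h1)); rewrite XE.
  by rewrite ler_wpM2l ?(ltW t0)// lerD2l.
set c2 := step_up_count [set: 'I_n]%SET (alpha * (1 + eps)) (pval z u s).
have c12 : (c1 <= c2)%N.
  apply: step_up_count_max; first exact: step_up_count_le.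
  rewrite -[X in (X <= _)%N](card_step_up [set: 'I_n]%SET (pval z 0 1) a0').
  apply: subset_leq_card; apply/fintype.subsetP => i /key pi.
  rewrite !inE; apply: (le_trans pi).
  by rewrite /t le_eqVlt; apply/orP; left; apply/eqP; ring.
apply/fintype.subsetP => i /key pi; rewrite !inE; apply: (le_trans pi).
rewrite -/c2 (_ : t * (1 + eps) = alpha * (1 + eps) * c1%:R / n%:R); last by rewrite /t; ring.
by rewrite ler_wpM2r ?invr_ge0// ler_wpM2l ?ler_nat// mulr_ge0// addr_ge0.
Qed.

End power_comparison.

(** * Power: pointwise comparison on good samples *)

Section power_pointwise.
Context {R : realType}.
Variables (n k : nat) (s : R).
Hypothesis k9 : k%:R <= 9 / 10 * n%:R :> R.
Hypothesis nE : n%:R = expR (s ^+ 2).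
Hypothesis s4 : 4 <= s.
Hypothesis tail1 : 20 * expR (- s ^+ 2 / 4) <= Phibar (s / 4).
Hypothesis tail2 : 20 * expR (- (3 / 4 * s ^+ 2)) <= Phibar (4 / 5 * s).
Local Notation delta := (delta_fit s).
Hypothesis delta_half : delta <= 1 / 2.
Hypothesis delta_small : 2004 * delta <= 1.
Variable x0 : R.
Hypothesis x0_gt0 : 0 < x0.
Hypothesis x0E : Phibar x0 = 4 / 10.

Local Notation q := (qn R n).
Local Notation q' := (qn' R n).
Local Notation N := (n%:R - k%:R : R).
Local Notation a2 := (Phibar_inv ((1 + delta) * q%:R / N) : R).
Local Notation b2 := (Phibar_inv ((1 - delta) * q'%:R / n%:R) : R).
Local Notation r := (k%:R / n%:R : R).

Definition good_two_sided (y : n.-tuple R) : Prop :=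
  [/\ good_fit k (dt_fit s delta) (ds_fit s delta) y,
      order_stat y q <= - a2 & - b2 <= order_stat y q'].

Variables (alpha eps eta C : R) (m : 'rV[R]_n).
Hypothesis al : 0 < alpha < 4 / 10.
Hypothesis eps01 : 0 < eps < 1.
Hypothesis eta0 : 0 < eta.
Hypothesis C0 : 0 < C.
Hypothesis nk : (n1 m <= k)%N.
Hypothesis kn : k%:R <= C * (n1 m)%:R :> R.

(** Bound for [r * (X + 1)] that does not involve [n]: [s_x0] and [s_eps] thus hold eventually, the
    latter because [eps * s] tends to infinity. *)
Definition power_cst (al et c : R) : R := 4 + 2 * `|ln (c / (al * et))|.
Local Notation K := (power_cst alpha eta C).

Hypothesis s11 : 11 <= s.
Hypothesis s_alpha : - ln alpha <= s ^+ 2.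
Hypothesis s_x0 : 4440 * (3 + K) <= x0 * s.
Hypothesis s_eps : 4440 * expR 3 * (3 + K) <= eps * s.

(** Either the oracle proportion is at most [eta], or the oracle makes at least [eta * n1]
    rejections. In the second case [n1] and [k] being comparable bounds its threshold from below,
    and all its rejections are kept. *)
Lemma TDP_comparison (z : n.-tuple R) : good_two_sided z ->
  TDP m (step_up [set: 'I_n]%SET alpha (pval z 0 1)) <=
  TDP m (step_up [set: 'I_n]%SET (alpha * (1 + eps)) (plus_pval k z)) + eta.
Proof.
move=> [gz ha hb].
have [al0 al1] := andP al; have [e0 e1] := andP eps01.
have al2 : 0 < alpha < 1 / 2 by rewrite al0/=; lra.
have sp : 0 < s by apply: lt_le_trans s4.
have np := n_gt0 nE.
have TDP_ge0 S : 0 <= TDP m S :> R by rewrite divr_ge0.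
set BH1 := step_up _ alpha _.
have [small|large] := leP (TDP m BH1) eta.
  by apply: (le_trans small); rewrite lerDr.
suff sub : BH1 \subset step_up [set: 'I_n]%SET (alpha * (1 + eps)) (plus_pval k z).
  apply: (@le_trans _ _ (TDP m (step_up [set: 'I_n]%SET (alpha * (1 + eps)) (plus_pval k z)))); last by rewrite lerDl ltW.
  rewrite /TDP; apply: ler_wpM2r; first by rewrite invr_ge0 ler0n.
  rewrite ler_nat.
  by apply: subset_leq_card; exact: finset.setSI.
have n1_gt0 : (0 < n1 m)%N.
  rewrite lt0n; apply/negP => /eqP n10; move: large; rewrite /TDP /n1 in n10 *.
  rewrite (_ : #|BH1 :&: H1 m| = 0%N) ?mul0r; first by rewrite ltNge ltW.
  by apply/eqP; rewrite -leqn0 -n10 subset_leq_card// subsetIr.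
pose c1 := step_up_count [set: 'I_n]%SET alpha (pval z 0 1).
have cE : #|BH1| = c1 by apply: card_step_up; exact: ltW.
have n1R : (0 : R) < (n1 m)%:R by rewrite ltr0n.
have c1_ge : eta * (n1 m)%:R <= c1%:R.
  move: large; rewrite /TDP (maxn_idPl n1_gt0) ltr_pdivlMr// => /ltW /le_trans; apply.
  by rewrite -cE ler_nat subset_leq_card// subsetIl.
have c1_gt0 : (0 < c1)%N.
  by rewrite -(ltr0n R); apply: lt_le_trans c1_ge; rewrite mulr_gt0.
have c1R : 1 <= c1%:R :> R by rewrite ler1n.
have k1 : 1 <= k%:R :> R by rewrite ler1n (leq_trans n1_gt0).
have r_gt0 : 0 < r by rewrite divr_gt0//; lra.
have r_le1 : r <= 1 by rewrite ler_pdivrMr// mul1r; have h9 := k9; lra.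
pose kap := alpha * eta / C.
have kap0 : 0 < kap by rewrite divr_gt0// mulr_gt0.
pose t := alpha * c1%:R / n%:R.
have t_ge : kap * r <= t.
  rewrite /kap /t mulrA ler_pM2r ?invr_gt0// -!mulrA ler_pM2l//.
  apply: le_trans c1_ge; rewrite ler_pM2l// ler_pdivrMl//.
have t_ge' : alpha / n%:R <= t by rewrite /t ler_pM2r ?invr_gt0// ler_peMr// ltW.
have t0 : 0 < t by apply: lt_le_trans t_ge; rewrite mulr_gt0.
have t_le : t <= alpha.
  rewrite /t ler_pdivrMr// ler_pM2l// ler_nat; exact: step_up_count_le.
pose X : R := Phibar_inv t.
have XE : Phibar X = t by apply: Phibar_invK; rewrite t0/=; lra.
have Xx0 : x0 <= X by apply: ler_Phibar_inj; rewrite XE x0E; lra.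
have X0 : 0 <= X by apply: le_trans Xx0; exact: ltW.
have Xsq : X ^+ 2 <= - 2 * ln t.
  have := Phibar_le_exp X0; rewrite XE => h.
  have {h} : t <= expR (- X ^+ 2 / 2) by apply: (le_trans h); have := expR_ge0 (- X ^+ 2 / 2); lra.
  rewrite -ler_ln ?posrE ?expR_gt0// expRK; lra.
(* [s_alpha] means [alpha >= 1 / n], so the threshold is at least [n^(-2)]. *)
have X2s : X <= 2 * s.
  have lt : ln alpha - s ^+ 2 <= ln t.
    rewrite -[s ^+ 2]expRK -nE -ln_div ?posrE// ler_ln ?posrE// divr_gt0//.
  rewrite -(ler_pXn2r (_ : (0 < 2)%N)) ?nnegrE//; last by rewrite mulr_ge0// ltW.
  have hs := s_alpha; rewrite exprMn; lra.
(* Many alternatives force a high threshold, hence a small quantile: [X^2 <= - 2 * ln t] with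
   [t >= kap * r], and [- r * ln r <= 1]. *)
have rX : r * (X + 1) <= K.
  have lt : ln kap + ln r <= ln t.
    by rewrite -lnM ?posrE// ler_ln ?posrE//; exact: mulr_gt0.
  have lr : - (r * ln r) <= 1.
    have rV : 0 < r^-1 by rewrite invr_gt0.
    have /ltW := ln_sublinear rV.
    by rewrite lnV ?posrE// -(ler_pM2l r_gt0) mulfV ?gt_eqF// mulrN.
  have lk : - ln kap <= `|ln (C / (alpha * eta))|.
    by rewrite -lnV ?posrE// /kap invf_div ler_norm.
  set B := `|_| in lk *; have B0 : 0 <= B by rewrite normr_ge0.
  have X1 : X + 1 <= 2 + 2 * B - 2 * ln r.
    have hX : X + 1 <= 2 + X ^+ 2 by nra.
    lra.
  have rB : r * B <= B by rewrite ler_piMl.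
  have /le_trans := ler_wpM2l (ltW r_gt0) X1; apply.
  rewrite /power_cst -/B; lra.
have s1 : s * s^-1 = 1 by rewrite mulfV// gt_eqF.
have si0 : 0 < s^-1 by rewrite invr_gt0.
have delta0 : 0 < delta by exact: expR_gt0.
(* From [s >= 11] on, [3 / 32 * s >= 1]. *)
have deltas : delta <= s^-1.
  rewrite /delta_fit expRN lef_pV2 ?posrE ?expR_gt0//.
  have := expR_ge1Dx (3 / 32 * s ^+ 2); have h11 := s11; nra.
set D := delta + r; have D0 : 0 <= D by rewrite addr_ge0 ?ltW.
have DX : D * (X + 1) <= 3 + K.
  have h1 : delta * (X + 1) <= 3.
    apply: (@le_trans _ _ (s^-1 * (2 * s + 1))); first by apply: ler_pM; lra.
    have : s^-1 <= 1 by rewrite invf_le1//; have h11 := s11; lra.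
    by move: s1; lra.
  by rewrite mulrDl lerD.
have X1p : 0 <= X + 1 by lra.
set dsu := 1600 * D / s ^+ 2; set dtu := 1240 * D / s.
have dsu0 : 0 <= dsu by rewrite divr_ge0 ?mulr_ge0 ?ler0n ?exprn_ge0// ltW.
have dtu0 : 0 <= dtu by rewrite divr_ge0 ?mulr_ge0 ?ler0n// ltW.
pose h := dsu * X + dtu.
have h0 : 0 <= h by rewrite addr_ge0// mulr_ge0.
(* As [X <= 2 * s], [4440 = 2 * 1600 + 1240]. *)
have hD : h <= 4440 * D * s^-1.
  have : dsu * X <= dsu * (2 * s) by rewrite ler_wpM2l.
  have -> : dsu * (2 * s) = 3200 * D * s^-1.
    by rewrite /dsu; field; rewrite gt_eqF.
  rewrite /h /dtu; lra.
have hK : h * (X + 1) <= 4440 * (3 + K) * s^-1.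
  apply: (le_trans (ler_wpM2r X1p hD)).
  have := ler_wpM2l (ltW si0) DX; lra.
have hx : h <= X.
  apply: (@le_trans _ _ (h * (X + 1))); first by rewrite ler_peMr// lerDr.
  apply: le_trans Xx0; apply: (le_trans hK).
  by rewrite ler_pdivrMr//; exact: s_x0.
have e3 : 1 <= expR 3 :> R by rewrite -[leLHS]expR0 ler_expR.
have heps : expR 3 * (h * (X + 1)) <= eps.
  apply: (@le_trans _ _ (expR 3 * (4440 * (3 + K) * s^-1))).
    by rewrite ler_wpM2l// expR_ge0.
  by rewrite mulrA ler_pdivrMr; [rewrite mulrCA mulrA; exact: s_eps|exact: sp].
have hX0 : 0 <= h * (X + 1) by rewrite mulr_ge0.
have h1 : h * (X + 1) <= 1.
  apply: (@le_trans _ _ (expR 3 * (h * (X + 1)))); first by rewrite ler_peMl.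
  exact: le_trans heps (ltW e1).
have dh : 0 < delta <= 1 / 2 by rewrite delta0 delta_half.
have [sU tU] := upper_fit k9 nE s4 tail1 tail2 dh ha hb.
have sp0 : 0 < sigma_plus k z.
  move: gz => /andP[_]; apply: lt_le_trans; rewrite subr_gt0.
  exact: ds_fit_lt1.
exact: (BH_subset_perturbed al2 (ltW e0) c1_gt0 sp0 sU tU dsu0 h0 hx h1 heps).
Qed.

End power_pointwise.

(** * Power: comparison of expectations *)

Section power_expectation.
Context {R : realType}.
Variables (n k : nat) (s : R).
Hypothesis k9 : k%:R <= 9 / 10 * n%:R :> R.
Hypothesis nE : n%:R = expR (s ^+ 2).
Hypothesis s4 : 4 <= s.
Hypothesis tail1 : 20 * expR (- s ^+ 2 / 4) <= Phibar (s / 4).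
Hypothesis tail2 : 20 * expR (- (3 / 4 * s ^+ 2)) <= Phibar (4 / 5 * s).
Local Notation delta := (delta_fit s).
Hypothesis delta_half : delta <= 1 / 2.
Hypothesis delta_small : 2004 * delta <= 1.
Variable x0 : R.
Hypothesis x0_gt0 : 0 < x0.
Hypothesis x0E : Phibar x0 = 4 / 10.
Variables (alpha eps eta C rho : R) (m : 'rV[R]_n).
Hypothesis al : 0 < alpha < 4 / 10.
Hypothesis eps01 : 0 < eps < 1.
Hypothesis eta0 : 0 < eta.
Hypothesis C0 : 0 < C.
Hypothesis m0 : forall i, 0 <= m 0 i.
Hypothesis nk : (n1 m <= k)%N.
Hypothesis kn : k%:R <= C * (n1 m)%:R :> R.
Local Notation K := (power_cst alpha eta C).
Hypothesis s11 : 11 <= s.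
Hypothesis s_alpha : - ln alpha <= s ^+ 2.
Hypothesis s_x0 : 4440 * (3 + K) <= x0 * s.
Hypothesis s_eps : 4440 * expR 3 * (3 + K) <= eps * s.
Hypothesis rho01 : 0 <= rho < 1.
Context d (T : measurableType d) (P : probability T R) (Y : {RV P >-> n.-tuple R}).
Hypothesis YG : gaussian_vector Y m (equicorr n rho).
Context d' (T' : measurableType d') (P' : probability T' R) (Y' : {RV P' >-> n.-tuple R}).
Hypothesis YG' : gaussian_vector Y' ((Num.sqrt (1 - rho))^-1 *: m) (equicorr n 0).
Local Notation v := (((Num.sqrt (1 - rho))^-1 *: m) 0).
Local Notation err := (expR (- (1 / 16 * s ^+ 2))).

Lemma TDP_ge0 S : 0 <= TDP m S :> R.
Proof. by rewrite divr_ge0. Qed.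

Lemma TDP_le1 S : TDP m S <= 1 :> R.
Proof.
rewrite /TDP ler_pdivrMr ?ltr0n ?leq_max ?orbT// mul1r ler_nat leq_max.
by rewrite subset_leq_card// subsetIr.
Qed.

Lemma measurable_TDP_oracle : measurable_fun setT (fun y : n.-tuple R =>
  TDP m (step_up [set: 'I_n]%SET alpha (pval y 0 1))).
Proof.
have h := @measurable_pval_array R n _ R alpha (cst 0) (cst 1)
  (fun a => TDP m (arr_set [set: 'I_n]%SET a)) (measurable_cst _) (measurable_cst _).
apply: (eq_measurable_fun _ _ h) => y _ /=; by rewrite step_upE.
Qed.

(** A coupling: after the reduction both models are the same sample [gauss n] shifted by
    [m / sqrt (1 - rho)], so the pointwise comparison can be integrated. The lower and the upper fit
    each fail with probability at most [6 * err]. *)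
Lemma expectation_TDP_le :
  ('E_P'[fun w => TDP m (BH alpha 0 1 (Y' w))] <=
   'E_P[fun w => TDP m (BH (alpha * (1 + eps)) (theta_plus k (Y w))
                           (sigma_plus k (Y w)) (Y w))] + (eta + 12 * err)%:E)%E.
Proof.
have [al0 al1] := andP al; have [e0 e1] := andP eps01.
have np : (0 < n)%N by rewrite -(ltr0n R) nE expR_gt0.
have [q1 q2] := @quantile_ranks R n np.
have q3 : (0 < qn' R n <= n)%N.
  by case/andP: q1 => _ h; case/andP: q2 => -> /leq_trans; apply.
have b0 : 0 <= alpha * (1 + eps) by rewrite mulr_ge0 ?addr_ge0// ltW.
rewrite (expectation_BH k np rho01 YG b0 TDP_ge0) unlock.
under eq_integral do rewrite BH_step_up.
rewrite (integral_independent (f := fun y => (TDP m (step_up [set: 'I_n]%SET alpha (pval y 0 1)))%:E) YG').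
- set f1 := fun y : n.-tuple R => TDP m (step_up [set: 'I_n]%SET alpha (pval (shift v y) 0 1)).
  set f2 := fun y : n.-tuple R => TDP m (step_up [set: 'I_n]%SET (alpha * (1 + eps)) (plus_pval k (shift v y))).
  have mf1 : measurable_fun setT f1.
    exact: (measurableT_comp measurable_TDP_oracle (measurable_shift v)).
  have mf2 : measurable_fun setT f2.
    exact: (@measurable_step_up R n k (alpha * (1 + eps)) [set: 'I_n]%SET v (TDP m) np).
  have sr : 0 < Num.sqrt (1 - rho) by rewrite sqrtr_gt0 subr_gt0; case/andP: rho01.
  have v0 i : 0 <= v i by rewrite mxE mulr_ge0// invr_ge0 ltW.
  have vk : (n - k <= #|[set i | v i == 0%R]%SET|)%N.
    apply: leq_trans (null_cards _ m0); last by rewrite invr_gt0.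
    exact: leq_sub2l.
  have mA := measurableC (measurable_good_fit k (dt_fit s delta) (ds_fit s delta) q1 q2).
  have pA := probability_bad_fit k9 nE s4 tail1 tail2 delta_half v0 vk.
  have pB := probability_bad_upper_fit k9 nE s4 tail1 delta_half v0 vk.
  set A := [set y | _ ] in pA; set B := [set y | _] in pB.
  have mA' : measurable A.
    rewrite -[X in measurable X]setTI (_ : A = shift v @^-1` (~` [set y | good_fit k (dt_fit s delta) (ds_fit s delta) y])).
      exact: (measurable_shift v measurableT mA).
    by apply/seteqP; split => y /negP.
  have ms q : (0 < q <= n)%N -> measurable_fun setT (fun y : n.-tuple R => order_stat (shift v y) q).
    by move=> hq; exact: (measurableT_comp (measurable_order_stat hq) (measurable_shift v)).
  have mB : measurable B.
    rewrite (_ : B = ~` [set y : n.-tuple R | order_stat (shift v y) (qn R n) <=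
          - (Phibar_inv ((1 + delta) * (qn R n)%:R / (n%:R - k%:R)) : R)] `|`
        ~` [set y : n.-tuple R | - (Phibar_inv ((1 - delta) * (qn' R n)%:R / n%:R) : R)
          <= order_stat (shift v y) (qn' R n)]).
      apply: measurableU; apply: measurableC.
        exact: (measurable_le_set (ms _ q1) (measurable_cst _)).
      exact: (measurable_le_set (measurable_cst _) (ms _ q3)).
    by apply/seteqP; split => y /= [] h; [left|right|left|right]; move: h; rewrite ltNge => /negP.
  (* On the exceptional events the trivial bound [f1 <= 1] is absorbed by an indicator. *)
  have le y : f1 y <= f2 y + (eta + (\1_A y + \1_B y)).
    have i0 D : 0 <= \1_D y :> R by rewrite indicE ler0n.
    have [gA|gA] := boolP (good_fit k (dt_fit s delta) (ds_fit s delta) (shift v y)); last first.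
      have -> : \1_A y = 1 :> R by rewrite indicE mem_set.
      have := TDP_le1 (step_up [set: 'I_n]%SET alpha (pval (shift v y) 0 1)); rewrite -/(f1 y).
      have := TDP_ge0 (step_up [set: 'I_n]%SET (alpha * (1 + eps)) (plus_pval k (shift v y))); rewrite -/(f2 y).
      have := i0 B; have := eta0; lra.
    have [gB|gB] := pselect (B y).
      have -> : \1_B y = 1 :> R by rewrite indicE mem_set.
      have := TDP_le1 (step_up [set: 'I_n]%SET alpha (pval (shift v y) 0 1)); rewrite -/(f1 y).
      have := TDP_ge0 (step_up [set: 'I_n]%SET (alpha * (1 + eps)) (plus_pval k (shift v y))); rewrite -/(f2 y).
      have := i0 A; have := eta0; lra.
    have gz : good_two_sided k s (shift v y).
      split => //; first by rewrite leNgt; apply/negP => h; apply: gB; left.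
      by rewrite leNgt; apply/negP => h; apply: gB; right.
    have := TDP_comparison k9 nE s4 tail1 tail2 delta_half delta_small x0_gt0 x0E
      al eps01 eta0 C0 nk kn s11 s_alpha s_x0 s_eps gz.
    rewrite -/(f1 y) -/(f2 y); have := i0 A; have := i0 B; lra.
  have mI (D : set (n.-tuple R)) : measurable D -> measurable_fun setT (fun y => (\1_D y)%:E : \bar R).
    by move=> mD; apply/measurable_EFinP; exact: measurable_indic.
  apply: (@le_trans _ _ (\int[gauss n]_y ((f2 y)%:E + (eta%:E + ((\1_A y)%:E + (\1_B y)%:E))))%E).
    apply: ge0_le_integral => //.
    + by move=> y _; rewrite lee_fin TDP_ge0.
    + by apply/measurable_EFinP; exact: mf1.
    + apply: emeasurable_funD; first by apply/measurable_EFinP; exact: mf2.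
      apply: emeasurable_funD; first exact: measurable_cst.
      by apply: emeasurable_funD; exact: mI.
    + by move=> y _; rewrite -!EFinD lee_fin le.
  have i0 D (y : n.-tuple R) : (0 <= (\1_D y)%:E :> \bar R)%E by rewrite lee_fin indicE ler0n.
  rewrite ge0_integralD//.
  + rewrite leeD2l// ge0_integralD//.
    * rewrite integral_cst//= probability_setT mule1 EFinD leeD2l//.
      rewrite ge0_integralD//; try exact: mI.
      rewrite !integral_indic ?setIT//.
      apply: (le_trans (leeD pA pB)); rewrite -EFinD lee_fin.
      set E := err; lra.
    * by move=> y _; rewrite lee_fin ltW.
    * by move=> y _; rewrite adde_ge0.
    * by apply: emeasurable_funD; exact: mI.
  + by move=> y _; rewrite lee_fin TDP_ge0.
  + by apply/measurable_EFinP; exact: mf2.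
  + by move=> y _; rewrite !adde_ge0// lee_fin ltW.
  + apply: emeasurable_funD; first exact: measurable_cst.
    by apply: emeasurable_funD; exact: mI.
- by apply/measurable_EFinP; exact: measurable_TDP_oracle.
- by move=> y; rewrite lee_fin TDP_ge0.
Qed.

End power_expectation.

(** * Passage to the limit and conclusion *)

Lemma limn_esup_le0 {R : realType} (u : (\bar R)^nat) :
  (forall e : R, 0 < e -> \forall n \near \oo, (u n <= e%:E)%E) ->
  (limn_esup u <= 0)%E.
Proof.
move=> h; apply/lee_addgt0Pr => e e0; rewrite add0e.
apply: (@le_trans _ _ (ereal_sup (u @` [set n | (u n <= e%:E)%E]))).
  by apply: ereal_inf_lbound; exists [set n | (u n <= e%:E)%E] => //; exact: h.
by apply: ge_ereal_sup => _ [n /= un <-].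
Qed.

Lemma near_sqrt_ln {R : realType} (M : R) :
  \forall n \near \oo, M <= Num.sqrt (ln (n%:R : R)).
Proof.
near=> n.
have nM : expR (M ^+ 2) <= n%:R by near: n; exact: nbhs_infty_ger.
apply: (le_trans (ler_norm M)); rewrite -sqrtr_sqr ler_sqrt.
  by rewrite -[M ^+ 2]expRK ler_ln ?posrE ?expR_gt0// (lt_le_trans _ nM) ?expR_gt0.
by rewrite ln_ge0// (le_trans _ nM)// -expR0 ler_expR sqr_ge0.
Unshelve. all: by end_near. Qed.

(** Bounds the error term of [expectation_TDP_le] using [expR (- u) <= 1 / u];
    [384 = 2 * 12 * 16]. *)
Lemma expR_sqr_small {R : realType} (e s : R) : 0 < e -> 1 <= s -> 384 / e <= s ->
  12 * expR (- (1 / 16 * s ^+ 2)) <= e / 2.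
Proof.
move=> e0 s1 se; have s0 : 0 < s by exact: lt_le_trans s1.
have s20 : 0 < s ^+ 2 by rewrite exprn_gt0.
have h1 : expR (- (1 / 16 * s ^+ 2)) <= 16 / s ^+ 2.
  rewrite expRN -[16 / s ^+ 2]invf_div lef_pV2 ?posrE ?expR_gt0 ?divr_gt0//.
  have := expR_ge1Dx (1 / 16 * s ^+ 2); lra.
have h2 : 192 / s ^+ 2 <= e / 2.
  rewrite ler_pdivrMr//; move: se; rewrite ler_pdivrMr// => se; nra.
lra.
Qed.

Theorem corollary5p5 (R : realType) :
  exists2 c : R, 0 < c &
  (forall (n : nat) (alpha rho : R) (m : 'rV[R]_n) (k0 : nat)
      (d : measure_display) (T : measurableType d) (P : probability T R)
      (Y : {RV P >-> n.-tuple R}),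
    (2 <= n)%N -> 0 < alpha < 4 / 10 -> 0 <= rho < 1 ->
    (forall i, 0 <= m 0 i) ->
    (n1 m <= k0)%N -> k0%:R <= 9 / 10 * n%:R :> R ->
    gaussian_vector Y m (equicorr n rho) ->
    (maxe ('E_P[fun w => FDP m (BH alpha (theta_plus k0 (Y w))
                                   (sigma_plus k0 (Y w)) (Y w))]
           - ((n0 m)%:R / n%:R * alpha)%:E) 0
       <= (c * (ln n%:R / n%:R `^ (1 / 16)))%:E)%E
    /\
    (maxe ((1 - alpha)%:E
           - P [set w | forall S : {set 'I_n},
                  (FDP m S <= FDPbar alpha (theta_plus k0 (Y w))
                                (sigma_plus k0 (Y w)) (Y w) S)%R]) 0
       <= (c * (ln n%:R / n%:R `^ (1 / 16)))%:E)%E)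
  /\
  (forall (alpha rho : R) (eps : nat -> R) (m : forall n : nat, 'rV[R]_n)
      (k0 : nat -> nat)
      (d : nat -> measure_display) (T : forall n, measurableType (d n))
      (P : forall n, probability (T n) R)
      (Y : forall n, {RV (P n) >-> n.-tuple R})
      (d' : nat -> measure_display) (T' : forall n, measurableType (d' n))
      (P' : forall n, probability (T' n) R)
      (Y' : forall n, {RV (P' n) >-> n.-tuple R}),
    0 < alpha < 4 / 10 -> 0 <= rho < 1 ->
    (forall n, (2 <= n)%N -> 0 < eps n < 1) ->
    eps n @[n --> \oo] --> (0 : R) ->
    eps n * Num.sqrt (ln n%:R) @[n --> \oo] --> +oo ->
    (forall n, (2 <= n)%N -> forall i, 0 <= m n 0 i) ->
    (forall n, (2 <= n)%N -> (n1 (m n) <= k0 n)%N) ->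
    (forall n, (2 <= n)%N -> (k0 n)%:R <= 9 / 10 * n%:R :> R) ->
    asymp (fun n => (n1 (m n))%:R / n%:R : R) (fun n => (k0 n)%:R / n%:R) ->
    (forall n, (2 <= n)%N -> gaussian_vector (Y n) (m n) (equicorr n rho)) ->
    (forall n, (2 <= n)%N ->
      gaussian_vector (Y' n) ((Num.sqrt (1 - rho))^-1 *: m n) (equicorr n 0)) ->
    (limn_esup (fun n : nat =>
       'E_(P' n)[fun w => TDP (m n) (BH alpha 0 1 (Y' n w))]
       - 'E_(P n)[fun w =>
           TDP (m n) (BH (alpha * (1 + eps n))
                         (theta_plus (k0 n) (Y n w))
                         (sigma_plus (k0 n) (Y n w)) (Y n w))]) <= 0)%E).
Proof.
have [c c0 h] := @FDP_control R; exists c => //; split; first exact: h.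
move=> alpha rho eps m k0 d T P Y d' T' P' Y' al rho01 eps01 _ epsinf m0 nk k9 [C C0 asy] YG YG'.
have [S [x0 [S4 x0p x0E hS]]] := @eventually_fit R.
apply: limn_esup_le0 => e e0.
have e20 : 0 < e / 2 by rewrite divr_gt0.
(* Half of [e] is the proportion below which the oracle is ignored; the other half covers the
   exceptional events. *)
pose K := power_cst alpha (e / 2) C.
near=> n.
have n2 : (2 <= n)%N by near: n; exact: nbhs_infty_ge.
have sS : S <= Num.sqrt (ln (n%:R : R)) by near: n; exact: (@near_sqrt_ln R).
have s11 : 11 <= Num.sqrt (ln (n%:R : R)) by near: n; exact: (@near_sqrt_ln R).
have sa : `|ln alpha| <= Num.sqrt (ln (n%:R : R)) by near: n; exact: (@near_sqrt_ln R).
have sx : 4440 * (3 + K) / x0 <= Num.sqrt (ln (n%:R : R)) by near: n; exact: (@near_sqrt_ln R).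
have se : 384 / e <= Num.sqrt (ln (n%:R : R)) by near: n; exact: (@near_sqrt_ln R).
have seps : 4440 * expR 3 * (3 + K) <= eps n * Num.sqrt (ln n%:R).
  near: n; move/cvgryPge: epsinf; exact.
set s := Num.sqrt (ln (n%:R : R)) in sS s11 sa sx se seps *.
have [t1 t2 d1 _ d3] := hS _ sS.
have s4 : 4 <= s by exact: le_trans sS.
have s1 : 1 <= s by apply: le_trans s4; rewrite ler1n.
have ss2 : s <= s ^+ 2 by rewrite expr2 ler_peMr// (le_trans ler01).
have nR : 0 < n%:R :> R by rewrite ltr0n ltnW.
have nE : n%:R = expR (s ^+ 2).
  by rewrite sqr_sqrtr ?lnK ?posrE// ln_ge0// ler1n ltnW.
have kn : (k0 n)%:R <= C * (n1 (m n))%:R.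
  have [_] := asy _ n2; by rewrite mulrA ler_pM2r// invr_gt0.
have s_alpha : - ln alpha <= s ^+ 2.
  by apply: le_trans ss2; apply: le_trans sa; rewrite -normrN ler_norm.
have s_x0 : 4440 * (3 + K) <= x0 * s by rewrite [leRHS]mulrC -ler_pdivrMr.
have := expectation_TDP_le (k9 n n2) nE s4 t1 t2 d1 d3 x0p x0E al (eps01 n n2) e20 C0
  (m0 n n2) (nk n n2) kn s11 s_alpha s_x0 seps rho01 (YG n n2) (YG' n n2).
set E1 := expectation _ _; set E2 := expectation _ _ => E12.
(* The difference is taken in the extended reals, where [E2] can change sides only if it is
   finite. *)
have E2fin : E2 \is a fin_num.
  have np : (0 < n)%N by exact: ltnW.
  have al0 : 0 <= alpha * (1 + eps n).
    have /andP[a0 _] := al; have /andP[z0 _] := eps01 n n2.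
    by rewrite mulr_ge0 ?addr_ge0// ltW.
  rewrite /E2 (expectation_BH (k0 n) np rho01 (YG n n2) al0 (TDP_ge0 (m n))).
  rewrite ge0_fin_numE; last by apply: integral_ge0 => y _; rewrite lee_fin TDP_ge0.
  apply: (@le_lt_trans _ _ (\int[gauss n]_y cst 1%E y)%E).
    apply: ge0_le_integral => //.
    - by move=> y _; rewrite lee_fin TDP_ge0.
    - by apply/measurable_EFinP; exact: (measurable_step_up (k0 n) _ _ _ (TDP (m n)) np).
    - by move=> y _; rewrite lee_fin TDP_le1.
  by rewrite integral_cst//= probability_setT mule1 ltry.
rewrite leeBlDr// addeC; apply: (le_trans E12).
rewrite leeD2l// lee_fin [leRHS]splitr lerD2l.
exact: expR_sqr_small.
Unshelve. all: by end_near.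
Qed.
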